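(* Let $d>1$ be a squarefree integer. (1) Let $(X_n,Y_n)$ be the $n$th solution in positive integers of the equation $X^2-dY^2=\pm 1$. If $X_n\in\{C_m,B_m\}$ for some integer $m\ge 0$, then $n=1$. (2) Let $(W_n,Z_n)$ be the $n$th solution in positive integers of the equation $W^2-dZ^2=\pm 4$. If $W_n\in\{C_m,B_m\}$ for some integer $m\ge 0$, then either $n\in\{1,3\}$, or $n=2$ and one of the following holds: (a) $d=2$, $(W_1,Z_1)=(2,2)$ and $W_2=B_2=6$, with $6^2-2\cdot 4^2=4$; (b) $d=3$, $(W_1,Z_1)=(4,2)$ and $W_2=C_4=14$, with $14^2-3\cdot 8^2=4$.
   Context: For $m\ge 0$, $B_m=\binom{2m}{m}$ and $C_m=\frac{1}{m+1}\binom{2m}{m}$ is the $m$th Catalan number. The solutions of $X^2-dY^2=\pm1$ are the pairs of positive integers $(X,Y)$ satisfying either $X^2-dY^2=1$ or $X^2-dY^2=-1$ (the two equations are taken together, not separately), and $(X_n,Y_n)$, $n\ge 1$, is the $n$th such pair in increasing order of $X$. Likewise, $(W_n,Z_n)$, $n\ge1$, is the $n$th pair in increasing order of $W$ among all pairs of positive integers $(W,Z)$ with $W^2-dZ^2=4$ or $W^2-dZ^2=-4$. *)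

(* Defs.v *)
From mathcomp Require Import all_boot all_order all_algebra.

Set Implicit Arguments.
Unset Strict Implicit.
Unset Printing Implicit Defensive.

Import Order.TTheory GRing.Theory Num.Theory.

Definition squarefree (d : nat) : Prop := forall k : nat, k ^ 2 %| d -> k = 1%N.

Definition central_binom (m : nat) : nat := 'C(m.*2, m).

(* The division is exact: m + 1 divides the m-th central binomial coefficient. *)
Definition catalan (m : nat) : nat := central_binom m %/ m.+1.

(* Positive solutions of x^2 - d y^2 = N or x^2 - d y^2 = -N, the two signs
   being taken together; the equations are over the integers. *)
Definition pell_solution (N : int) (d x y : nat) : Prop :=
  [/\ (0 < x)%N, (0 < y)%N
    & ((x%:Z ^+ 2 - d%:Z * y%:Z ^+ 2 = N)%R
       \/ (x%:Z ^+ 2 - d%:Z * y%:Z ^+ 2 = - N)%R)].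

(* (x, y) is the n-th pair, n >= 1, in increasing order of the first component
   among the pairs satisfying S: exactly n - 1 such pairs, listed without
   repetition by s, have a smaller first component. For the sets of solutions
   of x^2 - d y^2 = +-1 and x^2 - d y^2 = +-4 with d > 1 squarefree, distinct
   pairs have distinct first components, so this is the usual numbering. *)
Definition nth_pair (S : nat -> nat -> Prop) (n x y : nat) : Prop :=
  S x y /\
  exists s : seq (nat * nat),
    [/\ uniq s,
        forall p : nat * nat, p \in s <-> S p.1 p.2 /\ (p.1 < x)%N
      & n = (size s).+1].

(* Main.v *)
Require Import Defs.
From mathcomp Require Import all_boot all_order all_algebra.
From mathcomp Require Import closed_field.
From mathcomp Require Import zify ring lra.
From mathcomp Require Import ssrZ.
From mathcomp Require Import Rstruct.
From Stdlib Require BinInt BinNat Nnat Classical_Prop Reals.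

Set Implicit Arguments.
Unset Strict Implicit.
Unset Printing Implicit Defensive.
Import Order.TTheory GRing.Theory Num.Theory.

(** * P1 *)
Local Open Scope ring_scope.

Fixpoint lucas (R : comNzRingType) (P N : R) (k : nat) : R :=
  match k with
  | 0 => 2
  | k1.+1 => if k1 is k2.+1 then P * lucas P N k1 - N * lucas P N k2 else P
  end.

Lemma lucasSS (R : comNzRingType) (P N : R) k :
  lucas P N k.+2 = P * lucas P N k.+1 - N * lucas P N k.
Proof. by []. Qed.

Lemma lucas_roots (R : comNzRingType) (a b : R) k :
  lucas (a + b) (a * b) k = a ^+ k + b ^+ k.
Proof.
suff: lucas (a + b) (a * b) k = a ^+ k + b ^+ k
   /\ lucas (a + b) (a * b) k.+1 = a ^+ k.+1 + b ^+ k.+1 by case.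
elim: k => [|k [IH0 IH1]]; first by rewrite /= !expr0 !expr1.
split=> //; rewrite lucasSS IH0 IH1 !exprS; ring.
Qed.

Lemma rmorph_lucas (R S : comNzRingType) (f : {rmorphism R -> S}) P N k :
  f (lucas P N k) = lucas (f P) (f N) k.
Proof.
suff: f (lucas P N k) = lucas (f P) (f N) k
   /\ f (lucas P N k.+1) = lucas (f P) (f N) k.+1 by case.
elim: k => [|k [IH0 IH1]]; first by rewrite /= rmorph_nat.
by split=> //; rewrite !lucasSS rmorphB !rmorphM IH0 IH1.
Qed.

Lemma quadratic_roots (F : countFieldType) (P N : F) :
  exists (K : closedFieldType) (f : {rmorphism F -> K}) (a b : K),
    f P = a + b /\ f N = a * b.
Proof.
have [K [f _]] := countable_algebraic_closure F.
have [a] := @solve_monicpoly K 2%N (fun i => nth 0 [:: - f N; f P] i) isT.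
rewrite !big_ord_recl big_ord0 /= addr0 expr0 expr1 mulr1 => a2.
exists K, f, a, (f P - a); split; first by rewrite addrC subrK.
rewrite mulrBr -expr2 a2; ring.
Qed.

Lemma lucasM (P N : int) j k :
  lucas P N (j * k) = lucas (lucas P N k) (N ^+ k) j.
Proof.
have [K [f [a [b [fP fN]]]]] := quadratic_roots (P%:~R : rat) (N%:~R).
pose g : {rmorphism int -> K} := f \o intr.
have gI : injective g by move=> x y /fmorph_inj/(@intr_inj rat).
have [gP gN] : g P = a + b /\ g N = a * b by [].
apply: gI; rewrite !rmorph_lucas rmorphXn gP gN.
by rewrite exprMn !lucas_roots mulnC !exprM.
Qed.

(** * P2 *)

Definition pell4 (e d n x y : int) : Prop :=
  [/\ 0 < x, 0 < y, n = 1 \/ n = -1, x ^+ 2 - d * y ^+ 2 = 4 * n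
    & (exists x0, x = e * x0) /\ (exists y0, y = e * y0)].

Lemma small_square_gap (d y t c : int) :
  1 < d -> 0 < y -> 0 < t -> d * (t * (2 * y + t)) = 4 * c -> c <= 2 -> False.
Proof.
move=> d1 y0 t0 E c2.
have [t1|[t2|t3]] : t = 1 \/ t = 2 \/ 3 <= t by lia.
- subst t; have [y1|[y2|y3]] : y = 1 \/ y = 2 \/ 3 <= y by lia.
  + by subst; lia.
  + by subst; lia.
  have : 2 * 7 <= d * (1 * (2 * y + 1)) by apply: ler_pM; lia.
  by lia.
- have : 2 * (2 * 4) <= d * (t * (2 * y + t)) by apply: ler_pM; lia.
  by lia.
have : 2 * (3 * 5) <= d * (t * (2 * y + t)) by apply: ler_pM; [lia|lia|lia|apply: ler_pM; lia].
by lia.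
Qed.

Lemma pell4_y_unique (e d n n' x y y' : int) :
  1 < d -> pell4 e d n x y -> pell4 e d n' x y' -> n = n' /\ y = y'.
Proof.
move=> d1 [x0 y0 hn E _] [_ y0' hn' E' _].
have F : d * (y ^+ 2 - y' ^+ 2) = 4 * (n' - n) by rewrite mulrBr !expr2 in E E' *; lia.
have [yy'|[yy'|yy']] : y = y' \/ y < y' \/ y' < y by lia.
- by split=> //; subst; lia.
- have G : d * ((y' - y) * (2 * y + (y' - y))) = 4 * (n - n').
    by rewrite -[n - n']opprB mulrN -F; ring.
  by case: (small_square_gap _ _ _ G); lia.
have G : d * ((y - y') * (2 * y' + (y - y'))) = 4 * (n' - n) by rewrite -F; ring.
by case: (small_square_gap _ _ _ G); lia.
Qed.

Lemma consecutive_even (z : int) : exists w, z * (z - 1) = 2 * w.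
Proof.
have [w [->|->]] : exists w, z = 2 * w \/ z = 2 * w + 1.
  by exists (z %/ 2)%Z; lia.
- by exists (w * (2 * w - 1)); ring.
by exists ((2 * w + 1) * w); ring.
Qed.

Lemma pell4_descend (e d n N x y a b : int) :
  (e = 1 \/ e = 2) -> 1 < d -> pell4 e d n x y -> pell4 e d N a b ->
  exists x' y', [/\ 2 * x' = N * (x * a - d * y * b),
    2 * y' = N * (y * a - x * b),
    exists x0, x' = e * x0 & exists y0, y' = e * y0].
Proof.
move=> he d1 [x0 y0 hn E [[xe xE] [ye yE]]] [a0 b0 hN E' [[ae aE] [be bE]]].
case: he => he; subst e; last first.
  exists (N * (2 * (xe * ae - d * ye * be))), (N * (2 * (ye * ae - xe * be))).
  split; first by subst; ring.
  - by subst; ring.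
  - by exists (N * (xe * ae - d * ye * be)); ring.
  by exists (N * (ye * ae - xe * be)); ring.
have par z1 z2 n1 : z1 ^+ 2 - d * z2 ^+ 2 = 4 * n1 -> exists u, z1 = d * z2 + 2 * u.
  move=> Ez; have [w1 w1E] := consecutive_even z1; have [w2 w2E] := consecutive_even z2.
  have Ew : z1 ^+ 2 - d * z2 ^+ 2 = 2 * w1 + z1 - (d * w2) * 2 - d * z2.
    rewrite -w1E; have -> : d * w2 * 2 = d * (2 * w2) by ring.
    by rewrite -w2E; ring.
  exists (2 * n1 - w1 + d * w2); rewrite Ez in Ew; lia.
have [u uE] := par _ _ _ E.
have [v vE] := par _ _ _ E'.
have [w wE] := consecutive_even d.
exists (N * (d * b * u + d * y * v + 2 * u * v + w * y * b)), (N * (y * v - u * b)).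
split; last 2 first.
- by eexists; rewrite mul1r.
- by eexists; rewrite mul1r.
- have -> : x * a - d * y * b =
   2 * (d * b * u + d * y * v + 2 * u * v) + (d * (d - 1)) * (y * b).
    by rewrite uE vE; ring.
  by rewrite wE; ring.
by rewrite uE vE; ring.
Qed.

Lemma pell4_quotient (e d n N x y a b : int) :
  (e = 1 \/ e = 2) -> 1 < d -> pell4 e d n x y -> pell4 e d N a b -> a <= x ->
  exists x' y', [/\ 2 * x = x' * a + d * y' * b, 2 * y = x' * b + y' * a
    & (x' = 2 /\ y' = 0) \/ (exists n', pell4 e d n' x' y') /\ x' < x].
Proof.
move=> he d1 sx sa ax.
have [x' [y' [x'E y'E xe ye]]] := pell4_descend he d1 sx sa.
have [x0 y0 hn E _] := sx; have [a0 b0 hN E' _] := sa.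
have N2 : N * N = 1 by case: hN => ->.
exists x', y'.
have two_neq0 : (2 : int) != 0 by [].
have Ex : 2 * x = x' * a + d * y' * b.
  apply: (mulfI two_neq0); transitivity (N * x * (a ^+ 2 - d * b ^+ 2)).
    by rewrite E'; transitivity (4 * (N * N) * x); [rewrite N2|]; ring.
  by rewrite [RHS]mulrDr !mulrA x'E [2 * d]mulrC -[d * 2 * y']mulrA y'E; ring.
have Ey : 2 * y = x' * b + y' * a.
  apply: (mulfI two_neq0); transitivity (N * y * (a ^+ 2 - d * b ^+ 2)).
    by rewrite E'; transitivity (4 * (N * N) * y); [rewrite N2|]; ring.
  by rewrite [RHS]mulrDr !mulrA x'E y'E; ring.
have En : x' ^+ 2 - d * y' ^+ 2 = 4 * (n * N).
  apply: (mulfI (mulf_neq0 two_neq0 two_neq0)).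
  transitivity ((N * N) * ((x ^+ 2 - d * y ^+ 2) * (a ^+ 2 - d * b ^+ 2))).
    transitivity ((2 * x') ^+ 2 - d * (2 * y') ^+ 2); first by ring.
    by rewrite x'E y'E; ring.
  by rewrite N2 E E'; ring.
have y'0 : 0 <= y'.
  have F : d * (y * a - x * b) * (y * a + x * b) = 4 * (N * x ^+ 2 - n * a ^+ 2).
    transitivity (a ^+ 2 * (x ^+ 2 - 4 * n) - x ^+ 2 * (a ^+ 2 - 4 * N)); last by ring.
    by rewrite -E -E'; ring.
  have S0 : 0 < y * a + x * b by rewrite addr_gt0 ?mulr_gt0.
  have ax2 : a ^+ 2 <= x ^+ 2 by rewrite ler_sqr ?nnegrE // ltW.
  rewrite -(pmulr_rge0 _ (isT : 0 < (2 : int))) y'E leNgt; apply/negP => D.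
  have a2 : 0 <= a ^+ 2 by rewrite sqr_ge0.
  have d0 : 0 < d by lia.
  case: hN => hN; rewrite hN in D F.
    have : 0 < d * - (y * a - x * b) * (y * a + x * b).
      by rewrite !mulr_gt0 //; lia.
    by rewrite mulrN mulNr F; case: hn => ->; lia.
  have : 0 < d * (y * a - x * b) * (y * a + x * b) by rewrite !mulr_gt0 //; lia.
  by rewrite F; case: hn => ->; lia.
have x'0 : 0 < x'.
  have F : N * (x * a - d * y * b) * (x * a + d * y * b)
      = 4 * (x ^+ 2 + n * N * a ^+ 2 - 4 * n).
    transitivity (N * (x ^+ 2 * a ^+ 2 - (d * y ^+ 2) * (d * b ^+ 2))); first by ring.
    have -> : d * y ^+ 2 = x ^+ 2 - 4 * n by rewrite -E; ring.
    have -> : d * b ^+ 2 = a ^+ 2 - 4 * N by rewrite -E'; ring.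
    by transitivity (4 * (N * N * x ^+ 2 + n * N * a ^+ 2 - 4 * n * (N * N)));
      [ring|rewrite N2; ring].
  have S0 : 0 < x * a + d * y * b.
    by rewrite addr_gt0 ?mulr_gt0 //; lia.
  rewrite -(pmulr_rgt0 _ (isT : 0 < (2 : int))) x'E -(pmulr_lgt0 _ S0) F.
  rewrite pmulr_rgt0 //.
  have ax2 : a ^+ 2 <= x ^+ 2 by rewrite ler_sqr ?nnegrE // ltW.
  have a2 : 0 < a ^+ 2 by rewrite exprn_gt0.
  have dy2 : 2 <= d * y ^+ 2.
    by rewrite -[2]mulr1; apply: ler_pM => //; rewrite -gtz0_ge1 exprn_gt0.
  case: hn => hn; case: hN => hN; rewrite hn hN in E E' *; try lia.
  have [xa|xa] := eqVneq x a.
    by have [] := pell4_y_unique d1 sx (_ : pell4 e d N x b); rewrite ?xa // hn hN.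
  have {}xa : a + 1 <= x by lia.
  have : (a + 1) ^+ 2 <= x ^+ 2 by rewrite ler_sqr ?nnegrE; lia.
  have -> : (a + 1) ^+ 2 = a ^+ 2 + 2 * a + 1 by ring.
  have [a1|a1] : a = 1 \/ 2 <= a by lia.
    by rewrite a1; lia.
  by lia.
split=> //.
case: (eqVneq y' 0) => [y'z|y'n]; [left|right].
  split=> //; move: En; rewrite y'z expr0n mulr0 subr0 => En.
  have [x1|[x1|x1]] : x' = 1 \/ x' = 2 \/ 3 <= x' by lia.
  - by move: En; rewrite x1; lia.
  - by [].
  have : 3 ^+ 2 <= x' ^+ 2 by rewrite ler_sqr ?nnegrE; lia.
  by rewrite En; case: hn => ->; case: hN => ->; lia.
split.
  by exists (n * N); split=> //; [lia|case: hn => ->; case: hN => ->; auto].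
have y'1 : 1 <= y' by lia.
rewrite -(ltr_pM2l (isT : 0 < (2 : int))) Ex.
have [a1|a2] : a = 1 \/ 2 <= a by lia.
  have db5 : d * b ^+ 2 = 5.
    have : 0 < d * b ^+ 2 by rewrite mulr_gt0 ?exprn_gt0 //; lia.
    by move: E'; rewrite a1; clear -hN; case: hN => ->; lia.
  have b1 : b = 1.
    have [//|b2] : b = 1 \/ 2 <= b by lia.
    have : 2 * 2 ^+ 2 <= d * b ^+ 2 by apply: ler_pM; rewrite ?ler_sqr ?nnegrE //; lia.
    by rewrite db5.
  have d5 : d = 5 by move: db5; rewrite b1 expr1n mulr1.
  suff : x' < 5 * y' by rewrite a1 b1 d5; clear; lia.
  rewrite -ltr_sqr ?nnegrE ?mulr_ge0 ?(ltW x'0) //.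
  have : 1 ^+ 2 <= y' ^+ 2 by rewrite ler_sqr ?nnegrE.
  rewrite exprMn; move: En; rewrite d5; clear -hn hN.
  by case: hn => ->; case: hN => ->; lia.
have : 2 * x' <= a * x' by rewrite ler_pM2r.
have : 0 < d * y' * b by rewrite !mulr_gt0 //; lia.
by rewrite [x' * a]mulrC; clear; lia.
Qed.

Lemma pell4_structure (e d N x y n a b : int) :
  (e = 1 \/ e = 2) -> 1 < d -> pell4 e d N a b ->
  (forall n' x' y', pell4 e d n' x' y' -> a <= x') ->
  pell4 e d n x y -> exists k, x = lucas a N k.+1.
Proof.
move=> he d1 sa amin sx.
suff: exists k, x = lucas a N k.+1 /\ d * y * b = 2 * lucas a N k.+2 - a * lucas a N k.+1.
  by case=> k [? _]; exists k.
have : exists m : nat, x < m%:Z by exists `|x|%N.+1; lia.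
case=> m; elim: m => [|m IH] in n x y sx *; first by case: sx; lia.
move=> xm; have [x' [y' [Ex Ey H]]] := pell4_quotient he d1 sx sa (amin _ _ _ sx).
have [_ _ _ Ea _] := sa.
have two_neq0 : (2 : int) != 0 by [].
suff [k [x'k y'k]] : exists k, x' = lucas a N k /\ d * y' * b = 2 * lucas a N k.+1 - a * lucas a N k.
  exists k; split.
    by apply: (mulfI two_neq0); rewrite Ex x'k y'k; ring.
  apply: (mulfI two_neq0).
  transitivity (d * b * (2 * y)); first by ring.
  rewrite Ey; transitivity ((d * b ^+ 2) * x' + a * (d * y' * b)); first by ring.
  have -> : d * b ^+ 2 = a ^+ 2 - 4 * N by rewrite -Ea; ring.
  by rewrite y'k x'k !lucasSS; ring.
case: H => [[-> ->]|[[n' s'] xx']].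
  by exists 0%N; split=> //=; ring.
have [|k [k1 k2]] := IH _ _ _ s'; first by lia.
by exists k.+1.
Qed.

(** * P3 *)

Lemma frobenius_roots (q : nat) (P N : int) :
  prime q -> exists (K : fieldType) (a b : K),
  [/\ P%:~R = a + b, N%:~R = a * b, q \in [pchar K] & a ^+ q = a \/ a ^+ q = b].
Proof.
move=> pq; have [K [f [a [b [fP fN]]]]] := quadratic_roots (P%:~R : 'F_q) (N%:~R).
rewrite !rmorph_int in fP fN.
have chK : q \in [pchar K] by rewrite (fmorph_pchar f) pchar_Fp.
exists K, a, b; split=> //.
have aD : a ^+ q + b ^+ q = a + b.
  by rewrite -!(pFrobenius_autE chK) -rmorphD -fP rmorph_int.
have aM : a ^+ q * b ^+ q = a * b.
  by rewrite -!(pFrobenius_autE chK) -rmorphM -fN rmorph_int.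
have /eqP : (a ^+ q - a) * (a ^+ q - b) = 0.
  transitivity (a ^+ q * a ^+ q - (a + b) * a ^+ q + a * b); first by ring.
  by rewrite -aD -aM; ring.
by rewrite mulf_eq0 !subr_eq0 => /orP[]/eqP; [left|right].
Qed.

Lemma pchar_int_eq0 (K : fieldType) (q : nat) (z : int) :
  q \in [pchar K] -> ((z%:~R : K) == 0) = (q %| `|z|)%N.
Proof.
move=> chK; rewrite (dvdn_pcharf chK) {1}(intEsign z) rmorphM rmorph_sign /=.
by rewrite -[in LHS](pmulrn _ `|z|%N) mulf_eq0 signr_eq0.
Qed.

Lemma prime_power_order (K : fieldType) (g : K) (p e t : nat) :
  prime p -> g ^+ (p ^ e.+1) = 1 -> g ^+ (p ^ e) != 1 -> g ^+ t = 1 ->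
  (p ^ e.+1 %| t)%N.
Proof.
move=> pp g1 gn gt.
have p0 : (0 < p ^ e.+1)%N by rewrite expn_gt0 prime_gt0.
have [m mprim mdvd] := prim_order_exists p0 g1.
suff <- : m = (p ^ e.+1)%N by rewrite (prim_order_dvd mprim) gt.
have /(dvdn_pfactor _ _ pp) [i ile mE] := mdvd.
move: ile; rewrite leq_eqVlt ltnS => /orP[/eqP ie|ile]; first by rewrite mE ie.
case/eqP: gn; apply/eqP; rewrite -(prim_order_dvd mprim) mE.
by rewrite dvdn_exp2l.
Qed.

Lemma lucas_divisor_class (q p e : nat) (P N : int) :
  prime q -> odd q -> prime p -> odd p -> N = 1 \/ N = -1 ->
  (q %| `|lucas P N (p ^ e.+1)|)%N -> ~~ (q %| `|lucas P N (p ^ e)|)%N ->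
  if N == 1 then (4 * p ^ e.+1 %| q.-1)%N || (4 * p ^ e.+1 %| q.+1)%N
  else (2 * p ^ e.+1 %| q.-1)%N.
Proof.
move=> pq oq pp op hN.
have [K [a [b [fP fN chK aq]]]] := frobenius_roots P N pq.
have V k : ((lucas P N k)%:~R : K) = a ^+ k + b ^+ k.
  by rewrite rmorph_lucas /= fP fN lucas_roots.
rewrite -!(pchar_int_eq0 _ chK) !V.
set l := (p ^ e.+1)%N; set h := (p ^ e)%N => Vl Vh.
have ol : odd l by rewrite oddX op orbT.
have oh : odd h by rewrite oddX op orbT.
have N2 : (N%:~R : K) ^+ 2 = 1 by case: hN => ->; rewrite ?mulrN1z ?sqrrN expr1n.
have Nodd k : odd k -> (- N%:~R : K) ^+ k = - N%:~R.
  move=> ok; rewrite -(odd_double_half k) ok -mul2n exprD exprM sqrrN N2.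
  by rewrite expr1n mulr1.
have N0 : (N%:~R : K) != 0 by rewrite -sqrf_eq0 N2 oner_eq0.
have a0 : a != 0 by apply: contra N0; rewrite fN => /eqP->; rewrite mul0r.
have Sk k : odd k -> (a ^+ k) * (a ^+ k + b ^+ k) = a ^+ (2 * k) + N%:~R.
  move=> ok; rewrite mulrDr -exprD addnn -mul2n -exprMn -fN.
  by rewrite -[in X in _ + X](opprK N%:~R) exprNn -signr_odd ok expr1 mulN1r Nodd ?opprK.
pose g : K := - N%:~R * a ^+ 2.
have gk k : odd k -> g ^+ k = - N%:~R * a ^+ (2 * k).
  by move=> ok; rewrite exprMn Nodd // -exprM.
have a2l : a ^+ (2 * l) = - N%:~R.
  by apply/eqP; rewrite -addr_eq0 -Sk // (eqP Vl) mulr0.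
have gl : g ^+ l = 1 by rewrite gk // a2l mulrNN -expr2.
have gh : g ^+ h != 1.
  apply: contra Vh; rewrite gk // => /eqP gh1.
  have /eqP : a ^+ h * (a ^+ h + b ^+ h) = 0.
    rewrite Sk //; apply/eqP; rewrite addr_eq0; apply/eqP.
    have Nn0 : - N%:~R != 0 :> K by rewrite oppr_eq0.
    by apply: (mulfI Nn0); rewrite gh1 mulrNN -expr2 N2.
  by rewrite mulf_eq0 expf_eq0 (negbTE a0) andbF.
have dvd t : g ^+ t = 1 -> (l %| t)%N by apply: prime_power_order.
have ge k : ~~ odd k -> g ^+ k = a ^+ (2 * k).
  move=> ek; rewrite exprMn -exprM -[X in _ ^+ X](odd_double_half k) (negbTE ek) add0n.
  by rewrite -mul2n exprM sqrrN N2 expr1n mul1r.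
have copl k : coprime (2 ^ k) l by rewrite coprimeXl // coprime2n.
have q1 : (0 < q)%N by rewrite prime_gt0.
have eq1 : ~~ odd q.-1 by rewrite -oddS prednK.
have eq2 : ~~ odd q.+1 by rewrite /= oq.
have aq1 : a ^+ q = a -> a ^+ q.-1 = 1.
  by move=> h1; apply: (mulfI a0); rewrite -exprS prednK // mulr1.
have aq2 : a ^+ q = b -> a ^+ q.+1 = N%:~R by move=> h1; rewrite exprS h1 fN.
have m1 : (-1 : K) != 1.
  rewrite -subr_eq0 -opprD oppr_eq0 -[1 + 1]/(2%:R) -(dvdn_pcharf chK).
  by apply: contraL oq; rewrite dvdn_prime2 // => /eqP->.
case: hN => hN; rewrite hN /=.
  have a2l1 : a ^+ (2 * l) = -1 by rewrite a2l hN.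
  have four t : ~~ odd t -> a ^+ t = 1 -> (4 * l %| t)%N.
    move=> et at1; rewrite (Gauss_dvd _ (copl 2)) dvd ?andbT; last first.
      by rewrite ge // mulnC exprM at1 expr1n.
    rewrite -(odd_double_half t) (negbTE et) add0n -mul2n (@dvdn_pmul2l 2 2) // dvdn2.
    apply: contraNT m1 => /negbNE ot; apply/eqP.
    have := congr1 (fun z => z ^+ t./2) a2l1.
    rewrite -[(-1) ^+ _]signr_odd ot expr1 -exprM => <-.
    suff -> : (2 * l * t./2 = t * l)%N by rewrite exprM at1 expr1n.
    by rewrite mulnAC mul2n -[in RHS](odd_double_half t) (negbTE et).
  apply/orP; case: aq => [/aq1|/aq2] h1; [left|right]; apply: four => //.
  by rewrite h1 hN.
have a2l1 : a ^+ (2 * l) = 1 by rewrite a2l hN rmorphN opprK.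
have cop2 : coprime 2 l := copl 1%N.
rewrite (Gauss_dvd _ cop2) dvdn2 eq1 /=.
case: aq => [/aq1|/aq2] h1.
  by apply: dvd; rewrite ge // mulnC exprM h1 expr1n.
case/eqP: m1.
have := congr1 (fun z => z ^+ l) h1.
rewrite hN rmorphN1 -signr_odd ol expr1 => <-.
rewrite -exprM -{1}(odd_double_half q.+1) (negbTE eq2) add0n -mul2n.
by rewrite mulnAC exprM a2l1 expr1n.
Qed.

Lemma square_sub_two_class (q : nat) (w N : int) :
  prime q -> odd q -> N = 1 \/ N = -1 -> (q %| absz (w ^+ 2 - 2 * N)%R)%N ->
  if N == 1 then (8 %| q.-1)%N || (8 %| q.+1)%N else (8 %| q.-1)%N || (8 %| q - 3)%N.
Proof.
move=> pq oq hN; have [K [a [b [fP fN chK aq]]]] := frobenius_roots w N pq.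
have N2 : (N%:~R : K) ^+ 2 = 1 by case: hN => ->; rewrite ?mulrN1z ?sqrrN expr1n.
rewrite -(pchar_int_eq0 _ chK) rmorphB rmorphXn rmorphM /= fP fN => Vq.
have N0 : (N%:~R : K) != 0 by rewrite -sqrf_eq0 N2 oner_eq0.
have a0 : a != 0 by apply: contra N0; rewrite fN => /eqP->; rewrite mul0r.
have a2 : a ^+ 2 = - b ^+ 2.
  by apply/eqP; rewrite -addr_eq0 -(eqP Vq); apply/eqP; ring.
have a4 : a ^+ 4 = -1.
  by rewrite (exprD a 2 2) {2}a2 mulrN -exprMn -fN N2.
have m1 : (-1 : K) != 1.
  rewrite -subr_eq0 -opprD oppr_eq0 -[1 + 1]/(2%:R) -(dvdn_pcharf chK).
  by apply: contraL oq; rewrite dvdn_prime2 // => /eqP->.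
have dvd t : a ^+ t = 1 -> (8 %| t)%N.
  apply: (@prime_power_order K a 2 2) => //; last by rewrite a4.
  by rewrite -[(2 ^ 3)%N]/(4 * 2)%N exprM a4 sqrrN expr1n.
have q2 : (2 < q)%N by rewrite odd_prime_gt2.
case: aq => h1.
  have -> : (8 %| q.-1)%N by apply: dvd; apply: (mulfI a0); rewrite -exprS prednK ?mulr1 // prime_gt0.
  by rewrite if_same.
have h2 : a ^+ q.+1 = N%:~R by rewrite exprS h1 fN.
case: hN h2 => -> h2 /=; first by rewrite (dvd q.+1) ?orbT.
rewrite (dvd (q - 3)%N) ?orbT //.
have a40 : a ^+ 4 != 0 by rewrite expf_neq0.
apply: (mulfI a40); rewrite -exprD a4 mulr1.
by have -> : (4 + (q - 3))%N = q.+1 by lia.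
Qed.

(* Divisors inherit residue classes from their prime factors. *)
Lemma divisor_class_mod8 (c D : nat) :
  c \in [:: 3; 7]%N -> odd D ->
  (forall q, prime q -> (q %| D)%N -> (q %% 8 \in [:: 1; c])%N) ->
  (D %% 8 \in [:: 1; c])%N.
Proof.
move=> hc; elim/ltn_ind: D => D IH oD H.
have [D1|D1] := leqP D 1; first by case: D oD D1 {IH H} => [|[]].
have pq := pdiv_prime D1; have /dvdnP[D' DE] := pdiv_dvd D.
have D'0 : (0 < D')%N by case: D' DE D1 => // ->.
have := H _ pq (pdiv_dvd D).
have : (D' %% 8 \in [:: 1; c])%N.
  apply: IH; first by rewrite [in ltnRHS]DE ltn_Pmulr // prime_gt1.
    by move: oD; rewrite [in odd D]DE oddM => /andP[].
  by move=> q qp qD; apply: H => //; rewrite DE dvdn_mulr.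
rewrite [in X in _ -> _ -> X]DE -modnMm.
move: hc; rewrite !inE => /orP[]/eqP-> /orP[]/eqP-> /orP[]/eqP-> //.
Qed.

Lemma square_sub_two_divisor (w N : int) (D : nat) :
  N = 1 \/ N = -1 -> odd D -> (D %| absz (w ^+ 2 - 2 * N)%R)%N ->
  (D %% 8)%N \in [:: 1%N; if N == 1 then 7%N else 3%N].
Proof.
move=> hN oD dD; apply: divisor_class_mod8 => // [|q pq qD]; first by case: ifP.
have oq : odd q by apply: dvdn_odd qD oD.
have := square_sub_two_class pq oq hN (dvdn_trans qD dD).
have q1 := odd_prime_gt2 oq pq.
by case: hN => -> /=; rewrite !inE; lia.
Qed.

(** * P4 *)
Local Close Scope ring_scope.

Lemma central_binomS m :
  m.+1 * central_binom m.+1 = 2 * (m.*2.+1) * central_binom m.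
Proof.
apply/eqP; rewrite -(eqn_pmul2l (ltn0Sn m)) /central_binom doubleS.
have h1 := mul_bin_diag m.*2.+2 m; have h2 := mul_bin_down m.*2.+1 m.
rewrite /= in h1 h2; rewrite -h1 [m.*2.+2](_ : _ = m.+1 * 2); last by lia.
have -> : m.+1 * (m.+1 * 2 * 'C(m.*2.+1, m)) =
   m.+1 * 2 * ((m.*2.+1 - m) * 'C(m.*2.+1, m)) by nia.
by rewrite -h2; apply/eqP; lia.
Qed.

Lemma central_binom_gt0 m : 0 < central_binom m.
Proof. by rewrite bin_gt0 -addnn leq_addr. Qed.

Lemma catalan_mul m : m.+1 * catalan m = central_binom m.
Proof.
suff /dvdnP[k kE] : m.+1 %| central_binom m by rewrite /catalan kE mulnK // mulnC.
have h := mul_bin_left m.*2 m.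
have -> : central_binom m = m.+1 * ('C(m.*2, m) - 'C(m.*2, m.+1)).
  rewrite mulnBr h /central_binom -addnn addnK mulSn addnK //.
by rewrite dvdn_mulr.
Qed.

Lemma central_binomS_catalan m : central_binom m.+1 = 2 * (m.*2.+1) * catalan m.
Proof.
apply/eqP; rewrite -(eqn_pmul2l (ltn0Sn m)) central_binomS -catalan_mul.
by apply/eqP; lia.
Qed.

Lemma catalanS m : m.+2 * catalan m.+1 = 2 * (m.*2.+1) * catalan m.
Proof. by rewrite catalan_mul central_binomS_catalan. Qed.

Lemma catalan_gt0 m : 0 < catalan m.
Proof. by have := central_binom_gt0 m; rewrite -catalan_mul muln_gt0 => /andP[]. Qed.

Definition odd_fact m := \prod_(i < m) i.*2.+1.

Lemma odd_factS m : odd_fact m.+1 = odd_fact m * m.*2.+1.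
Proof. by rewrite /odd_fact big_ord_recr. Qed.

Lemma odd_odd_fact m : odd (odd_fact m).
Proof.
elim: m => [|m IH]; first by rewrite /odd_fact big_ord0.
by rewrite odd_factS oddM IH /= odd_double.
Qed.

Lemma central_binom_odd_fact m : central_binom m * m`! = 2 ^ m * odd_fact m.
Proof.
elim: m => [|m IH]; first by rewrite /odd_fact big_ord0.
rewrite factS mulnA [_ * m.+1]mulnC central_binomS -mulnA IH odd_factS expnS; lia.
Qed.

Lemma central_binom_double m :
  odd_fact m ^ 2 * central_binom m.*2 = odd_fact m.*2 * central_binom m.
Proof.
have h1 := central_binom_odd_fact m; have h2 := central_binom_odd_fact m.*2.
have h3 : (m.*2)`! = 2 ^ m * m`! * odd_fact m.
  have := bin_fact (leq_addr m m); rewrite addnK addnn -/(central_binom m) mulnA h1; lia.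
have f0 : 0 < 2 ^ m * m`! by rewrite muln_gt0 expn_gt0 fact_gt0.
have h4 : central_binom m.*2 * (m`! * odd_fact m) = 2 ^ m * odd_fact m.*2.
  apply/eqP; rewrite -(eqn_pmul2l (_ : 0 < 2 ^ m)) ?expn_gt0 //; apply/eqP.
  by move: h2; rewrite h3 -addnn expnD; lia.
apply/eqP; rewrite -(eqn_pmul2l f0); apply/eqP; nia.
Qed.

Lemma logn2_odd n : odd n -> logn 2 n = 0.
Proof. by move=> on; rewrite lognE dvdn2 on !andbF. Qed.

Lemma logn2_central_binom_double m :
  logn 2 (central_binom m.*2) = logn 2 (central_binom m).
Proof.
have := congr1 (logn 2) (central_binom_double m).
have o1 := odd_odd_fact m; have o2 := odd_odd_fact m.*2.
rewrite !lognM ?expn_gt0 ?central_binom_gt0 ?(odd_gt0 o1) ?(odd_gt0 o2) //.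
by rewrite !(logn2_odd o1) (logn2_odd o2).
Qed.

Lemma logn2_central_binom_doubleS m :
  logn 2 (central_binom m.*2.+1) = (logn 2 (central_binom m)).+1.
Proof.
rewrite -(logn2_central_binom_double m).
have := congr1 (logn 2) (central_binomS m.*2).
have l1 : logn 2 m.*2.+1 = 0 by rewrite logn2_odd //= odd_double.
have l2 : logn 2 (m.*2.*2.+1) = 0 by rewrite logn2_odd //= odd_double.
by rewrite !lognM ?central_binom_gt0 // l1 l2 add0n => ->.
Qed.

Lemma logn2_central_binom_eq0 m : logn 2 (central_binom m) = 0 -> m = 0.
Proof.
elim/ltn_ind: m => m IH; rewrite -(odd_double_half m).
case: (odd m); first by rewrite add1n logn2_central_binom_doubleS.
rewrite add0n logn2_central_binom_double => h.
have [m0|m0] := posnP m; first by rewrite m0.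
by rewrite (IH m./2) //; lia.
Qed.

Lemma logn2_central_binom_eq1 m :
  logn 2 (central_binom m) = 1 -> exists a, m = 2 ^ a.
Proof.
elim/ltn_ind: m => m IH; have [m0|m0] := posnP m; first by rewrite m0.
rewrite -{1}(odd_double_half m).
have mE := odd_double_half m; case: (odd m) mE => mE.
  rewrite add1n logn2_central_binom_doubleS => -[/logn2_central_binom_eq0 h].
  by exists 0; rewrite -mE h.
rewrite add0n logn2_central_binom_double => /IH [|a h]; first by lia.
by exists a.+1; rewrite -mE h expnS mul2n.
Qed.

Lemma logn2_central_binom_eq2 m :
  logn 2 (central_binom m) = 2 -> exists a b, b < a /\ m = 2 ^ a + 2 ^ b.
Proof.
elim/ltn_ind: m => m IH; have [m0|m0] := posnP m; first by rewrite m0.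
rewrite -{1}(odd_double_half m).
have mE := odd_double_half m; case: (odd m) mE => mE.
  rewrite add1n logn2_central_binom_doubleS => -[/logn2_central_binom_eq1 [a h]].
  by exists a.+1, 0; rewrite -mE h expnS mul2n addnC.
rewrite add0n logn2_central_binom_double => /IH [|a [b [ab h]]]; first by lia.
by exists a.+1, b.+1; rewrite -mE h !expnS doubleD !mul2n.
Qed.

Lemma odd_fact_mod8 m : odd_fact (4 * m) = 1 %[mod 8].
Proof.
elim: m => [|m IH]; first by rewrite /odd_fact big_ord0.
rewrite mulnS addnC !addnS addn0 !odd_factS -!mulnA -modnMml IH modnMml mul1n.
have -> : (4 * m).*2 = 8 * m by lia.
have -> : (4 * m).+1.*2 = 8 * m + 2 by lia.
have -> : (4 * m).+2.*2 = 8 * m + 4 by lia.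
have -> : (4 * m).+3.*2 = 8 * m + 6 by lia.
have -> : (8 * m).+1 * ((8 * m + 2).+1 * ((8 * m + 4).+1 * (8 * m + 6).+1)) =
  (512 * m ^ 4 + 1024 * m ^ 3 + 688 * m ^ 2 + 176 * m + 13) * 8 + 1 by lia.
by rewrite modnMDl.
Qed.

Lemma central_binom_pow2 a :
  0 < a -> exists k, central_binom (2 ^ a) = 2 * k /\ k %% 8 = 3.
Proof.
case: a => // a _; elim: a => [|a [k [kE k3]]]; first by exists 3.
have [a0|a0] := posnP a; first by exists 35; rewrite a0.
have h := central_binom_double (2 ^ a.+1); rewrite -mul2n -expnS in h.
have v : logn 2 (central_binom (2 ^ a.+2)) = 1.
  rewrite expnS mul2n logn2_central_binom_double kE.
  have ok : odd k by lia.
  by rewrite lognM ?(odd_gt0 ok) // (logn2_odd ok).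
have /dvdnP[k' k'E] : 2 %| central_binom (2 ^ a.+2).
  by rewrite -[2]/(2 ^ 1) pfactor_dvdn ?central_binom_gt0 // v.
exists k'; split; first by rewrite mulnC.
have e1 : odd_fact (2 ^ a.+1) = 1 %[mod 8].
  by case: a a0 {h kE v k'E} => // a _; rewrite 2!expnS mulnA odd_fact_mod8.
have e2 : odd_fact (2 ^ a.+2) = 1 %[mod 8].
  by rewrite 2!expnS mulnA odd_fact_mod8.
have {}h : odd_fact (2 ^ a.+1) ^ 2 * k' = odd_fact (2 ^ a.+2) * k.
  by apply/eqP; rewrite -(eqn_pmul2l (isT : 0 < 2)); apply/eqP; move: h; rewrite kE k'E; lia.
have lhs : odd_fact (2 ^ a.+1) ^ 2 * k' = k' %[mod 8].
  by rewrite -modnMml -modnXm e1 modnXm exp1n modnMml mul1n.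
by rewrite -lhs h -modnMml e2 modnMml mul1n.
Qed.

Lemma pow2_mod (r k i : nat) :
  2 ^ r %% k = 1 -> 2 ^ (r * i) %% k = 1 %% k.
Proof. by move=> h; rewrite expnM -modnXm h exp1n. Qed.

Lemma quotient_dvdn (g D k C : nat) :
  0 < g -> g * D %| k * C -> gcdn (g * D) k %| g -> D %| C.
Proof.
move=> g0 h hg; rewrite -(dvdn_pmul2l g0).
apply: (dvdn_trans _ (dvdn_mul hg (dvdnn C))).
by rewrite muln_gcdl dvdn_gcd h dvdn_mulr.
Qed.

Lemma catalan_step1 M : 1 < M -> 2 * M - 3 %| M * catalan M.-1.
Proof.
case: M => [|[|M]] //= _; rewrite catalanS.
have -> : 2 * M.+2 - 3 = M.*2.+1 by lia.
by rewrite dvdn_mulr ?dvdn_mull.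
Qed.

Lemma catalan_step2 M : 2 < M -> 2 * M - 5 %| M * M.-1 * catalan M.-1.
Proof.
case: M => [|[|[|M]]] //= _.
have h1 := catalanS M.+1; have h2 := catalanS M.
have -> : 2 * M.+3 - 5 = M.*2.+1 by lia.
apply/dvdnP; exists (4 * M.+1.*2.+1 * catalan M); nia.
Qed.

Lemma catalan_step3 M : 3 < M -> 2 * M - 7 %| M * M.-1 * M.-2 * catalan M.-1.
Proof.
case: M => [|[|[|[|M]]]] //= _.
have h1 := catalanS M.+2; have h2 := catalanS M.+1; have h3 := catalanS M.
have -> : 2 * M.+4 - 7 = M.*2.+1 by lia.
apply/dvdnP; exists (8 * M.+2.*2.+1 * M.+1.*2.+1 * catalan M).
have -> : M.+4 * M.+3 * M.+2 * catalan M.+3 = M.+2 * M.+3 * (M.+4 * catalan M.+3) by lia.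
rewrite h1; have -> : M.+2 * M.+3 * (2 * M.+2.*2.+1 * catalan M.+2) =
  M.+2 * (2 * M.+2.*2.+1) * (M.+3 * catalan M.+2) by lia.
rewrite h2; have -> : M.+2 * (2 * M.+2.*2.+1) * (2 * M.+1.*2.+1 * catalan M.+1) =
  (2 * M.+2.*2.+1) * (2 * M.+1.*2.+1) * (M.+2 * catalan M.+1) by lia.
rewrite h3; lia.
Qed.

(* odd divisors of T lie in the residue classes 1 and c modulo 8 *)
Definition odd_divisors_mod8 (c T : nat) : Prop :=
  forall D, odd D -> D %| T -> D %% 8 \in [:: 1; c].

Lemma catalan_odd_divisors_odd c m : c \in [:: 3; 7] ->
  odd_divisors_mod8 c (catalan m) -> odd (catalan m) -> catalan m = 1.
Proof.
move=> hc H oC.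
have [a mE] : exists a, m.+1 = 2 ^ a.
  apply: logn2_central_binom_eq1; rewrite central_binomS_catalan -mulnA.
  have o2 : odd (m.*2.+1 * catalan m) by rewrite oddM /= odd_double.
  by rewrite lognM ?(odd_gt0 o2) // (logn2_odd o2).
case: a mE => [[->]//|[[->]//|a mE]].
have e8 : 2 ^ a.+2 = 4 * 2 ^ a by rewrite 2!expnS mulnA.
have a0 : 0 < 2 ^ a by rewrite expn_gt0.
have o3 : odd (2 * 2 ^ a.+2 - 3) by lia.
have h : 2 * 2 ^ a.+2 - 3 %| 2 ^ a.+2 * catalan m.
  by rewrite -mE; apply: (@catalan_step1 m.+1); lia.
have : 2 * 2 ^ a.+2 - 3 %| catalan m.
  apply: (@quotient_dvdn 1 _ (2 ^ a.+2)); rewrite ?mul1n //.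
  by rewrite gcdnC dvdn1 -/(coprime _ _) coprimeXl // coprime2n.
by move/(H _ o3); move: hc; rewrite !inE; lia.
Qed.

Lemma pow2_mod15 a : 2 ^ a %% 15 = 2 ^ (a %% 4).
Proof.
rewrite {1}(divn_eq a 4) [_ * 4]mulnC expnD -modnMml (@pow2_mod 4 15) // mul1n.
by rewrite modn_small //; have := ltn_pmod a (isT : 0 < 4); case: (a %% 4) => [|[|[|[]]]].
Qed.

Lemma pow2_mod7 a : 2 ^ a %% 7 = 2 ^ (a %% 3).
Proof.
rewrite {1}(divn_eq a 3) [_ * 3]mulnC expnD -modnMml (@pow2_mod 3 7) // mul1n.
by rewrite modn_small //; have := ltn_pmod a (isT : 0 < 3); case: (a %% 3) => [|[|[]]].
Qed.

Lemma coprime_of_add X N r k :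
  prime r -> X + r = k * N -> ~~ (r %| N) -> coprime X N.
Proof.
move=> pr E rN.
have gr : gcdn X N %| r.
  by rewrite -(dvdn_addr _ (dvdn_gcdl X N)) E dvdn_mull // dvdn_gcdr.
have /primeP[_ /(_ _ gr)/orP[//|/eqP gE]] := pr.
by move: rN; rewrite -gE dvdn_gcdr.
Qed.

Lemma gcdn_dvd_of_add X N r k : X + r = k * N -> gcdn X N %| r.
Proof.
by move=> E; rewrite -(dvdn_addr _ (dvdn_gcdl X N)) E dvdn_mull // dvdn_gcdr.
Qed.

Lemma catalan_odd_divisors_even c m : c \in [:: 3; 7] ->
  odd_divisors_mod8 c (catalan m) -> logn 2 (catalan m) = 1 -> m = 2 \/ m = 4.
Proof.
move=> hc H v1.
have [a [b [ab mE]]] : exists a b, b < a /\ m.+1 = 2 ^ a + 2 ^ b.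
  apply: logn2_central_binom_eq2; rewrite central_binomS_catalan -mulnA.
  have o2 : odd m.*2.+1 by rewrite /= odd_double.
  rewrite lognM ?muln_gt0 ?catalan_gt0 // lognM ?catalan_gt0 //.
  by rewrite (logn2_odd o2) v1.
have s1 : 1 < m.+1 -> 2 * m.+1 - 3 %| m.+1 * catalan m by apply: catalan_step1.
have s2 : 2 < m.+1 -> 2 * m.+1 - 5 %| m.+1 * (m * catalan m).
  by rewrite mulnA; apply: catalan_step2.
have s3 : 3 < m.+1 -> 2 * m.+1 - 7 %| m.+1 * (m * (m.-1 * catalan m)).
  by rewrite !mulnA; apply: catalan_step3.
have C0 := catalan_gt0 m.
have Bm := catalan_mul m.
move: (catalan m) C0 Bm H s1 s2 s3 {v1} => C C0 Bm H s1 s2 s3.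
have odd8 D r : D %% 8 = r -> odd r -> odd D.
  by move=> <-; rewrite {2}(divn_eq D 8) oddD oddM andbF.
(* The residues 3, 5, 7 cannot all be ruled in: 5 never, 3 and 7 not together. *)
have bad5 D : D %| C -> D %% 8 = 5 -> False.
  move=> dD D5; have := H D (odd8 _ _ D5 isT) dD; rewrite D5.
  by move: hc; rewrite !inE => /orP[]/eqP->.
have bad37 D E : D %| C -> D %% 8 = 3 -> E %| C -> E %% 8 = 7 -> False.
  move=> dD D3 dE E7.
  have := H D (odd8 _ _ D3 isT) dD; have := H E (odd8 _ _ E7 isT) dE; rewrite D3 E7.
  by move: hc; rewrite !inE => /orP[]/eqP->.
have p15 := pow2_mod15 a; have a4 : a %% 4 < 4 by rewrite ltn_mod.
case: b => [|[|b]] in ab mE.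
- have mA : m = 2 ^ a by move: mE; rewrite expn0 addn1 => -[].
  case: a => [//|[|[|a]]] in ab mE mA p15 a4 *; [by left|by right|].
  have e8 : 2 ^ a.+3 = 8 * 2 ^ a by rewrite 3!expnS !mulnA.
  have k0 : 0 < 2 ^ a by rewrite expn_gt0.
  have [k [kE k3]] := @central_binom_pow2 a.+3 isT; rewrite -mA -Bm in kE.
  rewrite e8 in mA; move: (2 ^ a) k0 mA {mE e8 p15 ab a4} => s s0 mA.
  have {}s1 := s1 _.
  have [u3|u3] := boolP (3 %| m.+1).
    have /dvdnP[u uE] := u3; exfalso; apply: (bad5 (2 * u - 1)); last first.
      by clear -uE mA s0; lia.
    apply: (@quotient_dvdn 3 _ m.+1) => //.
      by rewrite mulnBr muln1 mulnCA -[3 * u]mulnC -uE; apply: s1; rewrite mA; clear -s0; lia.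
    by apply: (@gcdn_dvd_of_add _ _ 3 2); clear -uE mA s0; lia.
  have C2 : exists C', C = 2 * C'.
    exists (C %/ 2); have : odd C = false; last by clear; lia.
    move: (congr1 odd kE); rewrite oddM mA /= oddM /=.
    by have -> : odd (2 * k) = false by clear; lia.
  have [C' CE] := C2; exfalso; apply: (bad37 C' (2 * m.+1 - 3)).
  - by rewrite CE dvdn_mull.
  - have : m.+1 * C' = k by move: kE; rewrite CE; clear; nia.
    rewrite mA => kC; move: k3; by rewrite -kC mulSn -mulnA [8 * _]mulnC addnC modnMDl.
  - by rewrite -(@Gauss_dvdr _ m.+1); [apply: s1; clear -mA s0; lia
      |apply: (@coprime_of_add _ _ 3 2) => //; clear -mA s0; lia].
  by clear -mA s0; lia.
- have mA : m = (2 ^ a).+1 by move: mE; rewrite expn1 addn2 => -[].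
  case: a => [//|[//|a]] in ab mE mA p15 a4 *.
  have e8 : 2 ^ a.+2 = 4 * 2 ^ a by rewrite 2!expnS !mulnA.
  have k0 : 0 < 2 ^ a by rewrite expn_gt0.
  have s4 : 4 <= 2 ^ a.+2 by rewrite e8; clear -k0; lia.
  have d4 : 4 %| 2 ^ a.+2 by rewrite e8 dvdn_mulr.
  have p7 : 2 ^ a.+2 %% 7 != 5.
    rewrite pow2_mod7; have := ltn_pmod a.+2 (isT : 0 < 3).
    by case: (a.+2 %% 3) => [|[|[]]].
  move: (2 ^ a.+2) s4 d4 mA p7 p15 {mE e8 k0} => s s4 d4 mA p7 p15; exfalso.
  have [r02|[r1|r3]] : a.+2 %% 4 \in [:: 0; 2] \/ a.+2 %% 4 = 1 \/ a.+2 %% 4 = 3.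
    by case: (a.+2 %% 4) a4 => [|[|[|[]]]] // _; auto.
  + have p : s %% 15 = 1 \/ s %% 15 = 4.
      by move: r02; rewrite p15 !inE => /orP[]/eqP->; auto.
    have u3 : 3 %| m.+1 by clear -p mA; lia.
    have /dvdnP[u uE] := u3; apply: (bad37 (2 * u - 1) (2 * m.+1 - 5)).
    * apply: (@quotient_dvdn 3 _ m.+1) => //.
        by rewrite mulnBr muln1 mulnCA -[3 * u]mulnC -uE; apply: s1; rewrite mA; clear -s4; lia.
      by apply: (@gcdn_dvd_of_add _ _ 3 2); clear -uE mA s4; lia.
    * by clear -uE mA s4 d4; lia.
    * have cM : coprime (2 * m.+1 - 5) m.+1.
        by apply: (@coprime_of_add _ _ 5 2) => //; clear -mA s4 p; lia.
      have cm : coprime (2 * m.+1 - 5) m.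
        by apply: (@coprime_of_add _ _ 3 2) => //; clear -mA s4 p; lia.
      by rewrite -(Gauss_dvdr _ cm) -(Gauss_dvdr _ cM) s2 // mA; clear -s4; lia.
    by clear -mA s4 d4; lia.
  + have p : s %% 15 = 2 by rewrite p15 r1.
    have u3 : 3 %| m by clear -p mA; lia.
    have /dvdnP[u uE] := u3; apply: (bad5 (2 * u - 1)); last by clear -uE mA s4 d4; lia.
    apply: (@quotient_dvdn 3 _ m) => //.
      have -> : 3 * (2 * u - 1) = 2 * m.+1 - 5 by clear -uE; lia.
      have cM : coprime (2 * m.+1 - 5) m.+1.
        by apply: (@coprime_of_add _ _ 5 2) => //; clear -mA s4 p; lia.
      by rewrite -(Gauss_dvdr _ cM) s2 // mA; clear -s4; lia.
    by apply: (@gcdn_dvd_of_add _ _ 3 2); clear -uE mA s4; lia.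
  have p : s %% 15 = 8 by rewrite p15 r3.
  apply: (bad5 (2 * m.+1 - 7)); last by clear -mA s4 d4; lia.
  have cM : coprime (2 * m.+1 - 7) m.+1.
    by apply: (@coprime_of_add _ _ 7 2) => //; clear -mA s4 p7 p; lia.
  have cm : coprime (2 * m.+1 - 7) m.
    by apply: (@coprime_of_add _ _ 5 2) => //; clear -mA s4 p; lia.
  have cm1 : coprime (2 * m.+1 - 7) m.-1.
    by apply: (@coprime_of_add _ _ 3 2) => //; clear -mA s4 p; lia.
  rewrite -(Gauss_dvdr _ cm1) -(Gauss_dvdr _ cm) -(Gauss_dvdr _ cM) s3 //.
  by rewrite mA; clear -s4; lia.
have [j aE] : exists j, a = j.+1 + b.+2 by exists (a - b.+2).-1; clear -ab; lia.
have ME : m.+1 = 4 * (2 ^ b * (2 ^ j.+1 + 1)).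
  by rewrite mE aE expnD mulnDr muln1 mulnDr mulnCA; rewrite !expnS; clear; lia.
have w0 : 0 < 2 ^ b * (2 ^ j.+1 + 1) by rewrite muln_gt0 expn_gt0 addn1.
have M4 : 4 <= m.+1 by rewrite ME; clear -w0; lia.
have M8 : 4 %| m.+1 by rewrite ME dvdn_mulr.
have M15 : ~~ (15 %| m.+1).
  rewrite ME mulnA -[4]/(2 ^ 2) -expnD Gauss_dvdr; last by rewrite coprimeXr.
  rewrite /dvdn -modnDml pow2_mod15; have := ltn_pmod j.+1 (isT : 0 < 4).
  by case: (j.+1 %% 4) => [|[|[|[]]]].
have mM : m = m.+1.-1 by [].
move: m.+1 mM M4 M8 M15 s1 s2 => M mM M4 M8 M15 s1 s2; exfalso.
have [u3|u3] := boolP (3 %| M); last first.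
  have cM : coprime (2 * M - 3) M.
    by apply: (@coprime_of_add _ _ 3 2) => //; clear -M4; lia.
  apply: (bad5 (2 * M - 3)); last by clear -M4 M8; lia.
  by rewrite -(Gauss_dvdr _ cM) s1 //; clear -M4; lia.
have /dvdnP[u uE] := u3; apply: (bad37 (2 * M - 5) (2 * u - 1)).
- have cM : coprime (2 * M - 5) M.
    by apply: (@coprime_of_add _ _ 5 2) => //; clear -M4 M15 u3; lia.
  have cm : coprime (2 * M - 5) m.
    by rewrite mM; apply: (@coprime_of_add _ _ 3 2) => //; clear -M4 u3; lia.
  by rewrite -(Gauss_dvdr _ cm) -(Gauss_dvdr _ cM) s2 //; clear -M4; lia.
- by clear -M4 M8; lia.
- apply: (@quotient_dvdn 3 _ M) => //.
    by rewrite mulnBr muln1 mulnCA -[3 * u]mulnC -uE; apply: s1; clear -M4; lia.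
  by apply: (@gcdn_dvd_of_add _ _ 3 2); clear -uE M4; lia.
by clear -uE M4 M8; lia.
Qed.

(** * P5 *)

Lemma central_binom_odd_divisors c m : c \in [:: 3; 7] ->
  odd_divisors_mod8 c (central_binom m) -> logn 2 (central_binom m) = 1 ->
  m = 1 \/ m = 2.
Proof.
move=> hc H /logn2_central_binom_eq1 [[|[|a]] mE]; [by left|by right|exfalso].
have [k [kE k3]] := @central_binom_pow2 a.+2 isT; rewrite -mE in kE.
have m0 : 0 < m by rewrite mE expn_gt0.
have m4 : 4 %| m by rewrite mE 2!expnS mulnA dvdn_mulr.
have h := central_binomS m.-1; rewrite prednK // in h.
have d7 : 2 * m - 1 %| central_binom m.
  have cm : coprime (2 * m - 1) m.
    rewrite /coprime -dvdn1; apply: (@gcdn_dvd_of_add _ _ 1 2); clear -m0; lia.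
  rewrite -(Gauss_dvdr _ cm) h; have -> : m.-1.*2.+1 = 2 * m - 1 by clear -m0; lia.
  by rewrite dvdn_mulr ?dvdn_mull.
have dk : k %| central_binom m by rewrite kE dvdn_mull.
have ok : odd k by clear -k3; lia.
have o7 : odd (2 * m - 1) by clear -m0; lia.
have r7 : (2 * m - 1) %% 8 = 7 by clear -m0 m4; lia.
have := H _ ok dk; have := H _ o7 d7; rewrite r7 k3.
by move: hc; rewrite !inE => /orP[]/eqP->.
Qed.

Lemma odd_target_eq1 c T m : c \in [:: 3; 7] -> odd_divisors_mod8 c T -> odd T ->
  T = catalan m \/ T = central_binom m -> T = 1.
Proof.
move=> hc H oT [TE|TE]; rewrite TE in H oT *.
  exact: catalan_odd_divisors_odd hc H oT.
by rewrite (@logn2_central_binom_eq0 m) // logn2_odd.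
Qed.

Lemma odd_divisors_square_sub_two (w N : int) (T k : nat) :
  (N = 1 \/ N = -1)%R -> (w ^+ 2 - 2 * N = (k * T)%:Z)%R ->
  odd_divisors_mod8 (if N == 1%R then 7 else 3) T.
Proof.
move=> hN E D oD dD; apply: (@square_sub_two_divisor w) => //.
by rewrite E absz_nat dvdn_mull.
Qed.

Lemma square_sub_two_target (w N : int) (T m : nat) :
  (0 < w)%R -> (N = 1 \/ N = -1)%R -> (w ^+ 2 - 2 * N = T%:Z)%R ->
  T = catalan m \/ T = central_binom m ->
  [\/ (w = 2 /\ N = 1)%R, [/\ w = 2, N = -1 & T = central_binom 2]%R
    | [/\ w = 4, N = 1 & T = catalan 4]%R].
Proof.
move=> w0 hN E hT;
have sq : [\/ (w = 1 /\ w ^+ 2 = 1)%R, (w = 2 /\ w ^+ 2 = 4)%R, (w = 3 /\ w ^+ 2 = 9)%R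
    | (w = 4 /\ w ^+ 2 = 16)%R \/ (25 <= w ^+ 2)%R].
  have [->|[->|[->|[->|w5]]]] : (w = 1 \/ w = 2 \/ w = 3 \/ w = 4 \/ 5 <= w)%R
    by clear -w0; lia.
  - by apply: Or41. - by apply: Or42. - by apply: Or43. - by apply: Or44; left.
  by apply: Or44; right; rewrite (_ : 25 = 5 ^+ 2)%R // ler_sqr ?nnegrE //; lia. have T0 : 0 < T.
  by case: hT => ->; rewrite ?catalan_gt0 ?central_binom_gt0.
have H := @odd_divisors_square_sub_two w N T 1 hN; rewrite mul1n in H.
have {}H := H E.
have hc : (if N == 1%R then 7 else 3) \in [:: 3; 7] by case: ifP.
have [v [w2|w2]] : exists v : int, (w ^+ 2 = 4 * v \/ w ^+ 2 = 4 * v + 1)%R.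
- have [u [->|->]] : exists u, (w = 2 * u \/ w = 2 * u + 1)%R by exists (w %/ 2)%Z; clear; lia.
  + by exists (u ^+ 2)%R; left; ring.
  by exists (u ^+ 2 + u)%R; right; ring.
- have v1 : logn 2 T = 1.
    have [t Tt] : exists t, T = 2 * t.+1 /\ ~~ odd t.
      exists (T %/ 2).-1; rewrite w2 in E; clear -E hN T0; case: hN => hN; rewrite hN in E; lia.
    case: Tt => -> ot; rewrite lognM // (@logn2_odd t.+1) //.
  have T2 : [\/ T = 2, T = central_binom 2 | T = catalan 4].
    case: hT => TE; rewrite TE in H v1 *.
      by have [->|->] := catalan_odd_divisors_even hc H v1; [apply: Or31|apply: Or33].
    by have [->|->] := central_binom_odd_divisors hc H v1; [apply: Or31|apply: Or32].
  clear -sq E T2 hN; case: T2 => TE; rewrite TE in E *.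
  + case: hN => hN; rewrite hN in E *; case: sq => [[_ ?]|[wE ?]|[_ ?]|[[_ ?]|?]];
      first [by exfalso; lia|by rewrite wE; apply: Or31].
  + rewrite (_ : central_binom 2 = 6) // in E *.
    case: hN => hN; rewrite hN in E *; case: sq => [[_ ?]|[wE ?]|[_ ?]|[[_ ?]|?]];
      first [by exfalso; lia|by rewrite wE; apply: Or32].
  rewrite (_ : catalan 4 = 14) // in E *.
  case: hN => hN; rewrite hN in E *; case: sq => [[_ ?]|[_ ?]|[_ ?]|[[wE ?]|?]];
      first [by exfalso; lia|by rewrite wE; apply: Or33].
have oT : odd T.
  by rewrite w2 in E; clear -E hN; case: hN => hN; rewrite hN in E; lia.
exfalso; rewrite (odd_target_eq1 hc H oT hT) in E.
by clear -sq E hN; case: hN => hN; rewrite hN in E; case: sq => [[_ ?]|[_ ?]|[_ ?]|[[_ ?]|?]]; lia.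
Qed.

(** * P6 *)
Local Open Scope ring_scope.

Record is_log (R : realFieldType) (lg : nat -> R) : Prop := IsLog {
  lgM : forall m n, (0 < m)%N -> (0 < n)%N -> lg (m * n)%N = lg m + lg n;
  lg_le : forall m n, (0 < m)%N -> (m <= n)%N -> lg m <= lg n;
  lg2 : lg 2%N = 1 }.

Lemma lg1 (R : realFieldType) (lg : nat -> R) : is_log lg -> lg 1%N = 0.
Proof. by move=> L; have := lgM L (ltn0Sn 0) (ltn0Sn 0); rewrite mul1n; lra. Qed.

Lemma lg_ge0 (R : realFieldType) (lg : nat -> R) n : is_log lg -> (0 < n)%N -> 0 <= lg n.
Proof. by move=> L n0; rewrite -(lg1 L) (lg_le L). Qed.

Lemma lgX (R : realFieldType) (lg : nat -> R) n k :
  is_log lg -> (0 < n)%N -> lg (n ^ k)%N = k%:R * lg n.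
Proof.
move=> L n0; elim: k => [|k IH]; first by rewrite expn0 (lg1 L) mul0r.
by rewrite expnS (lgM L) ?expn_gt0 ?n0 // IH -addn1 natrD mulrDl mul1r addrC.
Qed.

Lemma lg_pow2 (R : realFieldType) (lg : nat -> R) k : is_log lg -> lg (2 ^ k)%N = k%:R.
Proof. by move=> L; rewrite (lgX _ L) // (lg2 L) mulr1. Qed.

Lemma lg_prod (R : realFieldType) (lg : nat -> R) (I : Type) (r : seq I) (P : pred I) (F : I -> nat) :
  is_log lg -> (forall i, P i -> (0 < F i)%N) ->
  lg (\prod_(i <- r | P i) F i)%N = \sum_(i <- r | P i) lg (F i).
Proof.
move=> L F0; elim: r => [|i r IH]; first by rewrite !big_nil (lg1 L).
rewrite !big_cons; case: ifP => // Pi.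
by rewrite (lgM L) ?F0 ?IH // prodn_cond_gt0.
Qed.

(* the prime powers up to X, as pairs (prime, exponent) *)
Definition prime_powers (X : nat) : seq (nat * nat) :=
  [seq (q, a) | q <- [seq q <- iota 0 X.+1 | prime q],
                a <- [seq a <- iota 1 X | (q ^ a <= X)%N]].

Definition psum (R : realFieldType) (lg : nat -> R) (X : nat) (f : nat -> nat -> R) : R :=
  \sum_(qa <- prime_powers X) lg qa.1 * f qa.1 (qa.1 ^ qa.2)%N.

Lemma mem_prime_powers X q a :
  ((q, a) \in prime_powers X) = [&& prime q, (0 < a)%N & (q ^ a <= X)%N].
Proof.
apply/allpairsPdep/and3P => [[q' [a' []]]|[pq a0 qX]].
  by rewrite !mem_filter !mem_iota => /andP[? _] /and3P[? ? _] [-> ->].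
have q1 := prime_gt1 pq.
exists q, a; rewrite !mem_filter !mem_iota pq a0 qX add0n add1n !ltnS; split=> //=.
  by rewrite (leq_trans _ qX) // -{1}(expn1 q) leq_exp2l.
by rewrite (leq_trans _ qX) // ltnW // ltn_expl.
Qed.

Lemma eq_psum (R : realFieldType) (lg : nat -> R) X (f g : nat -> nat -> R) :
  (forall q a, prime q -> (0 < a)%N -> (q ^ a <= X)%N -> f q (q ^ a)%N = g q (q ^ a)%N) ->
  psum lg X f = psum lg X g.
Proof.
move=> fg; apply: eq_big_seq => -[q a]; rewrite mem_prime_powers => /and3P[pq a0 qX] /=.
by rewrite fg.
Qed.

Lemma le_psum (R : realFieldType) (lg : nat -> R) X (f g : nat -> nat -> R) :
  is_log lg ->
  (forall q a, prime q -> (0 < a)%N -> (q ^ a <= X)%N -> f q (q ^ a)%N <= g q (q ^ a)%N) ->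
  psum lg X f <= psum lg X g.
Proof.
move=> L fg; rewrite /psum big_seq [leRHS]big_seq; apply: ler_sum => -[q a].
rewrite mem_prime_powers => /and3P[pq a0 qX] /=.
by rewrite ler_wpM2l ?fg // lg_ge0 ?prime_gt0.
Qed.

Lemma psumD (R : realFieldType) (lg : nat -> R) X (f g : nat -> nat -> R) :
  psum lg X (fun q n => f q n + g q n) = psum lg X f + psum lg X g.
Proof. by rewrite -big_split; apply: eq_bigr => i _ /=; rewrite mulrDr. Qed.

Lemma psumZ (R : realFieldType) (lg : nat -> R) X c (f : nat -> nat -> R) :
  psum lg X (fun q n => c * f q n) = c * psum lg X f.
Proof. by rewrite /psum mulr_sumr; apply: eq_bigr => i _; rewrite mulrCA. Qed.

Lemma psum_sum (R : realFieldType) (lg : nat -> R) X (I : Type) (r : seq I)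
    (f : I -> nat -> nat -> R) :
  psum lg X (fun q n => \sum_(i <- r) f i q n) = \sum_(i <- r) psum lg X (f i).
Proof.
rewrite /psum exchange_big; apply: eq_bigr => i _ /=; by rewrite mulr_sumr.
Qed.

Lemma ler_norm_psum (R : realFieldType) (lg : nat -> R) X (f : nat -> nat -> R) :
  is_log lg -> `|psum lg X f| <= psum lg X (fun q n => `|f q n|).
Proof.
move=> L; apply: (le_trans (ler_norm_sum _ _ _)).
rewrite /psum big_seq [leRHS]big_seq; apply: ler_sum => -[q a].
rewrite mem_prime_powers => /and3P[pq a0 qX] /=.
by rewrite normrM ger0_norm // lg_ge0 ?prime_gt0.
Qed.

Lemma logn_count_dvd_upto (p n X : nat) : prime p -> (0 < n)%N -> (n <= X)%N ->
  logn p n = (\sum_(a <- iota 1 X | p ^ a <= X) (p ^ a %| n))%N.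
Proof.
move=> pp n0 nX; rewrite logn_count_dvd // (big_nat_widen _ _ X.+1); last exact: leqW.
rewrite /index_iota subn1 /= [LHS]big_mkcond [RHS]big_mkcond; apply: eq_bigr => a _ /=.
have [dv|] := boolP (p ^ a %| n)%N; last by rewrite !if_same.
have an := dvdn_leq n0 dv; rewrite (leq_trans an nX) (leq_trans _ an) //.
by rewrite ltn_expl // prime_gt1.
Qed.

(* factorization of j, on the logarithmic scale *)
Lemma psum_dvd (R : realFieldType) (lg : nat -> R) X j :
  is_log lg -> (0 < j <= X)%N -> lg j = psum lg X (fun _ n => (n %| j)%:R).
Proof.
move=> L /andP[j0 jX].
have -> : lg j = \sum_(0 <= q < X.+1 | prime q) (logn q j)%:R * lg q.
  rewrite -{1}(partnT j0) (widen_partn _ jX) (lg_prod _ L); last first.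
    by move=> q _; rewrite expn_gt0; case: q => //=; rewrite lognE.
  rewrite [RHS]big_mkcond; apply: eq_big => //= q _.
  case: ifP => [pq|npq]; first by rewrite (lgX _ L) ?prime_gt0.
  by rewrite lognE npq expn0 (lg1 L).
rewrite /psum big_allpairs_dep big_filter; apply: eq_bigr => q pq /=.
rewrite big_filter mulrC -mulr_sumr; congr (_ * _).
by rewrite (logn_count_dvd_upto pq j0 jX) natr_sum.
Qed.

(** * P7 *)

Lemma logn_fact_upto (p n X : nat) : prime p -> (n <= X)%N ->
  logn p n`! = (\sum_(a <- iota 1 X | p ^ a <= X) n %/ p ^ a)%N.
Proof.
move=> pp nX; rewrite logn_fact // (big_nat_widen _ _ X.+1); last by rewrite ltnS.
rewrite /index_iota subn1 /= [LHS]big_mkcond [RHS]big_mkcond; apply: eq_bigr => a _ /=.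
have [paX|paX] := ltnP n (p ^ a); first by rewrite divn_small // !if_same.
rewrite (leq_trans paX nX) ltnS (leq_trans _ paX) //.
by rewrite ltnW // ltn_expl // prime_gt1.
Qed.

Lemma odd_divn_double (m n : nat) : (0 < n)%N ->
  (m.*2 %/ n = 2 * (m %/ n) + odd (m.*2 %/ n))%N.
Proof.
move=> n0; have -> : (m %/ n = (m.*2 %/ n)./2)%N.
  by rewrite -divn2 -divnMA mulnC divnMA -muln2 mulnK.
by rewrite mul2n addnC odd_double_half.
Qed.

Lemma logn_central_binom (p m X : nat) : prime p -> (m.*2 <= X)%N ->
  logn p (central_binom m) = (\sum_(a <- iota 1 X | p ^ a <= X) odd (m.*2 %/ p ^ a))%N.
Proof.
move=> pp mX; have mX' : (m <= X)%N by rewrite (leq_trans _ mX) // -addnn leq_addr.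
have E : (central_binom m * (m`! * m`!) = (m.*2)`!)%N.
  by have := bin_fact (leq_addr m m); rewrite addnK addnn.
have := congr1 (logn p) E.
rewrite !lognM ?fact_gt0 ?central_binom_gt0 ?muln_gt0 ?fact_gt0 //.
rewrite !(@logn_fact_upto _ _ X) // => {}E.
have D : (\sum_(a <- iota 1 X | p ^ a <= X) m.*2 %/ p ^ a =
    2 * (\sum_(a <- iota 1 X | p ^ a <= X) m %/ p ^ a) +
    \sum_(a <- iota 1 X | p ^ a <= X) odd (m.*2 %/ p ^ a))%N.
  rewrite big_distrr -big_split /=; apply: eq_bigr => a _.
  by rewrite -odd_divn_double // expn_gt0 prime_gt0.
by move: E; rewrite D; clear; lia.
Qed.

Lemma lg_central_binom_partn (R : realFieldType) (lg : nat -> R) X m (pi : nat_pred) :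
  is_log lg -> (m.*2 <= X)%N ->
  lg ((central_binom m)`_pi)%N =
  psum lg X (fun q n => ((q \in pi) && odd (m.*2 %/ n))%:R).
Proof.
move=> L mX; set B := central_binom m.
have B0 : (0 < B)%N := central_binom_gt0 m.
have logn0 q : prime q -> (X < q)%N -> logn q B = 0%N.
  move=> pq Xq; rewrite (logn_central_binom pq mX) big1 // => a _.
  have [->|a0] := posnP a; last rewrite divn_small //.
    by rewrite expn0 divn1 odd_double.
  by rewrite (leq_trans (leq_ltn_trans mX Xq)) // -{1}(expn1 q) leq_exp2l // prime_gt1.
have -> : lg (B`_pi)%N = \sum_(0 <= q < X.+1 | prime q) ((q \in pi) * logn q B)%:R * lg q.
  pose Y := maxn X B.
  have BY : (B <= Y)%N by rewrite leq_maxr.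
  rewrite (widen_partn _ BY) (lg_prod _ L); last first.
    by move=> q _; rewrite expn_gt0; case: q => //=; rewrite lognE.
  rewrite [RHS](big_nat_widen _ _ Y.+1); last by rewrite ltnS leq_maxl.
  rewrite [LHS]big_mkcond [RHS]big_mkcond; apply: eq_big_nat => q _.
  have [pq|npq] := boolP (prime q); last first.
    by rewrite lognE (negbTE npq) expn0 (lg1 L) if_same.
  rewrite (lgX _ L) ?prime_gt0 // ltnS leqNgt /=; case: ltnP => Xq.
    by rewrite logn0 // mul0r if_same.
  by case: ifP => _; rewrite ?mul1n // mul0n mul0r.
rewrite /psum /prime_powers big_allpairs_dep big_filter.
rewrite /index_iota subn0; apply: eq_bigr => q pq /=.
rewrite big_filter mulrC -mulr_sumr; congr (_ * _).
rewrite (logn_central_binom pq mX) big_distrr natr_sum; apply: eq_bigr => a _ /=.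
by rewrite mulnb.
Qed.

Lemma lg_central_binom (R : realFieldType) (lg : nat -> R) X m :
  is_log lg -> (m.*2 <= X)%N ->
  lg (central_binom m) = psum lg X (fun _ n => (odd (m.*2 %/ n))%:R).
Proof.
move=> L mX; rewrite -[central_binom m](partnT (central_binom_gt0 m)).
by rewrite (lg_central_binom_partn _ L mX).
Qed.

Lemma lg_fact (R : realFieldType) (lg : nat -> R) X j :
  is_log lg -> (j <= X)%N -> lg j`! = psum lg X (fun _ n => (j %/ n)%:R).
Proof.
move=> L jX; rewrite fact_prod big_nat_cond (lg_prod _ L); last first.
  by move=> i /andP[/andP[]].
rewrite (eq_bigr (fun i => psum lg X (fun _ n => (n %| i)%:R))); last first.
  move=> i /andP[/andP[i1 ij] _]; apply: psum_dvd => //.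
  by rewrite i1 (leq_trans _ jX) // -ltnS.
rewrite -big_nat_cond -psum_sum; apply: eq_psum => q a pq a0 qX.
by rewrite divn_count_dvd natr_sum.
Qed.

(** * P8 *)

Lemma central_binomS_le m : (central_binom m.+1 <= 2 * 4 ^ m)%N.
Proof.
elim: m => [//|m IH]; rewrite -(leq_pmul2l (ltn0Sn m.+1)) central_binomS.
by rewrite expnS; clear -IH; nia.
Qed.

Lemma central_binom_le m : (central_binom m <= 4 ^ m)%N.
Proof.
by case: m => // m; rewrite (leq_trans (central_binomS_le m)) // expnS leq_pmul2r ?expn_gt0.
Qed.

Lemma central_binom_ge m : (0 < m)%N -> (4 ^ m <= m.*2 * central_binom m)%N.
Proof.
case: m => // m _; elim: m => [//|m IH].
have h := central_binomS m.+1; rewrite -[m.+2.*2]mul2n -mulnA h expnS.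
by clear -IH; nia.
Qed.

Lemma bin_doubleS m : (2 * 'C(m.*2.+1, m) = central_binom m.+1)%N.
Proof.
rewrite /central_binom doubleS binS.
have -> : 'C(m.*2.+1, m.+1) = 'C(m.*2.+1, m).
  by rewrite -bin_sub; [congr ('C(_, _)); clear; lia|clear; lia].
by rewrite addnn mul2n.
Qed.

Lemma leq_divDl_floor (m n d : nat) : (m %/ d + n %/ d <= (m + n) %/ d)%N.
Proof.
have [->|d0] := posnP d; first by rewrite !divn0.
by rewrite leq_divRL // mulnDl leq_add // leq_divM.
Qed.

Lemma psi_le (R : realFieldType) (lg : nat -> R) X z :
  is_log lg -> (z <= X)%N ->
  psum lg X (fun _ n => (n <= z)%N%:R) <= (2 * z)%N%:R.
Proof.
move=> L; elim/ltn_ind: z => z IH zX; have [z1|z2] := leqP z 1.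
  rewrite [leLHS](_ : _ = 0) ?ler0n //; apply: big1_seq => -[q a] /=.
  rewrite mem_prime_powers => /and3P[pq a0 _].
  rewrite leqNgt (leq_ltn_trans z1) ?mulr0 //.
  by rewrite (leq_trans (prime_gt1 pq)) // -{1}(expn1 q) leq_exp2l // prime_gt1.
pose m := z./2; case oz: (odd z).
  have zE : z = m.*2.+1 by rewrite -[LHS]odd_double_half oz.
  have E : ('C(m.*2.+1, m) * (m`! * m.+1`!) = (m.*2.+1)`!)%N.
    have := @bin_fact m.*2.+1 m; have -> : (m.*2.+1 - m = m.+1)%N by clear; lia.
    by apply; clear; lia.
  have C0 : (0 < 'C(m.*2.+1, m))%N by rewrite bin_gt0; clear; lia.
  have := congr1 lg E.
  rewrite (lgM L C0) ?muln_gt0 ?fact_gt0 // (lgM L (fact_gt0 m) (fact_gt0 m.+1)).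
  rewrite !(@lg_fact _ _ X) //; try by clear -zE zX z2; lia.
  have lC : lg 'C(m.*2.+1, m) <= (2 * m)%:R.
    rewrite -(lg_pow2 (2 * m) L); apply: (lg_le L) => //.
    by rewrite expnM -(leq_pmul2l (isT : 0 < 2)%N) bin_doubleS central_binomS_le.
  have I2 : psum lg X (fun _ n => (n <= m.*2.+1)%N%:R) +
      (psum lg X (fun _ n => (m %/ n)%:R) + psum lg X (fun _ n => (m.+1 %/ n)%:R)) <=
      psum lg X (fun _ n => (n <= m.+1)%N%:R) + psum lg X (fun _ n => (m.*2.+1 %/ n)%:R).
    rewrite -!psumD; apply: le_psum => // q a pq a0 _.
    have n0 : (0 < q ^ a)%N by rewrite expn_gt0 prime_gt0.
    rewrite -!natrD ler_nat; move: (q ^ a)%N n0 => n n0.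
    have -> : m.*2.+1 = (m + m.+1)%N by clear; lia.
    have [nz|nz] := leqP n m.+1.
      by rewrite leq_add ?leq_b1 // leq_divDl_floor.
    rewrite (divn_small nz) (divn_small (ltnW nz)) addn0 add0n.
    by rewrite -(divn_gt0 _ n0); case: ((m + m.+1) %/ n)%N.
  move=> E2; have I3 : psum lg X (fun _ n => (n <= m.+1)%N%:R) <= (2 * m.+1)%:R.
    by apply: IH; clear -zE zX z2; lia.
  have -> : (2 * z)%:R = (2 * m)%:R + (2 * m.+1)%:R :> R.
    by rewrite -natrD zE; congr (_%:R); clear; lia.
  by rewrite zE; rewrite -E2 in I2; move: lC I2 I3; lra.
have zE : z = m.*2 by rewrite -[LHS]odd_double_half oz.
have I3 : psum lg X (fun _ n => (n <= m)%N%:R) <= (2 * m)%:R.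
  by apply: IH; clear -zE zX z2; lia.
have lB : lg (central_binom m) <= (2 * m)%:R.
  rewrite -(lg_pow2 (2 * m) L); apply: (lg_le L); first exact: central_binom_gt0.
  by rewrite expnM central_binom_le.
rewrite (@lg_central_binom _ _ X) // -?zE // in lB.
apply: (@le_trans _ _ (psum lg X (fun _ n => (n <= m)%N%:R) +
    psum lg X (fun _ n => (odd (z %/ n))%:R))).
  rewrite -psumD; apply: le_psum => // q a pq a0 _.
  rewrite -natrD ler_nat; have [nz|//] := leqP (q ^ a) z.
  have [//|nm] := leqP (q ^ a) m.
  have -> : (z %/ q ^ a = 1)%N; last by [].
  by apply/eqP; rewrite eqn_leq -ltnS ltn_divLR ?leq_divRL ?expn_gt0 ?prime_gt0 // mul1n nz andbT; clear -nm zE; lia.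
have -> : (2 * z)%:R = (2 * m)%:R + (2 * m)%:R :> R.
  by rewrite -natrD zE; congr (_%:R); clear; lia.
by move: lB I3; lra.
Qed.

(** * P9 *)

Definition partial_sum (R : pzRingType) (chi : nat -> R) (y : nat) : R :=
  \sum_(1 <= e < y.+1) chi e.

Lemma partial_sumS (R : pzRingType) (chi : nat -> R) y :
  partial_sum chi y.+1 = partial_sum chi y + chi y.+1.
Proof. by rewrite /partial_sum big_nat_recr. Qed.

Lemma sum_multiples (R : pzRingType) (F : nat -> R) (n y : nat) : (0 < n)%N ->
  \sum_(1 <= j < y.+1) F j * (n %| j)%N%:R = \sum_(1 <= e < (y %/ n).+1) F (e * n)%N.
Proof.
move=> n0; elim: y => [|y IH]; first by rewrite div0n !big_geq.
rewrite big_nat_recr //= IH.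
have [nd|nd] := boolP (n %| y.+1)%N; last first.
  by rewrite mulr0 addr0 divnS // (negbTE nd).
have yn : (y.+1 %/ n = (y %/ n).+1)%N by rewrite divnS // nd.
by rewrite mulr1 yn [RHS]big_nat_recr //= -yn divnK.
Qed.

(* Abel summation *)
Lemma abel_sum_log (R : realFieldType) (lg : nat -> R) (chi : nat -> R) y :
  is_log lg -> (forall t, `|partial_sum chi t| <= 1) -> (0 < y)%N ->
  `|\sum_(1 <= j < y.+1) chi j * lg j| <= 2 * lg y.
Proof.
move=> L H1 y0.
suff h : `|\sum_(1 <= j < y.+1) chi j * lg j - partial_sum chi y * lg y| <= lg y.
  have h2 : `|partial_sum chi y * lg y| <= lg y.
    by rewrite normrM (ger0_norm (lg_ge0 L y0)) ler_piMl // lg_ge0.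
  by have := ler_normD (\sum_(1 <= j < y.+1) chi j * lg j - partial_sum chi y * lg y)
    (partial_sum chi y * lg y); rewrite subrK; move: h h2; clear; lra.
case: y y0 => // y _; elim: y => [|y IH].
  by rewrite /partial_sum !big_nat1 (lg1 L) !mulr0 subrr normr0.
rewrite big_nat_recr //= partial_sumS.
set S := \sum_(_ <= _ < _) _ in IH *; set H := partial_sum chi y.+1 in IH *.
have -> : S + chi y.+2 * lg y.+2 - (H + chi y.+2) * lg y.+2 =
  (S - H * lg y.+1) - H * (lg y.+2 - lg y.+1) by ring.
apply: (le_trans (ler_normB _ _)).
have d0 : 0 <= lg y.+2 - lg y.+1 by rewrite subr_ge0 (lg_le L).
have := H1 y.+1; rewrite -/H normrM (ger0_norm d0) => H1'.
have : `|H| * (lg y.+2 - lg y.+1) <= lg y.+2 - lg y.+1 by rewrite ler_piMl.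
by move: IH; clear; lra.
Qed.

Lemma psum_character (R : realFieldType) (lg : nat -> R) (chi : nat -> R) X y :
  is_log lg -> (y <= X)%N -> (forall e n, chi (e * n)%N = chi e * chi n) ->
  \sum_(1 <= j < y.+1) chi j * lg j =
  psum lg X (fun _ n => chi n * partial_sum chi (y %/ n)).
Proof.
move=> L yX chiM.
rewrite (eq_big_nat _ _ (F2 := fun j => psum lg X (fun _ n => chi j * (n %| j)%N%:R))); last first.
  move=> j /andP[j1 jy]; rewrite psumZ -psum_dvd // j1 /= (leq_trans _ yX) //.
rewrite -psum_sum; apply: eq_psum => q a pq a0 _.
have n0 : (0 < q ^ a)%N by rewrite expn_gt0 prime_gt0.
rewrite sum_multiples // /partial_sum mulr_sumr; apply: eq_bigr => e _.
by rewrite chiM mulrC.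
Qed.

Lemma character_certificate (R : realFieldType) (lg : nat -> R) (chi : nat -> R)
    (bs st : seq (R * nat)) (x : nat) :
  is_log lg -> (forall e n, chi (e * n)%N = chi e * chi n) ->
  (forall n, `|chi n| <= 1) -> (forall y, `|partial_sum chi y| <= 1) ->
  (forall bk, bk \in bs -> (0 < bk.2 <= x)%N) ->
  (forall cY, cY \in st -> (0 < cY.2)%N /\ 0 <= cY.1) ->
  (forall y, (0 < y)%N ->
     `|(odd y)%:R - \sum_(bk <- bs) bk.1 * partial_sum chi (y %/ bk.2)|
     <= \sum_(cY <- st) cY.1 * (cY.2 <= y)%N%:R) ->
  psum lg x (fun _ n => chi n * (odd (x %/ n))%:R) <=
  \sum_(bk <- bs) `|bk.1| * (2 * lg (x %/ bk.2)%N) +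
  \sum_(cY <- st) cY.1 * (2 * (x %/ cY.2))%N%:R.
Proof.
move=> L chiM chi1 H1 bs0 st0 cert.
pose G y := \sum_(bk <- bs) bk.1 * partial_sum chi (y %/ bk.2).
have -> : psum lg x (fun _ n => chi n * (odd (x %/ n))%:R) =
    \sum_(bk <- bs) bk.1 * (\sum_(1 <= j < (x %/ bk.2).+1) chi j * lg j) +
    psum lg x (fun _ n => chi n * ((odd (x %/ n))%:R - G (x %/ n)%N)).
  rewrite (eq_big_seq (fun bk => psum lg x (fun _ n => bk.1 * (chi n * partial_sum chi ((x %/ n) %/ bk.2))))).
    rewrite -psum_sum -psumD; apply: eq_psum => q a pq a0 _.
    rewrite mulrBr addrC -addrA [X in _ = _ + X](_ : _ = 0) ?addr0 //.
    rewrite addrC; apply/eqP; rewrite subr_eq0 /G mulr_sumr; apply/eqP.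
    by apply: eq_bigr => bk _; rewrite mulrCA.
  move=> bk _; rewrite (@psum_character _ _ _ x) ?leq_div // -psumZ.
  by apply: eq_psum => q a _ _ _; rewrite divnAC.
apply: lerD.
  rewrite big_seq [leRHS]big_seq; apply: ler_sum => bk /bs0/andP[k0 kx].
  apply: (le_trans (ler_norm _)); rewrite normrM ler_wpM2l //.
  by rewrite abel_sum_log // divn_gt0.
apply: (le_trans (ler_norm _)); apply: (le_trans (ler_norm_psum _ _ L)).
apply: (@le_trans _ _ (psum lg x (fun _ n => \sum_(cY <- st) cY.1 * (cY.2 <= x %/ n)%N%:R))).
  apply: le_psum => // q a pq a0 qX; rewrite normrM.
  apply: (@le_trans _ _ (1 * `|(odd (x %/ q ^ a))%:R - G (x %/ q ^ a)%N|)).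
    by rewrite ler_wpM2r.
  by rewrite mul1r cert // divn_gt0 // expn_gt0 prime_gt0.
rewrite psum_sum big_seq [leRHS]big_seq; apply: ler_sum => cY /st0[Y0 c0].
rewrite psumZ ler_wpM2l //.
apply: le_trans (psi_le L (leq_div x cY.2)).
apply: le_psum => // q a pq a0 _.
have n0 : (0 < q ^ a)%N by rewrite expn_gt0 prime_gt0.
by rewrite leq_divRL // leq_divRL // mulnC.
Qed.

(** * P10 *)

Notation Z := BinNums.Z.
Notation N := BinNums.N.

Definition chi_of (T : seq Z) (n : nat) : Z := nth 0 T (n %% size T).

Definition counter : Type := (Z * nat * nat * seq Z)%type.

Definition tick (T : seq Z) (c : counter) : Z * counter :=
  match c with
  | (b, k, t.+1, ph) => (BinNums.Z0, (b, k, t, ph))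
  | (b, k, 0%N, v :: ph) => (BinInt.Z.mul b v, (b, k, k, ph))
  | (b, k, 0%N, [::]) => (BinInt.Z.mul b (head BinNums.Z0 T), (b, k, k, behead T))
  end.

Fixpoint ticks (T : seq Z) (s : Z) (cs : seq counter) : Z * seq counter :=
  if cs is c :: cs1 then
    let (v, c1) := tick T c in
    let (s1, cs2) := ticks T (if v is BinNums.Z0 then s else BinInt.Z.add s v) cs1 in
    (s1, c1 :: cs2)
  else (s, [::]).

Definition weight (c : counter) : Z := c.1.1.1.
Definition scale (c : counter) : nat := c.1.1.2.+1.

Definition counter_at (T : seq Z) (y : nat) (c : counter) : Prop :=
  let: (b, k, t, ph) := c in
  (t = k - y %% k.+1)%N /\
  (ph = drop ((y %/ k.+1).+1 %% size T) T \/
   (((y %/ k.+1).+1 %% size T = 0)%N /\ ph = [::])).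

Definition counters_sum (T : seq Z) (cs : seq counter) (y : nat) : Z :=
  \sum_(c <- cs) weight c * partial_sum (chi_of T) (y %/ scale c).

Lemma tickP (T : seq Z) (y : nat) (c : counter) :
  (0 < size T)%N -> counter_at T y c ->
  [/\ counter_at T y.+1 (tick T c).2, weight (tick T c).2 = weight c,
      scale (tick T c).2 = scale c &
      weight c * partial_sum (chi_of T) (y %/ scale c) + (tick T c).1 =
      weight c * partial_sum (chi_of T) (y.+1 %/ scale c)].
Proof.
move=> T0; case: c => [[[b k] t] ph] [tE phE] /=; rewrite /weight /scale /=.
have := divn_eq y k.+1; have rk := ltn_pmod y (ltn0Sn k).
set Q := (y %/ k.+1)%N in phE *; set r := (y %% k.+1)%N in tE rk *; move=> yE.
case: t tE => [|t] tE.
  have r_k : r = k by clear -tE rk; lia.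
  have y1 : y.+1 = (Q.+1 * k.+1)%N by rewrite yE r_k; clear; lia.
  have d1 : (y.+1 %/ k.+1 = Q.+1)%N by rewrite y1 mulnK.
  have m1 : (y.+1 %% k.+1 = 0)%N by rewrite y1 modnMl.
  have step v ph' : v = chi_of T Q.+1 ->
    (ph' = drop (Q.+2 %% size T) T \/ (Q.+2 %% size T = 0)%N /\ ph' = [::]) ->
    [/\ counter_at T y.+1 (b, k, k, ph'), b = b, k.+1 = k.+1 &
      b * partial_sum (chi_of T) Q + BinInt.Z.mul b v =
      b * partial_sum (chi_of T) (y.+1 %/ k.+1)].
    move=> vE phE'; split=> //; first by rewrite /counter_at d1 m1 subn0.
    by rewrite d1 partial_sumS mulrDr vE.
  set i := (Q.+1 %% size T)%N in phE.
  have iT : (i < size T)%N by rewrite ltn_mod.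
  have Q2 : (Q.+2 %% size T = if i.+1 == size T then 0 else i.+1)%N.
    rewrite -addn1 -modnDml -/i addn1.
    case: eqP => [->|/eqP h]; first by rewrite modnn.
    by rewrite modn_small // ltn_neqAle h.
  have nxt : drop i.+1 T = drop (Q.+2 %% size T) T \/
     (Q.+2 %% size T = 0)%N /\ drop i.+1 T = [::].
    rewrite Q2; case: eqP => [->|_]; last by left.
    by right; rewrite drop_size.
  case: phE => [->|[i0 ->]].
    by rewrite (drop_nth 0 iT) /=; apply: step.
  rewrite i0 in nxt iT *; apply: step; last by rewrite -drop1.
  by rewrite /chi_of -/i i0; case: (T).
have rk1 : (r < k)%N by clear -tE; lia.
have y1 : y.+1 = (Q * k.+1 + r.+1)%N by rewrite yE addnS.
have d1 : (y.+1 %/ k.+1 = Q)%N by rewrite y1 divnMDl // divn_small ?addn0.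
have m1 : (y.+1 %% k.+1 = r.+1)%N by rewrite y1 modnMDl modn_small.
split=> //=; last by rewrite d1 addr0.
by rewrite d1 m1; split=> //; clear -tE; lia.
Qed.

Lemma ticksP (T : seq Z) (y : nat) (s : Z) (cs : seq counter) :
  (0 < size T)%N -> (forall c, c \in cs -> counter_at T y c) ->
  [/\ forall c, c \in (ticks T s cs).2 -> counter_at T y.+1 c,
      forall z, counters_sum T (ticks T s cs).2 z = counters_sum T cs z &
      (ticks T s cs).1 = s + (counters_sum T cs y.+1 - counters_sum T cs y)].
Proof.
move=> T0; elim: cs s => [|c cs IH] s H /=.
  by split=> //; rewrite /counters_sum !big_nil subrr addr0.
have [c1 wE sE vE] := tickP T0 (H c (mem_head _ _)).
case: (tick T c) c1 wE sE vE => v c' /= c1 wE sE vE.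
set s' := (match v with BinNums.Z0 => s | _ => _ end).
have s'E : s' = s + v by rewrite /s'; case: v {vE s'} => //; rewrite addr0.
have [|I1 I2 I3] := IH s'; first by move=> c0 c0cs; apply: H; rewrite inE c0cs orbT.
case: (ticks T s' cs) I1 I2 I3 => s1 cs2 /= I1 I2 I3; split.
- by move=> c0; rewrite inE => /orP[/eqP->|/I1].
- by move=> z; rewrite /counters_sum !big_cons wE sE; congr (_ + _); apply: I2.
by rewrite I3 s'E /counters_sum !big_cons -vE; ring.
Qed.

Fixpoint check_run (T : seq Z) (n : nat) (y : N) (odd : bool) (s D : Z)
    (cs : seq counter) (st : seq (N * Z)) : bool :=
  if n is n1.+1 then
    let (s1, cs1) := ticks T s cs in
    let d := BinInt.Z.abs (BinInt.Z.sub (if odd then BinNums.Zpos BinNums.xH else BinNums.Z0) s1) in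
    let next D1 st1 :=
      if BinInt.Z.leb d D1 then
        check_run T n1 (BinNat.N.succ y) (negb odd) s1 D1 cs1 st1
      else false in
    match st with
    | (Y, c) :: st1 => if BinNat.N.eqb Y y then next (BinInt.Z.add D c) st1 else next D st
    | [::] => next D st
    end
  else true.

Definition steps_sum (st : seq (N * Z)) (j : nat) : Z :=
  \sum_(Yc <- st) Yc.2 * (BinNat.N.to_nat Yc.1 <= j)%N%:R.

Lemma check_runP (T : seq Z) n yN y s D cs st :
  (0 < size T)%N -> BinNat.N.to_nat yN = y.+1 ->
  check_run T n yN (odd y.+1) s D cs st ->
  (forall c, c \in cs -> counter_at T y c) -> s = counters_sum T cs y ->
  (forall Yc, Yc \in st -> 0 <= Yc.2) ->
  forall j, (y < j <= y + n)%N ->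
  `|(odd j)%:R - counters_sum T cs j| <= D + steps_sum st j.
Proof.
move=> T0; elim: n => [|n IH] in yN y s D cs st *.
  by move=> _ _ _ _ _ j /andP[yj]; rewrite addn0 leqNgt yj.
move=> yE; rewrite [check_run _ _ _ _ _ _ _ _]/=.
case E: (ticks T s cs) => [s1 cs1] H csy sE st0.
have [] := ticksP s T0 csy; rewrite E /= => cs1y cs1E s1E.
have {}s1E : s1 = counters_sum T cs y.+1 by rewrite s1E sE addrC subrK.
set d := BinInt.Z.abs _ in H.
have dE : d = `|(odd y.+1)%:R - counters_sum T cs y.+1|.
  by rewrite /d s1E [odd y.+1]/=; case: (odd y).
suff next D1 st1 : (forall j, (y < j)%N -> D1 + steps_sum st1 j <= D + steps_sum st j) ->
    (forall Yc, Yc \in st1 -> 0 <= Yc.2) ->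
    (if BinInt.Z.leb d D1 then
        check_run T n (BinNat.N.succ yN) (negb (odd y.+1)) s1 D1 cs1 st1
      else false) ->
    forall j, (y < j <= y + n.+1)%N ->
    `|(odd j)%:R - counters_sum T cs j| <= D + steps_sum st j.
  case: st st0 H next => [|[Y c] st] st0 H next; first exact: (next D [::]).
  move: H; case: BinNat.N.eqb_spec => [YE|_] H; last exact: (next D _ _ _ H).
  apply: (next _ _ _ _ H) => [j yj|Yc Ycst]; last by apply: st0; rewrite inE Ycst orbT.
  by rewrite /steps_sum big_cons /= YE yE yj mulr1 addrA.
move=> D1E st10; case: ifP => // dD H1 j /andP[yj jn].
apply: le_trans (D1E j yj); have [jy|jy] := eqVneq j y.+1.
  rewrite jy -dE; have : 0 <= steps_sum st1 y.+1.
    rewrite /steps_sum big_seq sumr_ge0 // => Yc /st10 c0.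
    by rewrite mulr_ge0 // ler0n.
  by move: dD; lia.
rewrite -cs1E; apply: (IH _ y.+1 _ _ _ _ _ H1) => //.
- by rewrite Nnat.N2Nat.inj_succ yE.
- by rewrite cs1E.
by rewrite ltn_neqAle eq_sym jy yj /= addSnnS.
Qed.

Definition counter_init (T : seq Z) (bk : Z * nat) : counter :=
  (bk.1, bk.2, bk.2, behead T).

(* The check covers 0 < y <= n; beyond n the trivial bound suffices. *)
Definition certificate_ok (T : seq Z) (n : nat) (bs : seq (Z * nat)) (st : seq (N * Z)) : bool :=
  [&& check_run T n (BinNums.Npos BinNums.xH) true BinNums.Z0 BinNums.Z0
        [seq counter_init T bk | bk <- bs] st,
      BinInt.Z.leb (BinInt.Z.add (BinNums.Zpos BinNums.xH) (foldr (fun bk a => BinInt.Z.add (BinInt.Z.abs bk.1) a) BinNums.Z0 bs))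
        (foldr (fun Yc a => BinInt.Z.add Yc.2 a) BinNums.Z0 st)
    & all (fun Yc => [&& BinInt.Z.leb BinNums.Z0 Yc.2, BinNat.N.leb (BinNums.Npos BinNums.xH) Yc.1
         & BinNat.N.leb Yc.1 (BinNat.N.of_nat n)]) st].

Lemma certificateP (T : seq Z) n bs st :
  (1 < size T)%N -> certificate_ok T n bs st ->
  (forall y, `|partial_sum (chi_of T) y| <= 1) ->
  forall j, (0 < j)%N ->
  `|(odd j)%:R - \sum_(bk <- bs) bk.1 * partial_sum (chi_of T) (j %/ bk.2.+1)|
    <= steps_sum st j.
Proof.
move=> T1 /and3P[H1 H2 H3] Hbd j j0.
have GE : \sum_(bk <- bs) bk.1 * partial_sum (chi_of T) (j %/ bk.2.+1) =
   counters_sum T [seq counter_init T bk | bk <- bs] j.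
  by rewrite /counters_sum big_map.
have c0 Yc : Yc \in st -> 0 <= Yc.2 by move=> /(allP H3)/and3P[].
have [jn|jn] := leqP j n.
  rewrite GE -[leRHS]add0r; apply: (@check_runP T n _ 0%N _ _ _ _ _ _ H1) => //.
  - exact: ltn_trans T1.
  - move=> c /mapP[bk _ ->]; rewrite /counter_init /counter_at mod0n subn0; split=> //.
    by left; rewrite div0n modn_small // drop1.
  - rewrite /counters_sum big_map big1 // => bk _.
    by rewrite div0n /partial_sum big_geq // mulr0.
  by rewrite j0 add0n jn.
apply: (@le_trans _ _ (1 + \sum_(bk <- bs) `|bk.1|)).
  apply: (le_trans (ler_normB _ _)); apply: lerD.
    by case: (odd j); rewrite /= ?normr1 ?normr0.
  apply: (le_trans (ler_norm_sum _ _ _)); apply: ler_sum => bk _.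
  by rewrite normrM ler_piMr.
have -> : steps_sum st j = foldr (fun Yc a => BinInt.Z.add Yc.2 a) BinNums.Z0 st.
  rewrite /steps_sum unlock /=.
  have H3' := allP H3; elim: st {H1 H2 H3 c0} H3' => //= Yc st IH H3.
  rewrite IH; last by move=> z zst; apply: H3; rewrite inE zst orbT.
  have /and3P[_ _ h] := H3 _ (mem_head _ _).
  have -> : (BinNat.N.to_nat Yc.1 <= j)%N by lia.
  by rewrite mulr1.
have -> : \sum_(bk <- bs) `|bk.1| =
    foldr (fun bk a => BinInt.Z.add (BinInt.Z.abs bk.1) a) BinNums.Z0 bs.
  by rewrite unlock /=; elim: (bs) => //= bk bs' ->.
exact: H2.
Qed.

(** * P11 *)

Fixpoint inversion_coefs (T : seq Z) (n k : nat) (odd : bool) (cs : seq counter) (s : Z) :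
    seq (Z * nat) :=
  if n is n1.+1 then
    let (s1, cs1) := ticks T s cs in
    let u := if odd then BinNums.Zpos BinNums.xH else BinNums.Z0 in
    let b := BinInt.Z.sub u s1 in
    if b is BinNums.Z0 then inversion_coefs T n1 k.+1 (negb odd) cs1 u
    else (b, k) :: inversion_coefs T n1 k.+1 (negb odd) ((b, k, k, behead (behead T)) :: cs1) u
  else [::].

Fixpoint record_steps (T : seq Z) (n : nat) (y : N) (odd : bool) (s D : Z)
    (cs : seq counter) (final : Z) : seq (N * Z) :=
  if n is n1.+1 then
    let (s1, cs1) := ticks T s cs in
    let d := BinInt.Z.abs (BinInt.Z.sub (if odd then BinNums.Zpos BinNums.xH else BinNums.Z0) s1) in
    if BinInt.Z.leb d D then record_steps T n1 (BinNat.N.succ y) (negb odd) s1 D cs1 final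
    else (y, BinInt.Z.sub d D) :: record_steps T n1 (BinNat.N.succ y) (negb odd) s1 d cs1 final
  else [:: (BinNat.N.pred y, BinInt.Z.sub final D)].

Definition abs_sum (bs : seq (Z * nat)) : Z :=
  foldr (fun bk a => BinInt.Z.add (BinInt.Z.abs bk.1) a) BinNums.Z0 bs.

Definition table12 : seq Z := Eval vm_compute in [:: 0; 1; 0; 0; 0; -1; 0; -1; 0; 0; 0; 1].
Definition table3 : seq Z := Eval vm_compute in [:: 0; 1; -1].
Definition cut := 200%N.
Definition range := (120 * 100)%N.

Definition coefs12 := Eval vm_compute in inversion_coefs table12 cut 0 true [::] BinNums.Z0.
Definition steps12 := Eval vm_compute in
  record_steps table12 range (BinNums.Npos BinNums.xH) true BinNums.Z0 BinNums.Z0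
    [seq counter_init table12 bk | bk <- coefs12] (BinInt.Z.succ (abs_sum coefs12)).
Lemma ok12 : certificate_ok table12 range coefs12 steps12.
Proof. by vm_compute. Qed.
Definition coefs3 := Eval vm_compute in inversion_coefs table3 cut 0 true [::] BinNums.Z0.
Definition steps3 := Eval vm_compute in
  record_steps table3 range (BinNums.Npos BinNums.xH) true BinNums.Z0 BinNums.Z0
    [seq counter_init table3 bk | bk <- coefs3] (BinInt.Z.succ (abs_sum coefs3)).
Lemma ok3 : certificate_ok table3 range coefs3 steps3.
Proof. by vm_compute. Qed.

Definition zr (R : realFieldType) (z : Z) : R := (int_of_Z z)%:~R.

Lemma zrD (R : realFieldType) a b : zr R (a + b) = zr R a + zr R b.
Proof. by rewrite /zr !rmorphD. Qed.
Lemma zrM (R : realFieldType) a b : zr R (a * b) = zr R a * zr R b.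
Proof. by rewrite /zr !rmorphM. Qed.
Lemma zrN (R : realFieldType) a : zr R (- a) = - zr R a.
Proof. by rewrite /zr !rmorphN. Qed.
Lemma zr_nat (R : realFieldType) n : zr R n%:R = n%:R.
Proof. by rewrite /zr !rmorph_nat. Qed.
Lemma zrX (R : realFieldType) a n : zr R (a ^+ n) = zr R a ^+ n.
Proof. by rewrite /zr !rmorphXn. Qed.
Lemma zr_sum (R : realFieldType) (I : Type) (r : seq I) (F : I -> Z) :
  zr R (\sum_(i <- r) F i) = \sum_(i <- r) zr R (F i).
Proof. by rewrite /zr !rmorph_sum. Qed.
Lemma le_zr (R : realFieldType) (a b : Z) : a <= b -> zr R a <= zr R b.
Proof. by move=> ab; rewrite /zr ler_int; lia. Qed.
Lemma norm_zr (R : realFieldType) (a : Z) : `|zr R a| = zr R `|a|.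
Proof.
have [a0|a0] := leP 0 a.
  by rewrite !ger0_norm // -[0](zr_nat R 0) le_zr.
by rewrite !ltr0_norm ?zrN // -[0](zr_nat R 0) /zr ltr_int; lia.
Qed.

Lemma partial_sum_zr (R : realFieldType) (chi : nat -> Z) y :
  partial_sum (fun n => zr R (chi n)) y = zr R (partial_sum chi y).
Proof. by rewrite /partial_sum zr_sum. Qed.

Definition character_table (T : seq Z) (p : nat) (Hs : seq Z) : bool :=
  [&& (1 < p)%N, size T == p, size Hs == p,
      all (fun a => all (fun b =>
        nth 0 T ((a * b) %% p) == nth 0 T a * nth 0 T b) (iota 0 p)) (iota 0 p),
      all (fun z => `|z| <= 1) T, nth 0 Hs 0 == 0,
      all (fun r => nth 0 Hs (r.+1 %% p) == nth 0 Hs r + nth 0 T (r.+1 %% p)) (iota 0 p)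
    & all (fun z => `|z| <= 1) Hs].

Lemma character_tableP T p Hs : character_table T p Hs ->
  [/\ (1 < size T)%N, forall e n, chi_of T (e * n) = chi_of T e * chi_of T n,
     forall n, `|chi_of T n| <= 1 & forall y, `|partial_sum (chi_of T) y| <= 1].
Proof.
case/and5P=> p1 /eqP sT /eqP sH mulT /and4P[T1 /eqP H0 HS H1].
have p0 : (0 < p)%N by rewrite ltnW.
split=> [|e n|n|y]; first by rewrite sT.
- rewrite /chi_of sT -modnMm.
  have in_p i : (i %% p)%N \in iota 0 p by rewrite mem_iota add0n ltn_mod.
  by have := allP (allP mulT _ (in_p e)) _ (in_p n) => /eqP.
- by apply: (allP T1); rewrite mem_nth // sT ltn_mod.
have -> : partial_sum (chi_of T) y = nth 0 Hs (y %% p).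
  elim: y => [|y IH]; first by rewrite /partial_sum big_geq // mod0n H0.
  have yE : (y.+1 %% p = (y %% p).+1 %% p)%N by rewrite -addn1 -modnDml addn1.
  have /(allP HS)/eqP h : (y %% p)%N \in iota 0 p by rewrite mem_iota add0n ltn_mod.
  by rewrite partial_sumS IH /chi_of sT yE h.
by apply: (allP H1); rewrite mem_nth // sH ltn_mod.
Qed.

Definition log_sum (bs : seq (Z * nat)) : Z :=
  foldr (fun bk a => BinInt.Z.add (BinInt.Z.mul (BinInt.Z.abs bk.1)
     (BinInt.Z.log2 (BinInt.Z.pow (BinInt.Z.of_nat bk.2.+1) (BinInt.Z.of_nat 16)))) a) BinNums.Z0 bs.

Definition million2 : Z := Eval vm_compute in BinInt.Z.mul (BinInt.Z.of_nat 2000) (BinInt.Z.of_nat 1000).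

Definition step_cost (st : seq (N * Z)) : Z :=
  foldr (fun Yc a => BinInt.Z.add (BinInt.Z.mul Yc.2
     (BinInt.Z.succ (BinInt.Z.div million2 (BinInt.Z.of_N Yc.1)))) a) BinNums.Z0 st.

Lemma lg_ge_log2 (R : realFieldType) (lg : nat -> R) (k : nat) :
  is_log lg -> (0 < k)%N ->
  zr R (BinInt.Z.log2 (BinInt.Z.pow (BinInt.Z.of_nat k) (BinInt.Z.of_nat 16))) <= 16 * lg k.
Proof.
move=> L k0; set z := BinInt.Z.pow _ _.
have zE : z = BinInt.Z.of_nat (k ^ 16) by rewrite /z; lia.
have z0 : BinInt.Z.lt BinNums.Z0 z by rewrite zE; lia.
have [h _] := BinInt.Z.log2_spec z z0.
have l0 := BinInt.Z.log2_nonneg z.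
pose l := BinInt.Z.to_nat (BinInt.Z.log2 z).
have lE : BinInt.Z.log2 z = BinInt.Z.of_nat l by rewrite /l; lia.
have lE' : BinInt.Z.log2 z = l%:R by rewrite lE; lia.
rewrite lE' zr_nat -(lg_pow2 l L) -(lgX 16 L k0); apply: (lg_le L); first by rewrite expn_gt0.
by move: h; rewrite lE zE; lia.
Qed.

Lemma abs_sum_cons bk bs : abs_sum (bk :: bs) = `|bk.1| + abs_sum bs.
Proof. by []. Qed.

Lemma log_sum_cons bk bs : log_sum (bk :: bs) = `|bk.1| *
  BinInt.Z.log2 (BinInt.Z.pow (BinInt.Z.of_nat bk.2.+1) (BinInt.Z.of_nat 16)) + log_sum bs.
Proof. by []. Qed.

Lemma step_cost_cons Yc st : step_cost (Yc :: st) = Yc.2 *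
  BinInt.Z.succ (BinInt.Z.div million2 (BinInt.Z.of_N Yc.1)) + step_cost st.
Proof. by []. Qed.

Lemma certificate_bound (R : realFieldType) (lg : nat -> R) T p Hs n bs st x :
  is_log lg -> character_table T p Hs -> certificate_ok T n bs st ->
  all (fun bk => bk.2 < x)%N bs ->
  psum lg x (fun _ k => zr R (chi_of T k) * (odd (x %/ k))%:R) <=
  2 * zr R (abs_sum bs) * lg x - zr R (log_sum bs) / 8
    + zr R (step_cost st) * x%:R / 10 ^+ 6.
Proof.
move=> L tab ok bsx; have [T1 chiM chi1 Hbd] := character_tableP tab.
have cert := certificateP T1 ok Hbd.
have /and3P[_ _ st0] := ok.
pose bs' := [seq (zr R bk.1, bk.2.+1) | bk <- bs].
pose st' := [seq (zr R Yc.2, BinNat.N.to_nat Yc.1) | Yc <- st].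
have h := @character_certificate R lg (fun k => zr R (chi_of T k)) bs' st' x L.
apply: (le_trans (h _ _ _ _ _ _)) => {h}.
- by move=> e k; rewrite chiM zrM.
- by move=> k; rewrite norm_zr -[1](zr_nat R 1) le_zr.
- by move=> y; rewrite partial_sum_zr norm_zr -[1](zr_nat R 1) le_zr.
- by move=> bk /mapP[bk' /(allP bsx) h ->].
- move=> cY /mapP[Yc /(allP st0)/and3P[c0 Y0 _] ->] /=; split; first by lia.
  by rewrite -[0](zr_nat R 0) le_zr.
- move=> y /cert /(le_zr R); rewrite -norm_zr zrD zrN zr_nat zr_sum /steps_sum zr_sum.
  rewrite !big_map /=; congr (_ <= _).
    congr (`|_ - _|); apply: eq_bigr => bk _.
    by rewrite zrM partial_sum_zr.
  by apply: eq_bigr => Yc _; rewrite zrM zr_nat.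
apply: lerD.
  rewrite big_map /=; elim: (bs) bsx => [_|bk bs0 IH /andP[kx bsx]].
    rewrite big_nil /abs_sum /log_sum /=.
    by rewrite -[BinNums.Z0]/(0%:R : Z) zr_nat !mulr0 !mul0r subrr.
  rewrite big_cons; move: {IH} (IH bsx) => IH; apply: (le_trans (lerD (lexx _) IH)).
  rewrite abs_sum_cons log_sum_cons !(zrD, zrM) -norm_zr; set b : R := `|_|; set l := zr R (BinInt.Z.log2 _).
  have l1 : l <= 16 * lg bk.2.+1 by apply: lg_ge_log2.
  have l2 : lg (x %/ bk.2.+1)%N + lg bk.2.+1 <= lg x.
    rewrite -(lgM L) ?divn_gt0 //; apply: (lg_le L); last exact: leq_divM.
    by rewrite muln_gt0 divn_gt0 ?kx.
  have b0 : 0 <= b by rewrite normr_ge0.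
  have : b * (2 * lg (x %/ bk.2.+1)%N) <= b * (2 * lg x - l / 8).
    by rewrite ler_wpM2l //; move: l1 l2; clear; lra.
  by clear; lra.
rewrite big_map /=; elim: (st) st0 => [_|[Y c] st1 IH /andP[/and3P[c0 Y0 _] st1P]].
  by rewrite big_nil /step_cost /= -[BinNums.Z0]/(0%:R : Z) zr_nat !mul0r.
rewrite big_cons; move: {IH} (IH st1P) => IH; apply: (le_trans (lerD (lexx _) IH)).
rewrite step_cost_cons zrD zrM.
rewrite [(Y, c).1]/= [(Y, c).2]/= in c0 Y0 *.
set q := BinInt.Z.succ _; set y := BinNat.N.to_nat Y.
have qx : zr R c * (2 * (x %/ y))%N%:R <= zr R c * (zr R q * x%:R / 10 ^+ 6).
  rewrite ler_wpM2l //; first by rewrite -[0](zr_nat R 0) le_zr.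
  have y0 : (0 < y)%N by rewrite /y; lia.
  have m2E : zr R million2 = 2 * 10 ^+ 6.
    rewrite (_ : million2 = 2%:R * 10%:R ^+ 6) //.
    by rewrite zrM zrX !zr_nat.
  have yE : BinInt.Z.of_N Y = y%:R by rewrite /y; lia.
  have YZ : BinInt.Z.lt BinNums.Z0 (BinInt.Z.of_N Y) by lia.
  have yq : zr R million2 <= y%:R * zr R q.
    rewrite -(zr_nat R y) -zrM le_zr // -yE.
    by have := BinInt.Z.mul_succ_div_gt million2 _ YZ; rewrite -/q; lia.
  have q0 : 0 <= zr R q.
    rewrite -[0](zr_nat R 0) le_zr // /q.
    have M0 : BinInt.Z.le BinNums.Z0 million2 by [].
    have := BinInt.Z.div_pos million2 _ M0 YZ.
    by move: (BinInt.Z.div _ _) => d; clear; lia.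
  have xy : (y * (x %/ y))%N%:R <= x%:R :> R by rewrite ler_nat mulnC leq_divM.
  have := ler_wpM2l q0 xy; rewrite m2E in yq.
  have := ler_wpM2r (ler0n R (x %/ y)%N) yq.
  rewrite ler_pdivlMr ?exprn_gt0 // !natrM; move: (_ ^+ 6) => e; clear; lra.
by move: qx; clear; lra.
Qed.

(** * P12 *)

Lemma lg_le_linear (R : realFieldType) (lg : nat -> R) x :
  is_log lg -> (0 < x)%N -> lg x <= 15 + x%:R / 2 ^+ 15.
Proof.
move=> L x0; pose q := (x %/ 2 ^ 15)%N.
have xq : (x <= 2 ^ (15 + q))%N.
  rewrite expnD ltnW // (leq_trans (ltn_ceil x (expn_gt0 2 15))) //.
  by rewrite mulnC leq_pmul2l ?expn_gt0 // ltn_expl.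
apply: (le_trans (lg_le L x0 xq)); rewrite (lg_pow2 _ L) natrD lerD2l.
by rewrite ler_pdivlMr ?exprn_gt0 // -natrX -natrM ler_nat leq_divM.
Qed.

Definition partial_sums12 : seq Z := Eval vm_compute in
  [:: 0; 1; 1; 1; 1; 0; 0; -1; -1; -1; -1; 0].
Definition partial_sums3 : seq Z := Eval vm_compute in [:: 0; 1; 0].

Lemma table12P : character_table table12 12 partial_sums12.
Proof. by vm_compute. Qed.
Lemma table3P : character_table table3 3 partial_sums3.
Proof. by vm_compute. Qed.

Definition numeric_ok (bs : seq (Z * nat)) (st : seq (N * Z)) (a l c : nat) : bool :=
  [&& all (fun bk => bk.2 < 1000)%N bs,
      BinInt.Z.leb (abs_sum bs) (BinInt.Z.of_nat a),
      BinInt.Z.leb (BinInt.Z.mul (BinInt.Z.of_nat l) (BinInt.Z.of_nat 1000)) (log_sum bs)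
    & BinInt.Z.leb (step_cost st) (BinInt.Z.mul (BinInt.Z.of_nat c) (BinInt.Z.of_nat 1000))].

Lemma Zof_natE (n : nat) : BinInt.Z.of_nat n = n%:R.
Proof. by lia. Qed.

Lemma character_sum_le (R : realFieldType) (lg : nat -> R) T p Hs n bs st (a l c : nat) x :
  is_log lg -> character_table T p Hs -> certificate_ok T n bs st ->
  numeric_ok bs st a l c -> (1000 <= x)%N ->
  psum lg x (fun _ k => zr R (chi_of T k) * (odd (x %/ k))%:R) <=
  2 * a%:R * lg x - l%:R * 1000 / 8 + c%:R * x%:R / 1000.
Proof.
move=> L tab ok /and4P[bs_x a_ok l_ok c_ok] x0.
have bsx : all (fun bk => bk.2 < x)%N bs.
  by apply: sub_all bs_x => bk /leq_trans; apply.
apply: (le_trans (certificate_bound L tab ok bsx)).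
rewrite !Zof_natE in a_ok l_ok c_ok.
have ha : zr R (abs_sum bs) <= a%:R by rewrite -(zr_nat R) le_zr.
have hl : l%:R * 1000 <= zr R (log_sum bs).
  by rewrite -(zr_nat R l) -(zr_nat R 1000) -zrM le_zr.
have hc : zr R (step_cost st) <= c%:R * 1000.
  by rewrite -(zr_nat R c) -(zr_nat R 1000) -zrM le_zr.
have lx : 0 <= lg x by apply: lg_ge0 => //; apply: leq_trans x0.
have h1 := ler_wpM2r lx ha; have h2 := ler_wpM2r (ler0n R x) hc.
rewrite [10 ^+ 6](_ : _ = 1000 * 1000); last by ring.
by move: h1 hl h2; clear; lra.
Qed.

Lemma numeric12 : numeric_ok coefs12 steps12 257 25 203.
Proof. by vm_compute. Qed.
Lemma numeric3 : numeric_ok coefs3 steps3 219 21 192.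
Proof. by vm_compute. Qed.

Lemma character_sum12_small (R : realFieldType) (lg : nat -> R) x :
  is_log lg -> (40 * 2 ^ 10 <= x)%N ->
  3 * psum lg x (fun _ k => zr R (chi_of table12 k) * (odd (x %/ k))%:R) + 5 * lg x + 12 < x%:R.
Proof.
move=> L x0; have x1 : (1000 <= x)%N by apply: leq_trans x0.
have := character_sum_le L table12P ok12 numeric12 x1.
have := lg_le_linear L (leq_trans (isT : 0 < 1000)%N x1).
have : 40 * 2 ^+ 10 <= x%:R :> R by rewrite -natrX -natrM ler_nat.
by move: (psum _ _ _) (lg x) (x%:R) => S l y; clear; lra.
Qed.

Lemma character_sum3_small (R : realFieldType) (lg : nat -> R) x :
  is_log lg -> (40 * 2 ^ 10 <= x)%N ->
  3 * psum lg x (fun _ k => zr R (chi_of table3 k) * (odd (x %/ k))%:R) + 5 * lg x + 12 < x%:R.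
Proof.
move=> L x0; have x1 : (1000 <= x)%N by apply: leq_trans x0.
have := character_sum_le L table3P ok3 numeric3 x1.
have := lg_le_linear L (leq_trans (isT : 0 < 1000)%N x1).
have : 40 * 2 ^+ 10 <= x%:R :> R by rewrite -natrX -natrM ler_nat.
by move: (psum _ _ _) (lg x) (x%:R) => S l y; clear; lra.
Qed.

(** * P13 *)

Lemma lg_partn_le_character (R : realFieldType) (lg : nat -> R) T p Hs m (pi : nat_pred) :
  is_log lg -> character_table T p Hs ->
  (forall q, prime q -> q \in pi -> chi_of T q = 1) ->
  2 * lg ((central_binom m)`_pi)%N <= lg (central_binom m) +
    psum lg m.*2 (fun _ k => zr R (chi_of T k) * (odd (m.*2 %/ k))%:R).
Proof.
move=> L tab piT; have [T1 chiM chi1 _] := character_tableP tab.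
rewrite (lg_central_binom_partn pi L (leqnn _)) (lg_central_binom L (leqnn _)).
rewrite -psumD -psumZ; apply: le_psum => // q a pq a0 _.
have c1 : `|zr R (chi_of T (q ^ a))| <= 1.
  by rewrite norm_zr -[1](zr_nat R 1) le_zr.
have [b0 b1] : (nat_of_bool false)%:R = 0 :> R /\ (nat_of_bool true)%:R = 1 :> R by [].
case: (odd _); last by rewrite andbF b0 !mulr0 addr0.
rewrite andbT b1 mulr1; have [qpi|_] := boolP (q \in pi); last first.
  by move: c1; rewrite ler_norml b0 => /andP[h _]; lra.
suff -> : chi_of T (q ^ a) = 1 by rewrite b1 -[1 : Z]/(1%:R) zr_nat; lra.
case: a a0 {c1} => // a _; elim: a => [|a IH]; first by rewrite expn1 piT.
by rewrite expnS chiM IH piT // mulr1.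
Qed.

Lemma density_contradiction (R : realFieldType) (lg : nat -> R) T p Hs m (pi : nat_pred) X Q :
  is_log lg -> character_table T p Hs ->
  (forall q, prime q -> q \in pi -> chi_of T q = 1) ->
  3 * psum lg m.*2 (fun _ k => zr R (chi_of T k) * (odd (m.*2 %/ k))%:R)
    + 5 * lg m.*2 + 12 < (m.*2)%:R ->
  (0 < m)%N -> (0 < X)%N -> (0 < Q)%N -> (X ^ 2 <= Q)%N ->
  (central_binom m <= m.+1 * (X * Q))%N ->
  (Q <= 3 * (central_binom m)`_pi)%N -> False.
Proof.
move=> L tab piT small m0 X0 Q0 XQ BXQ QA.
have := lg_partn_le_character m L tab piT.
set B := central_binom m in BXQ QA *; have B0 : (0 < B)%N := central_binom_gt0 m.
set A := (B`_pi)%N in QA *; have A0 : (0 < A)%N by rewrite part_gt0.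
have := lg_le L Q0 QA; rewrite (lgM L) //.
have : lg 3%N <= 2%:R by rewrite -(lg_pow2 2 L) (lg_le L).
have := lg_le L B0 BXQ; rewrite !(lgM L) ?muln_gt0 ?X0 ?Q0 //.
have := lg_le L _ XQ; rewrite expn_gt0 X0 => /(_ isT); rewrite (lgX _ L) //.
have : lg m.+1 <= lg m.*2 by apply: (lg_le L) => //; clear -m0; lia.
have : (m.*2)%:R <= lg m.*2 + lg B.
  rewrite -(lgM L) //; last by clear -m0; lia.
  rewrite -(lg_pow2 _ L); apply: (lg_le L); first by rewrite expn_gt0.
  by rewrite -mul2n expnM mul2n central_binom_ge.
by move: small; move: (psum _ _ _) => S; clear; lra.
Qed.

Lemma cofactor_le_partn (B Q c : nat) (pi : nat_pred) :
  (0 < B)%N -> (Q %| B)%N -> (Q`_(pi^') <= c)%N -> (Q <= c * B`_pi)%N.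
Proof.
move=> B0 QB Qc; have Q0 := dvdn_gt0 B0 QB.
by rewrite -(partnC pi Q0) mulnC leq_mul // dvdn_leq ?part_gt0 // partn_dvd.
Qed.

(** * P14 *)

Definition splitting_primes (N : int) (l : nat) : nat_pred :=
  [pred q | if N == 1 then (4 * l %| q.-1)%N || (4 * l %| q.+1)%N else (2 * l %| q.-1)%N].

Definition cubic (N : int) (x : nat) : int := x%:Z * (4 * x%:Z ^+ 2 - 3 * N).

Lemma lucas3 (P N : int) : lucas P N 3 = P * (P ^+ 2 - 3 * N).
Proof. by rewrite /=; ring. Qed.

Lemma cubic_cofactor (N : int) (X : nat) : N = 1 \/ N = -1 -> (0 < X)%N ->
  exists Q : nat, [/\ Q%:Z = 4 * X%:Z ^+ 2 - 3 * N, (0 < Q)%N, (X ^ 2 <= Q)%N &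
     odd Q /\ ~~ (9 %| Q)%N].
Proof.
move=> hN X0; have X2 : (0 < X ^ 2)%N by rewrite expn_gt0 X0.
have E : X%:Z ^+ 2 = (X ^ 2)%N%:Z by lia.
have [Q QE] : exists Q : nat, Q%:Z = 4 * X%:Z ^+ 2 - 3 * N.
  by exists (absz (4 * X%:Z ^+ 2 - 3 * N)%R); rewrite E; clear -X2 hN; lia.
exists Q; split=> //.
- by clear -QE E X2 hN; lia.
- by clear -QE E X2 hN; lia.
split; first by clear -QE E X2 hN; lia.
apply/negP => d9; have d3 : (3 %| X ^ 2)%N by clear -QE E d9 hN; lia.
rewrite Euclid_dvdX // in d3; case/andP: d3 => d3 _.
have d9' : (9 %| X ^ 2)%N by rewrite -[9%N]/(3 ^ 2)%N dvdn_exp2r.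
by clear -QE E d9 d9' hN; lia.
Qed.

Lemma cubic_prime_factor (N : int) (X Q q : nat) : N = 1 \/ N = -1 ->
  Q%:Z = 4 * X%:Z ^+ 2 - 3 * N -> odd Q -> prime q -> (q %| Q)%N ->
  q = 3%N \/ q \in splitting_primes N 3.
Proof.
move=> hN QE oQ pq qQ; have oq : odd q := dvdn_odd qQ oQ.
have [qX|qX] := boolP (q %| 2 * X)%N.
  left; have q3 : (q %| 3)%N.
    have : (q %| Q + 3)%N || (q %| Q - 3)%N.
      have E : X%:Z ^+ 2 = (X ^ 2)%N%:Z by lia.
      have d4 : (q %| 4 * X ^ 2)%N.
        by rewrite -[4%N]/(2 ^ 2)%N -expnMn expnS dvdn_mulr.
      case: hN => hN.
        by rewrite (_ : (Q + 3 = 4 * X ^ 2)%N) ?d4 //; clear -QE E hN; lia.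
      by rewrite orbC (_ : (Q - 3 = 4 * X ^ 2)%N) ?d4 //; clear -QE E hN; lia.
    case/orP; first by rewrite dvdn_addr.
    have [Q3|Q3] := leqP 3 Q; first by rewrite dvdn_subr.
    by move: oQ qQ; case: Q {QE} Q3 => [|[|[]]] // _ _; rewrite dvdn1 => /eqP ->.
  by move: q3; rewrite dvdn_prime2 // => /eqP.
right; have := @lucas_divisor_class q 3 0 (2 * X%:Z) N pq oq isT isT hN.
rewrite expn1 expn0 lucas3 /= => h; rewrite inE; apply: h.
  have -> : (2 * X%:Z) ^+ 2 - 3 * N = Q%:Z by rewrite QE; ring.
  by rewrite abszM dvdn_mull.
exact: qX.
Qed.

Lemma cubic_cofactor_partn (N : int) (X Q : nat) : N = 1 \/ N = -1 ->
  Q%:Z = 4 * X%:Z ^+ 2 - 3 * N -> (0 < Q)%N -> odd Q -> ~~ (9 %| Q)%N ->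
  (Q`_((splitting_primes N 3)^') <= 3)%N.
Proof.
move=> hN QE Q0 oQ Q9; set pi := splitting_primes N 3; set n := (Q`_(pi^'))%N.
have nQ : (n %| Q)%N := dvdn_part _ _.
have n3 : (3%N).-nat n.
  apply/pnatP => [|q pq qn]; first by rewrite part_gt0.
  have /pnatP h := part_pnat pi^' Q.
  have := h (part_gt0 _ _) q pq qn; rewrite !inE /= => qpi.
  case: (cubic_prime_factor hN QE oQ pq (dvdn_trans qn nQ)) => [-> //|].
  by move=> hq; case/negP: qpi; exact: hq.
have [k nE] := p_natP n3; rewrite nE in nQ *.
case: k nE nQ => [|[|k]] // _ nQ; case/negP: Q9.
by apply: dvdn_trans nQ; rewrite 2!expnS mulnA dvdn_mulr.
Qed.

(** * P15 *)

Lemma catalan_or_binom_dvd (T m : nat) : T = catalan m \/ T = central_binom m ->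
  [/\ (0 < T)%N, (T %| central_binom m)%N & (central_binom m <= m.+1 * T)%N].
Proof.
case=> ->; last by rewrite central_binom_gt0 dvdnn leq_pmull.
by rewrite catalan_gt0 -catalan_mul dvdn_mull.
Qed.

Lemma cubic_large (R : realFieldType) (lg : nat -> R) (N : int) (X T m : nat) :
  is_log lg -> (20 * 2 ^ 10 <= m)%N -> N = 1 \/ N = -1 -> (0 < X)%N ->
  T = catalan m \/ T = central_binom m -> cubic N X <> T%:Z.
Proof.
move=> L m_large hN X0 hT E.
have [Q [QE Q0 XQ [oQ Q9]]] := cubic_cofactor hN X0.
have TE : T = (X * Q)%N by move: E; rewrite /cubic -QE; clear; lia.
have [T0 TB BT] := catalan_or_binom_dvd hT.
have B0 := central_binom_gt0 m.
have QB : (Q %| central_binom m)%N by apply: dvdn_trans TB; rewrite TE dvdn_mull.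
have part3 := cubic_cofactor_partn hN QE Q0 oQ Q9.
have Qle := cofactor_le_partn B0 QB part3.
have x_large : (40 * 2 ^ 10 <= m.*2)%N by rewrite -(leq_double _ m) in m_large.
have m0 : (0 < m)%N by apply: leq_trans m_large.
rewrite TE in BT.
case: hN => hN.
  apply: (density_contradiction L table12P _ (character_sum12_small L x_large)
     m0 X0 Q0 XQ BT Qle) => q pq.
  rewrite inE hN /= /chi_of => h; have q0 := prime_gt0 pq.
  have : (q %% 12 = 1)%N \/ (q %% 12 = 11)%N by clear -h q0; lia.
  by case=> ->.
apply: (density_contradiction L table3P _ (character_sum3_small L x_large)
     m0 X0 Q0 XQ BT Qle) => q pq.
rewrite inE hN /= /chi_of => h; have q0 := prime_gt0 pq.
have : (q %% 3 = 1)%N by clear -h q0; lia.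
by move=> ->.
Qed.

Lemma dvdn_central_binom (q m : nat) : prime q -> (q <= m.*2)%N -> odd (m.*2 %/ q) ->
  (q %| central_binom m)%N.
Proof.
move=> pq qm oq; have : (0 < logn q (central_binom m))%N.
  rewrite (logn_central_binom pq (leqnn _)).
  have q1 : 1%N \in [seq a <- iota 1 m.*2 | (q ^ a <= m.*2)%N].
    by rewrite mem_filter expn1 qm mem_iota /= add1n ltnS (leq_trans _ qm) ?prime_gt0.
  by rewrite -big_filter (big_rem 1%N) //= expn1 oq.
by rewrite logn_gt0 mem_primes => /and3P[].
Qed.

Lemma prod_primes_dvdn (s : seq nat) (n : nat) :
  uniq s -> all prime s -> all (fun q => q %| n)%N s -> (\prod_(q <- s) q %| n)%N.
Proof.
elim: s => [|q s IH] /=; first by rewrite big_nil dvd1n.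
move=> /andP[qs us] /andP[pq ps] /andP[qn sn]; rewrite big_cons Gauss_dvd ?qn ?IH //.
rewrite prime_coprime //; apply: contra qs; elim: s ps {IH us sn} => [|r s IH] /=.
  by rewrite big_nil dvdn1 => _ /eqP q1; rewrite q1 in pq.
move=> /andP[pr ps]; rewrite big_cons Euclid_dvdM // dvdn_prime2 // inE.
by case/orP=> [->//|/(IH ps)->]; rewrite orbT.
Qed.

(** * P16 *)
Local Close Scope ring_scope.

(* (p-1, t): the next multiple of p is t steps of length 12 ahead. *)
Definition sieve_step (c : nat * nat) : nat * nat :=
  match c with (p1, 0) => (p1, p1) | (p1, t.+1) => (p1, t) end.

Definition sieve_hit (cs : seq (nat * nat)) : bool :=
  has (fun c => if c.2 is 0 then true else false) cs.

Fixpoint sieve (n : nat) (y c5 c : N) (s5 s : seq (nat * nat)) : seq N :=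
  if n is n1.+1 then
    let r := sieve n1 (BinNat.N.add y (BinNat.N.of_nat 12)) c5 c
               (map sieve_step s5) (map sieve_step s) in
    let r1 := if sieve_hit s then r else BinNat.N.add y c :: r in
    if sieve_hit s5 then r1 else BinNat.N.add y c5 :: r1
  else [::].

Definition sieve_start (M : nat) (v : N) : seq (nat * nat) :=
  [seq (p.-1, find (fun i => BinNat.N.eqb BinNums.N0
          (BinNat.N.modulo (BinNat.N.add v (BinNat.N.mul (BinNat.N.of_nat 12) (BinNat.N.of_nat i)))
             (BinNat.N.of_nat p))) (iota 0 p)) | p <- iota 5 (M - 5) & prime p].

Definition sieve_start_ok (M v : nat) (s : seq (nat * nat)) : bool :=
  all (fun c => (c.2 <= c.1) && (c.1.+1 %| v + 12 * c.2)) s &&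
  (map (fun c => c.1.+1) s == [seq p <- iota 5 (M - 5) | prime p]).

Definition start5 := Eval vm_compute in sieve_start 203 (BinNat.N.of_nat (204 + 5)).
Definition start7 := Eval vm_compute in sieve_start 203 (BinNat.N.of_nat (204 + 7)).
Definition start11 := Eval vm_compute in sieve_start 203 (BinNat.N.of_nat (204 + 11)).

Lemma start5_ok : sieve_start_ok 203 (204 + 5) start5.
Proof. by vm_compute. Qed.
Lemma start7_ok : sieve_start_ok 203 (204 + 7) start7.
Proof. by vm_compute. Qed.
Lemma start11_ok : sieve_start_ok 203 (204 + 11) start11.
Proof. by vm_compute. Qed.

Definition prime_list (c : nat) (s : seq (nat * nat)) : seq N :=
  [seq BinNat.N.of_nat q | q <- iota 60 144 & prime q && ((q %% 12 == 5) || (q %% 12 == c))] ++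
  sieve 3416 (BinNat.N.of_nat 204) (BinNat.N.of_nat 5) (BinNat.N.of_nat c) start5 s.

Definition add_weight (q : N) : N * N := (q, BinNat.N.log2 (BinNat.N.pow q (BinNat.N.of_nat 4))).

Fixpoint window_weight (L : seq (N * N)) (b a2 : N) : N :=
  if L is (q, w) :: L1 then
    if BinNat.N.ltb a2 q then BinNums.N0
    else if BinNat.N.leb b q ||
       (BinNat.N.leb b (BinNat.N.double q) && BinNat.N.leb (BinNat.N.add q (BinNat.N.double q)) a2)
    then BinNat.N.add w (window_weight L1 b a2) else window_weight L1 b a2
  else BinNums.N0.

Definition block_ok (L : seq (N * N)) (a b : N) : bool :=
  BinNat.N.ltb (BinNat.N.mul (BinNat.N.of_nat 4)
     (BinNat.N.add (BinNat.N.mul (BinNat.N.of_nat 3) (BinNat.N.log2_up b)) (BinNat.N.double (BinNat.N.pred b))))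
    (BinNat.N.mul (BinNat.N.of_nat 3) (window_weight L b (BinNat.N.double a))).

Fixpoint blocks_ok (L : seq (N * N)) (n : nat) (a : N) : bool :=
  if n is n1.+1 then
    let b := BinNat.N.add (BinNat.N.succ a)
       (BinNat.N.div (BinNat.N.sub a (BinNat.N.of_nat 140)) (BinNat.N.of_nat 40)) in
    block_ok L a b && blocks_ok L n1 b
  else BinNat.N.leb (BinNat.N.mul (BinNat.N.of_nat 20) (BinNat.N.of_nat 1024)) a.


Definition mid_ok (c : nat) (s : seq (nat * nat)) : bool :=
  let L := prime_list c s in
  sorted BinNat.N.ltb L && blocks_ok (map add_weight L) 275 (BinNat.N.of_nat 140).
Lemma mid7_ok : mid_ok 7 start7.
Proof. by vm_compute. Qed.
Lemma mid11_ok : mid_ok 11 start11.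
Proof. by vm_compute. Qed.
Definition counter_ok (v : nat) (c : nat * nat) : bool :=
  (c.2 <= c.1) && (c.1.+1 %| v + 12 * c.2).

Lemma counters_step v s : all (counter_ok v) s -> all (counter_ok (v + 12)) (map sieve_step s).
Proof.
rewrite all_map; apply: sub_all => -[p1 [|t]] /andP[/= tp dp]; apply/andP; split=> //=.
- rewrite muln0 addn0 in dp.
  by rewrite -addnA -mulnS dvdn_add // dvdn_mull.
- exact: ltnW.
by rewrite -addnA -mulnS.
Qed.

Lemma counters_step_primes s :
  map (fun c => c.1.+1) (map sieve_step s) = map (fun c : nat * nat => c.1.+1) s.
Proof. by rewrite -map_comp; apply: eq_map => -[p1 [|t]]. Qed.

Lemma sieve_hitN v s : all (counter_ok v) s -> ~~ sieve_hit s ->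
  all (fun p => prime p ==> (4 < p) ==> ~~ (p %| v)) (map (fun c => c.1.+1) s).
Proof.
elim: s => [|[p1 t] s IH] //= /andP[/andP[/= tp dp] ok]; rewrite negb_or => /andP[t0 hs].
rewrite {}IH // andbT; apply/implyP=> pp; apply/implyP=> p4; apply/negP=> pv.
rewrite dvdn_addr // Gauss_dvdr in dp; last first.
  by rewrite prime_coprime // -[12]/(2 * (2 * 3)) !Euclid_dvdM // !(dvdn_prime2 pp) //; clear -p4; lia.
case: t t0 tp dp => // t _ tp /dvdn_leq; rewrite ltnS => /(_ isT) h.
by move: (leq_trans h tp); rewrite ltnn.
Qed.

Lemma sieve_sound (n y c5 c : nat) (s5 s : seq (nat * nat)) (ps : seq nat) (w : N) :
  all (counter_ok (y + c5)) s5 -> all (counter_ok (y + c)) s ->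
  map (fun c => c.1.+1) s5 = ps -> map (fun c => c.1.+1) s = ps ->
  w \in (sieve n (BinNat.N.of_nat y) (BinNat.N.of_nat c5) (BinNat.N.of_nat c) s5 s) ->
  let v := BinNat.N.to_nat w in
  [/\ v <= y + 12 * n + maxn c5 c, v = y + c5 %[mod 12] \/ v = y + c %[mod 12] &
      all (fun p => prime p ==> (4 < p) ==> ~~ (p %| v)) ps].
Proof.
elim: n y s5 s => [|n IH] y s5 s ok5 ok E5 E //=.
have -> : BinNat.N.add (BinNat.N.of_nat y) (BinNat.N.of_nat 12) = BinNat.N.of_nat (y + 12).
  exact: esym (Nnat.Nat2N.inj_add y 12).
have IH' := IH (y + 12) (map sieve_step s5) (map sieve_step s).
have rec : w \in (sieve n (BinNat.N.of_nat (y + 12)) (BinNat.N.of_nat c5) (BinNat.N.of_nat c)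
     (map sieve_step s5) (map sieve_step s)) ->
  [/\ BinNat.N.to_nat w <= y + 12 * n.+1 + maxn c5 c,
   BinNat.N.to_nat w = y + c5 %[mod 12] \/ BinNat.N.to_nat w = y + c %[mod 12] &
   all (fun p => prime p ==> (4 < p) ==> ~~ (p %| BinNat.N.to_nat w)) ps].
  move=> hw; have := IH'; rewrite ![y + 12 + _]addnAC => /(_ _ _ _ _ hw)[].
  - exact: counters_step.
  - exact: counters_step.
  - by rewrite counters_step_primes.
  - by rewrite counters_step_primes.
  by move=> h1 h2 h3; split=> //; [clear -h1; lia | rewrite !modnDr in h2].
have new e se : all (counter_ok (y + e)) se -> ~~ sieve_hit se ->
   map (fun c => c.1.+1) se = ps -> e = c5 \/ e = c ->
   w = BinNat.N.add (BinNat.N.of_nat y) (BinNat.N.of_nat e) ->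
  [/\ BinNat.N.to_nat w <= y + 12 * n.+1 + maxn c5 c,
   BinNat.N.to_nat w = y + c5 %[mod 12] \/ BinNat.N.to_nat w = y + c %[mod 12] &
   all (fun p => prime p ==> (4 < p) ==> ~~ (p %| BinNat.N.to_nat w)) ps].
  move=> oke hse Ee he ->; rewrite -Nnat.Nat2N.inj_add Nnat.Nat2N.id -Ee; split.
  - by clear -he; lia.
  - by case: he => ->; [left | right].
  exact: sieve_hitN.
have rec1 : w \in (if sieve_hit s then sieve n (BinNat.N.of_nat (y + 12)) (BinNat.N.of_nat c5)
     (BinNat.N.of_nat c) (map sieve_step s5) (map sieve_step s)
   else BinNat.N.add (BinNat.N.of_nat y) (BinNat.N.of_nat c) ::
     sieve n (BinNat.N.of_nat (y + 12)) (BinNat.N.of_nat c5)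
     (BinNat.N.of_nat c) (map sieve_step s5) (map sieve_step s)) ->
  [/\ BinNat.N.to_nat w <= y + 12 * n.+1 + maxn c5 c,
   BinNat.N.to_nat w = y + c5 %[mod 12] \/ BinNat.N.to_nat w = y + c %[mod 12] &
   all (fun p => prime p ==> (4 < p) ==> ~~ (p %| BinNat.N.to_nat w)) ps].
  case: ifP => h; first exact: rec.
  by rewrite inE => /predU1P[/(new _ _ ok (negbT h) E (or_intror erefl))|/rec].
case: ifP => h5; first exact: rec1.
by rewrite inE => /predU1P[/(new _ _ ok5 (negbT h5) E5 (or_introl erefl))|/rec1].
Qed.

Lemma sieved_prime (M v : nat) : 4 < M -> 1 < v -> v < M * M -> v %% 12 \in [:: 5; 7; 11] ->
  all (fun p => prime p ==> (4 < p) ==> ~~ (p %| v)) [seq p <- iota 5 (M - 5) | prime p] ->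
  prime v.
Proof.
move=> M4 v1 vM v12 /allP dv; apply: ltn_pdiv2_prime; first exact: ltnW.
have pp := pdiv_prime v1; have pv := pdiv_dvd v.
rewrite mulnn in vM; apply: (leq_trans vM); rewrite leq_exp2r // leqNgt.
apply/negP => pM.
have p4 : 4 < pdiv v.
  move: pp pv; case: (pdiv v) => [|[|[|[|[|]]]]] // _ /dvdnP[k vE];
    rewrite vE !inE in v12; clear -v12; lia.
have := dv (pdiv v); rewrite mem_filter pp mem_iota p4 pv /= => h.
suff /h : pdiv v < 5 + (M - 5) by [].
by clear -p4 pM M4; lia.
Qed.

Lemma prime_list_sound (c : nat) (s : seq (nat * nat)) (w : N) :
  c = 7 \/ c = 11 -> sieve_start_ok 203 (204 + c) s ->
  w \in prime_list c s ->
  let q := BinNat.N.to_nat w in prime q /\ (q %% 12 = 5 \/ q %% 12 = c).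
Proof.
move=> hc /andP[ok /eqP E]; rewrite /prime_list mem_cat => /orP[].
  case/mapP=> q; rewrite mem_filter => /andP[/andP[pq qc] _] -> /=.
  by rewrite Nnat.Nat2N.id; case/orP: qc => /eqP->; split=> //; [left|right].
have /andP[ok5 /eqP E5] := start5_ok.
have [n nE] : exists n, n = 3416 by exists 3416.
have [M ME] : exists M, M = 203 by exists 203.
rewrite -nE; rewrite -ME in E E5 => /(@sieve_sound n 204 5 c start5 s _ w ok5 ok E5 E)[].
move: (BinNat.N.to_nat w) => v vle vmod dv.
have {}vmod : v %% 12 = 5 \/ v %% 12 = c.
  by clear -vmod hc; case: vmod => ->; [left | right; case: hc => ->].
split; [apply: sieved_prime dv | exact: vmod].
- by rewrite ME.
- by clear -vmod hc; lia.
- by clear -vle nE ME hc; lia.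
by clear -vmod hc; rewrite !inE; lia.
Qed.

(** * P17 *)

Lemma N_pow2 (k : N) : BinNat.N.to_nat (BinNat.N.pow (BinNat.N.of_nat 2) k) = 2 ^ (BinNat.N.to_nat k).
Proof.
rewrite -[k in LHS]Nnat.N2Nat.id; elim: (BinNat.N.to_nat k) => // n IH.
by rewrite (Nnat.Nat2N.inj_succ n) BinNat.N.pow_succ_r' Nnat.N2Nat.inj_mul IH expnS Nnat.Nat2N.id.
Qed.

Lemma N_le_to_nat (x y : N) : BinNat.N.le x y -> BinNat.N.to_nat x <= BinNat.N.to_nat y.
Proof. by lia. Qed.

Lemma pow_log2_le (n : N) : 0 < BinNat.N.to_nat n ->
  2 ^ (BinNat.N.to_nat (BinNat.N.log2 n)) <= BinNat.N.to_nat n.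
Proof.
move=> n0; rewrite -N_pow2; apply: N_le_to_nat.
by case: (BinNat.N.log2_spec n) => //; lia.
Qed.

Lemma le_pow_log2_up (n : N) : 0 < BinNat.N.to_nat n ->
  BinNat.N.to_nat n <= 2 ^ (BinNat.N.to_nat (BinNat.N.log2_up n)).
Proof.
have [n1 _|n1 n0] := ltnP 1 (BinNat.N.to_nat n); last first.
  by apply: leq_trans n1 _; rewrite expn_gt0.
rewrite -N_pow2; apply: N_le_to_nat.
by case: (BinNat.N.log2_up_spec n) => //; lia.
Qed.

(* The primes of either window divide every central binomial coefficient with
   index in [a, b): the quotient 2m/q is 1 in the first window, 3 in the other. *)
Definition window (a b q : nat) : bool :=
  (q <= a.*2) && ((b <= q) || (b <= q.*2) && (3 * q <= a.*2)).

Lemma divn_between k q n : k * q <= n -> n < k.+1 * q -> n %/ q = k.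
Proof.
move=> kn nk; have q0 : 0 < q by case: q nk {kn} => //; rewrite muln0.
by apply/eqP; rewrite eqn_leq -ltnS ltn_divLR // nk leq_divRL.
Qed.

Lemma window_dvd a b q m : a <= m -> m < b -> prime q -> window a b q ->
  q %| central_binom m.
Proof.
move=> am mb pq /andP[qa hq]; apply: dvdn_central_binom => //.
  by clear -am qa; lia.
case/orP: hq => [bq|/andP[bq q3]].
  by rewrite (@divn_between 1) //; clear -bq qa am mb; lia.
by rewrite (@divn_between 3) //; clear -bq q3 qa am mb; lia.
Qed.

Lemma window_weight_sound (L : seq N) (a b : nat) : 
  sorted ltn (map BinNat.N.to_nat L) -> 0 < b ->
  exists s : seq nat, [/\ subseq s (map BinNat.N.to_nat L), all (window a b) s &
    2 ^ (BinNat.N.to_nat (window_weight (map add_weight L) (BinNat.N.of_nat b)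
        (BinNat.N.double (BinNat.N.of_nat a))))
      <= (\prod_(q <- s) q) ^ 4].
Proof.
move=> + b0; elim: L => [|w L IH] /=; first by exists [::]; rewrite big_nil.
move=> sL; have [s [sub win wt]] := IH (path_sorted sL).
case: ifP => hlt; first by exists [::]; rewrite big_nil.
case: ifP => hw; last first.
  by exists s; split=> //; apply: subseq_trans sub (subseq_cons _ _).
exists (BinNat.N.to_nat w :: s); split => /=.
- by rewrite eqxx.
- rewrite win andbT; rewrite /window; clear -hw hlt; lia.
rewrite Nnat.N2Nat.inj_add expnD big_cons expnMn leq_mul //.
have w0 : 0 < BinNat.N.to_nat w by clear -hw b0; lia.
have N_pow4 : BinNat.N.to_nat w ^ 4 = BinNat.N.to_nat (BinNat.N.pow w (BinNat.N.of_nat 4)).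
  have -> : BinNat.N.of_nat 4 =
      BinNat.N.succ (BinNat.N.succ (BinNat.N.succ (BinNat.N.succ BinNums.N0))) by [].
  by rewrite !BinNat.N.pow_succ_r' BinNat.N.pow_0_r !Nnat.N2Nat.inj_mul !expnS expn0.
by rewrite N_pow4; apply: pow_log2_le; rewrite -N_pow4 expn_gt0 w0.
Qed.

Lemma block_contradiction (L : seq N) (a b m T Q X : nat) :
  sorted ltn (map BinNat.N.to_nat L) ->
  (forall w, w \in L -> prime (BinNat.N.to_nat w) /\ ~~ (BinNat.N.to_nat w %| Q)) ->
  block_ok (map add_weight L) (BinNat.N.of_nat a) (BinNat.N.of_nat b) ->
  a <= m -> m < b -> T = X * Q -> X ^ 2 <= Q -> 0 < X ->
  central_binom m %| m.+1 * T -> T <= 4 ^ m -> False.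
Proof.
move=> sL LP; rewrite /block_ok => + am mb TE XQ X0 dB T4.
case: (window_weight_sound a sL (leq_ltn_trans (leq0n _) mb)) => s [sub win].
set W := BinNat.N.to_nat _ => wt hW.
set g := BinNat.N.to_nat (BinNat.N.log2_up (BinNat.N.of_nat b)).
have {}hW : 4 * (3 * g + (b.-1).*2) < 3 * W by rewrite /W /g; clear -hW; lia.
have b0 : 0 < b by apply: leq_ltn_trans mb.
have bg : b <= 2 ^ g by rewrite -{1}[b]Nnat.Nat2N.id le_pow_log2_up // Nnat.Nat2N.id.
have sP q : q \in s -> [/\ prime q, ~~ (q %| Q) & window a b q].
  move=> qs; have /mapP[w wL qE] := mem_subseq sub qs.
  have [pw nw] := LP w wL; rewrite qE in qs *; split=> //; exact: (allP win).
have us : uniq s by apply: subseq_uniq sub _; apply: sorted_uniq sL; [exact: ltn_trans|exact: ltnn].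
have dP : \prod_(q <- s) q %| m.+1 * X.
  apply: prod_primes_dvdn => //; apply/allP => q /sP[] // pq nq hq.
  have := dvdn_trans (window_dvd am mb pq hq) dB.
  by rewrite TE mulnA Euclid_dvdM // (negbTE nq) orbF.
have P_le : \prod_(q <- s) q <= b * X.
  by apply: leq_trans (dvdn_leq _ dP) _; rewrite ?muln_gt0 ?X0 // leq_mul2r mb orbT.
have X3 : X ^ 3 <= 4 ^ b.-1.
  apply: leq_trans (_ : 4 ^ m <= _); last by rewrite leq_exp2l // -ltnS prednK.
  by apply: leq_trans T4; rewrite TE expnS leq_mul2l XQ orbT.
suff : 2 ^ (3 * W) <= 2 ^ (4 * (3 * g + (b.-1).*2)) by rewrite leq_exp2l // leqNgt hW.
rewrite mulnC expnM.
apply: leq_trans (_ : ((b * X) ^ 4) ^ 3 <= _).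
  by rewrite leq_exp2r // (leq_trans wt) // leq_exp2r.
rewrite expnAC [4 * _]mulnC [2 ^ (_ * 4)]expnM leq_exp2r // expnMn expnD.
apply: leq_mul; first by rewrite mulnC expnM leq_exp2r.
by rewrite -mul2n expnM.
Qed.

Lemma blocks_cover (L : seq (N * N)) (n a m : nat) :
  blocks_ok L n (BinNat.N.of_nat a) -> a <= m -> m < 20 * 2 ^ 10 ->
  exists a' b' : nat, [/\ a' <= m, m < b' & block_ok L (BinNat.N.of_nat a') (BinNat.N.of_nat b')].
Proof.
elim: n a => [|n IH] a.
  rewrite /blocks_ok -[1024]/(2 ^ 10); set k := 2 ^ 10 => h am mk.
  by exfalso; clear -h am mk; lia.
rewrite /=; set b := BinNat.N.add _ _ => /andP[bl rec] am mk.
have bE : b = BinNat.N.of_nat (BinNat.N.to_nat b) by rewrite Nnat.N2Nat.id.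
have [mb|bm] := ltnP m (BinNat.N.to_nat b).
  by exists a, (BinNat.N.to_nat b); rewrite -bE.
by apply: IH bm mk; rewrite -bE.
Qed.

Lemma cubic_mid (N : int) (X T m : nat) : 140 <= m -> m < 20 * 2 ^ 10 ->
  (N = 1 \/ N = -1)%R -> 0 < X ->
  T = catalan m \/ T = central_binom m -> cubic N X <> (T%:Z)%R.
Proof.
move=> m1 m2 hN X0 hT E.
have [Q [QE Q0 XQ [oQ Q9]]] := cubic_cofactor hN X0.
have TE : T = (X * Q)%N by move: E; rewrite /cubic -QE; clear; lia.
have [T0 TB _] := catalan_or_binom_dvd hT.
have T4 : T <= 4 ^ m := leq_trans (dvdn_leq (central_binom_gt0 m) TB) (central_binom_le m).
have dB : central_binom m %| m.+1 * T.
  by case: hT => ->; rewrite ?catalan_mul // dvdn_mull.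
have key c s : c = 7 \/ c = 11 -> (N = 1%R -> c = 7) -> (N = (-1)%R -> c = 11) ->
    sieve_start_ok 203 (204 + c) s -> mid_ok c s -> False.
  move=> hc c7 c11 sok; rewrite /mid_ok; have sound w := @prime_list_sound c s w hc sok.
  move: (prime_list c s) sound => L sound; case/andP=> sL bl.
  have LP w : w \in L ->
      prime (BinNat.N.to_nat w) /\ ~~ (BinNat.N.to_nat w %| Q).
    move=> wL; have [pq qc] := sound w wL; split=> //.
    apply/negP => qQ; have q0 := prime_gt0 pq.
    case: (cubic_prime_factor hN QE oQ pq qQ) => [q3|].
      by move: qc; rewrite q3; case: hc => ->; case.
    rewrite inE; case: hN => hN.
      by rewrite hN eqxx => h; move: qc; rewrite (c7 hN); clear -h q0; lia.
    rewrite hN (_ : (-1 == 1 :> int)%R = false) // => h.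
    by move: qc; rewrite (c11 hN); clear -h q0; lia.
  have sL' : sorted ltn (map BinNat.N.to_nat L).
    rewrite sorted_map; apply: sub_sorted sL => x y /= h; clear -h; lia.
  have [a [b [am mb ok]]] := blocks_cover bl m1 m2.
  exact: (block_contradiction sL' LP ok am mb TE XQ X0 dB T4).
case: (hN) => hN'.
  by apply: (key 7 _ _ _ _ start7_ok mid7_ok); [left | | rewrite hN'].
by apply: (key 11 _ _ _ _ start11_ok mid11_ok); [right | rewrite hN' |].
Qed.

(** * P18 *)

Definition cubic_gap (plus : bool) (T x : N) : bool :=
  let x1 := BinNat.N.succ x in
  let c y := BinNat.N.mul (BinNat.N.of_nat 4) (BinNat.N.mul y (BinNat.N.mul y y)) in
  let l y := BinNat.N.mul (BinNat.N.of_nat 3) y in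
  if plus then
    (BinNat.N.leb x (BinNat.N.of_nat 1) || BinNat.N.ltb (c x) (BinNat.N.add T (l x))) &&
    BinNat.N.ltb (BinNat.N.add T (l x1)) (c x1)
  else
    (BinNat.N.leb x BinNums.N0 || BinNat.N.ltb (BinNat.N.add (c x) (l x)) T) &&
    BinNat.N.ltb T (BinNat.N.add (c x1) (l x1)).

Fixpoint cubic_root (plus : bool) (T : N) (k : nat) (x : N) : N :=
  if k is k1.+1 then
    let y := BinNat.N.add x (BinNat.N.pow (BinNat.N.of_nat 2) (BinNat.N.of_nat k1)) in
    let c := BinNat.N.mul (BinNat.N.of_nat 4) (BinNat.N.mul y (BinNat.N.mul y y)) in
    let l := BinNat.N.mul (BinNat.N.of_nat 3) y in
    cubic_root plus T k1
      (if (if plus then BinNat.N.ltb c (BinNat.N.add T l) else BinNat.N.ltb (BinNat.N.add c l) T)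
       then y else x)
  else x.

Definition binom_next (m B : N) : N :=
  BinNat.N.div (BinNat.N.mul (BinNat.N.double (BinNat.N.succ (BinNat.N.double m))) B) (BinNat.N.succ m).

Fixpoint cubic_table (n : nat) (m B : N) : seq (N * N * N * N) :=
  if n is n1.+1 then
    let C := BinNat.N.div B (BinNat.N.succ m) in
    (BinNat.N.max (BinNat.N.of_nat 1) (cubic_root true B 100 BinNums.N0), cubic_root false B 100 BinNums.N0,
     BinNat.N.max (BinNat.N.of_nat 1) (cubic_root true C 100 BinNums.N0), cubic_root false C 100 BinNums.N0)
    :: cubic_table n1 (BinNat.N.succ m) (binom_next m B)
  else [::].

Fixpoint cubic_table_ok (m B : N) (t : seq (N * N * N * N)) : bool :=
  if t is (x1, x2, x3, x4) :: t1 then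
    let C := BinNat.N.div B (BinNat.N.succ m) in
    [&& cubic_gap true B x1, cubic_gap false B x2, cubic_gap true C x3, cubic_gap false C x4
      & cubic_table_ok (BinNat.N.succ m) (binom_next m B) t1]
  else true.

Definition cubic_table140 := Eval vm_compute in cubic_table 140 BinNums.N0 (BinNat.N.of_nat 1).

Lemma cubic_table140_ok : cubic_table_ok BinNums.N0 (BinNat.N.of_nat 1) cubic_table140.
Proof. by vm_compute. Qed.

Lemma cube_gap (u v : nat) : u < v -> 4 * (u * (u * u)) + 3 * v <= 4 * (v * (v * v)) + 3 * u.
Proof.
move=> uv; rewrite -(subnKC uv); move: (v - _) => w; clear; nia.
Qed.

Lemma cubic_gapP (e : int) (X T : nat) (x : N) :
  e = 1%R /\ 1 < X \/ e = (-1)%R /\ 0 < X -> cubic_gap (e == 1%R) (BinNat.N.of_nat T) x ->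
  cubic e X <> (T%:Z)%R.
Proof.
rewrite /cubic_gap /cubic; set y := BinNat.N.to_nat x.
have en : (((-1) : int) == 1)%R = false by [].
case=> -[-> X0]; rewrite ?eqxx ?en => g E.
  have {g}[g1 g2] : (y <= 1 \/ 4 * (y * (y * y)) < T + 3 * y) /\
      T + 3 * y.+1 < 4 * (y.+1 * (y.+1 * y.+1)).
    by rewrite /y; clear -g; lia.
  have {}E : 4 * (X * (X * X)) = T + 3 * X by clear -E; lia.
  move: (y) g1 g2 => z g1 g2.
  have [Xz|zX] := leqP X z.
    case: g1 => [z1|g1]; first by clear -z1 X0 Xz; lia.
    case: (ltngtP X z) Xz => [lt _|//|eq _]; last by rewrite eq in E; clear -E g1; lia.
    by have := cube_gap lt; clear -E g1; lia.
  case: (ltngtP z.+1 X) zX => [lt _|//|eq _]; last by rewrite eq in g2; clear -E g2; lia.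
  by have := cube_gap lt; clear -E g2; lia.
have {g}[g1 g2] : (y = 0 \/ 4 * (y * (y * y)) + 3 * y < T) /\
    T < 4 * (y.+1 * (y.+1 * y.+1)) + 3 * y.+1.
  by rewrite /y; clear -g; lia.
have {}E : 4 * (X * (X * X)) + 3 * X = T by clear -E; lia.
move: (y) g1 g2 => z g1 g2.
have [Xz|zX] := leqP X z.
  case: g1 => [z1|g1]; first by clear -z1 X0 Xz; lia.
  case: (ltngtP X z) Xz => [lt _|//|eq _]; last by rewrite eq in E; clear -E g1; lia.
  by have := cube_gap lt; clear -E g1 lt; lia.
case: (ltngtP z.+1 X) zX => [lt _|//|eq _]; last by rewrite eq in g2; clear -E g2; lia.
by have := cube_gap lt; clear -E g2 lt; lia.
Qed.

Lemma N_div_nat (a b : nat) :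
  BinNat.N.div (BinNat.N.of_nat a) (BinNat.N.of_nat b) = BinNat.N.of_nat (a %/ b).
Proof.
case: b => [|b]; first by rewrite divn0; case: (BinNat.N.of_nat a).
symmetry; apply: (BinNat.N.div_unique _ _ _ (BinNat.N.of_nat (a %% b.+1))).
  by have := ltn_pmod a (ltn0Sn b); clear; lia.
by have := divn_eq a b.+1; move: (a %/ b.+1) (a %% b.+1) => q r; clear; lia.
Qed.

Lemma binom_nextE (m : nat) : binom_next (BinNat.N.of_nat m) (BinNat.N.of_nat (central_binom m)) =
  BinNat.N.of_nat (central_binom m.+1).
Proof.
rewrite -[central_binom m.+1](mulKn _ (ltn0Sn m)) central_binomS -N_div_nat /binom_next.
congr BinNat.N.div; last by clear; lia.
by move: (central_binom m) => B; clear; lia.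
Qed.

Lemma cubic_table_sound (m n : nat) (t : seq (N * N * N * N)) (e : int) (X T : nat) :
  cubic_table_ok (BinNat.N.of_nat m) (BinNat.N.of_nat (central_binom m)) t ->
  m <= n < m + size t -> e = 1%R /\ 1 < X \/ e = (-1)%R /\ 0 < X ->
  T = catalan n \/ T = central_binom n -> cubic e X <> (T%:Z)%R.
Proof.
move=> + + hX hT; elim: t m => [|[[[x1 x2] x3] x4] t IH] m /=.
  by rewrite addn0 => _ /andP[/leq_ltn_trans h /h]; rewrite ltnn.
rewrite -(Nnat.Nat2N.inj_succ m) binom_nextE N_div_nat -/(catalan m).
case/and5P=> g1 g2 g3 g4 ok /andP[mn nm].
case: (ltngtP m n) mn => [lt _|//|mn _].
  by apply: (IH m.+1) => //; rewrite lt addSnnS.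
rewrite mn in g1 g2 g3 g4.
case: (hX) hT => -[eE X0] [->|->].
- by apply: (cubic_gapP hX (x := x3)); rewrite eE.
- by apply: (cubic_gapP hX (x := x1)); rewrite eE.
- by apply: (cubic_gapP hX (x := x4)); rewrite eE.
by apply: (cubic_gapP hX (x := x2)); rewrite eE.
Qed.

Lemma cubic_neq (R : realFieldType) (lg : nat -> R) (e : int) (X T m : nat) : is_log lg ->
  e = 1%R /\ 1 < X \/ e = (-1)%R /\ 0 < X ->
  T = catalan m \/ T = central_binom m -> cubic e X <> (T%:Z)%R.
Proof.
move=> L hX hT.
have he : e = 1%R \/ e = (-1)%R by case: hX => -[]; [left | right].
have X0 : 0 < X by case: hX => -[_ //]; apply: ltnW.
have [m1|m1] := ltnP m 140.
  have := @cubic_table_sound 0 m cubic_table140 e X T.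
  rewrite (_ : central_binom 0 = 1); last exact: bin0.
  rewrite (_ : size cubic_table140 = 140); last by vm_compute.
  by move=> /(_ cubic_table140_ok m1 hX hT).
have [m2|m2] := ltnP m (20 * 2 ^ 10); first exact: cubic_mid m1 m2 he X0 hT.
exact: cubic_large L m2 he X0 hT.
Qed.

(** * P19 *)

Lemma progression_count (f : pred nat) (n u J c : nat) : 0 < n -> 0 < u -> f u ->
  (forall j, f j -> f (j + n)) -> u + n * c <= J + n ->
  c <= \sum_(j <- iota 1 J) f j.
Proof.
move=> n0 u0 fu fn cJ; rewrite -big_mkcond sum1_count -size_filter /=.
rewrite -(size_iota 0 c) -(size_map (fun t => u + n * t)).
apply: uniq_leq_size.
  rewrite map_inj_uniq ?iota_uniq // => x y /eqP.
  by rewrite eqn_add2l eqn_pmul2l // => /eqP.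
move=> j /mapP[t]; rewrite mem_iota /= add0n => tc ->.
rewrite mem_filter mem_iota; apply/andP; split.
  elim: t {tc} => [|t IH]; first by rewrite muln0 addn0.
  by rewrite mulnS [n + _]addnC addnA; apply: fn.
have : n * t.+1 <= n * c by rewrite leq_mul2l tc orbT.
by rewrite mulnS; clear -cJ u0; lia.
Qed.

(* M j + 1 or M j - 1 *)
Definition ap_term (M : nat) (plus : bool) (j : nat) : nat :=
  if plus then (M * j).+1 else (M * j).-1.

Lemma ap_term_period (M n : nat) (b : bool) (j : nat) : 0 < M * j ->
  n %| ap_term M b j -> n %| ap_term M b (j + n).
Proof.
move=> Mj dn; have -> : ap_term M b (j + n) = ap_term M b j + M * n.
  by rewrite /ap_term mulnDr; case: b {dn}; [|case: (M * j) Mj].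
by rewrite dvdn_addr // dvdn_mull.
Qed.

Lemma ap_root (M n : nat) (b : bool) : 0 < n -> 0 < M -> coprime n M ->
  exists2 u, 0 < u <= n & n %| ap_term M b u.
Proof.
move=> n0 M0 cnM.
have [v vE] : exists v, n %| M * v + (if b then 1 else n.-1).
  case: b.
    have [[x y] /= E] := coprimeP M n0 cnM; exists y.
    have -> : M * y + 1 = x * n by move: E; rewrite [y * M]mulnC; clear; lia.
    exact: dvdn_mull.
  rewrite coprime_sym in cnM; have [[x y] /= E] := coprimeP n M0 cnM; exists x.
  have -> : M * x + n.-1 = (y + 1) * n by move: E; rewrite [x * M]mulnC mulnDl; clear -n0; lia.
  exact: dvdn_mull.
have rE : n %| M * (v %% n) + (if b then 1 else n.-1).
  move: vE; rewrite {1}(divn_eq v n) mulnDr -addnA dvdn_addr //.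
  by rewrite mulnA dvdn_mull.
have dd : forall u, 0 < u -> n %| M * u + (if b then 1 else n.-1) -> n %| ap_term M b u.
  move=> u u0; rewrite /ap_term; case: b {vE rE}; first by rewrite addn1.
  have Mu : 0 < M * u by rewrite muln_gt0 M0.
  have -> : M * u + n.-1 = (M * u).-1 + n by clear -n0 Mu; lia.
  by rewrite dvdn_addl.
have [v0|v0] := posnP (v %% n).
  exists n; first by rewrite n0 leqnn.
  by apply: dd => //; rewrite dvdn_addr ?dvdn_mull //; rewrite v0 muln0 add0n in rE.
by exists (v %% n); [rewrite v0 ltnW // ltn_pmod | apply: dd].
Qed.

Lemma ap_count (M n : nat) (b : bool) (J : nat) : 0 < n -> 0 < M -> coprime n M ->
  J %/ n <= \sum_(j <- iota 1 J) (n %| ap_term M b j).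
Proof.
move=> n0 M0 cnM; have [u /andP[u0 un] du] := ap_root b n0 M0 cnM.
pose f := [pred j | (0 < j) && (n %| ap_term M b j)].
apply: (@leq_trans (\sum_(j <- iota 1 J) f j)).
  apply: (@progression_count f n u) => //.
  - by rewrite /= u0.
  - move=> j /= /andP[j0 dj]; rewrite addn_gt0 j0 /=; apply: ap_term_period dj.
    by rewrite muln_gt0 M0.
  by rewrite addnC leq_add // mulnC leq_trunc_div.
by apply: leq_sum => j _ /=; case: (0 < j).
Qed.

Lemma ap_count_odd (M n : nat) (b : bool) (m : nat) : 1 < n -> 0 < M -> ~~ odd M ->
  (if b then M %| n.-1 else M %| n.+1) -> odd (m.*2 %/ n) ->
  (m.*2 %/ M) %/ n < \sum_(j <- iota 1 (m.*2 %/ M)) (n %| ap_term M b j).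
Proof.
move=> n1 M0 eM dM oy; have n0 := ltnW n1; set J := m.*2 %/ M.
have [s nE] : exists s, n = ap_term M b s.
  rewrite /ap_term; case: b dM => /dvdnP[s E]; exists s; rewrite mulnC -E.
    by rewrite prednK.
  by [].
have s0 : 0 < s.
  by move: n1; rewrite nE /ap_term; case: (b); case: s {nE} => //; rewrite muln0.
pose f := [pred j | (0 < j) && (n %| ap_term M b j)].
apply: (@leq_trans (\sum_(j <- iota 1 J) f j)); last first.
  by apply: leq_sum => j _ /=; case: (0 < j).
apply: (@progression_count f n s) => //.
- by rewrite /= s0 -nE dvdnn.
- move=> j /= /andP[j0 dj]; rewrite addn_gt0 j0 /=; apply: ap_term_period dj.
  by rewrite muln_gt0 M0.
set y := m.*2 %/ n in oy.
have -> : J %/ n = y %/ M by rewrite /J /y -!divnMA mulnC.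
have yE := divn_eq y M; set k := y %/ M in yE *.
have e0 : 0 < y %% M.
  rewrite lt0n; apply: contraL oy => /eqP e0; rewrite yE e0 addn0 oddM (negbTE eM) andbF //.
have yn : y * n <= m.*2 := leq_trunc_div _ _.
rewrite mulnS addnCA [J + n]addnC leq_add2l [s + _]addnC leq_divRL //.
have h1 : (k * M + 1) * n <= m.*2.
  by apply: leq_trans yn; rewrite leq_mul2r yE leq_add2l e0 orbT.
have -> : (n * k + s) * M = k * M * n + M * s by ring.
move: h1 eM; rewrite mulnDl mul1n {2}nE /ap_term; case: (b) => h1 eM.
  by clear -h1; lia.
have : ~~ odd (k * M * n + M * s) by rewrite oddD !oddM (negbTE eM) !andbF.
have Ms : 0 < M * s by rewrite muln_gt0 M0.
by move: h1; move: (k * M * n) (M * s) Ms => a c; clear; lia.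
Qed.

(** * P20 *)

Lemma logn_prod_seq (q : nat) (I : Type) (s : seq I) (F : I -> nat) : (forall i, 0 < F i) ->
  logn q (\prod_(i <- s) F i) = \sum_(i <- s) logn q (F i).
Proof.
move=> F0; elim: s => [|i s IH]; first by rewrite !big_nil logn1.
by rewrite !big_cons lognM ?prodn_gt0 // IH.
Qed.

Lemma ap_term_gt0 (M : nat) (b : bool) (j : nat) : 1 < M -> 0 < ap_term M b j.+1.
Proof. by rewrite /ap_term; case: b => // M1; rewrite mulnS; clear -M1; lia. Qed.

Lemma ap_term_le (M : nat) (b : bool) (j : nat) : ap_term M b j.+1 <= M.+1 * j.+1.
Proof. by rewrite /ap_term mulSn; case: b; clear; lia. Qed.

Definition ap_prod (M : nat) (b : bool) (J : nat) : nat := \prod_(0 <= j < J) ap_term M b j.+1.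

Lemma ap_prod_le (M : nat) (b : bool) (J : nat) : ap_prod M b J <= M.+1 ^ J * J`!.
Proof.
rewrite /ap_prod; elim: J => [|J IH]; first by rewrite big_geq.
rewrite big_nat_recr //= factS expnS.
apply: leq_trans (leq_mul IH (ap_term_le M b J)) _.
by rewrite leq_eqVlt; apply/orP; left; apply/eqP; ring.
Qed.

Lemma logn_ap_prod (q M : nat) (b : bool) (J X : nat) : prime q -> 1 < M -> M.+1 * J <= X ->
  logn q (ap_prod M b J) =
  \sum_(a <- iota 1 X | q ^ a <= X) \sum_(j <- iota 1 J) (q ^ a %| ap_term M b j).
Proof.
move=> pq M1 JX; rewrite /ap_prod logn_prod_seq => [|j]; last exact: ap_term_gt0.
rewrite exchange_big /= -[in iota 1 J](addn0 1) iotaDl big_map /index_iota subn0.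
apply: eq_big_seq => j; rewrite mem_iota /= add0n add1n => jJ.
apply: logn_count_dvd_upto => //; first exact: ap_term_gt0.
by apply: leq_trans (ap_term_le _ _ _) (leq_trans _ JX); rewrite leq_mul2l jJ orbT.
Qed.

Lemma logn_partn (q n : nat) (pi : nat_pred) : prime q -> logn q n`_pi = (q \in pi) * logn q n.
Proof.
move=> pq; have [qpi|qpi] := boolP (q \in pi).
  by rewrite mul1n -(logn_part q n`_pi) partn_part ?logn_part // => r /eqP ->.
rewrite mul0n; apply/eqP; rewrite -leqn0 leqNgt logn_gt0 primes_part mem_filter.
by rewrite (negbTE qpi).
Qed.

Lemma binom_part_dvd (M m : nat) (A : nat_pred) (bs : seq bool) :
  let J := m.*2 %/ M in
  1 < M -> ~~ odd M ->
  (forall q a, prime q -> q \in A -> 0 < a -> coprime q M /\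
     has (fun b : bool => if b then M %| (q ^ a).-1 else M %| (q ^ a).+1) bs) ->
  (central_binom m)`_A * (J`!`_(\pi(M)^')) ^ size bs %| \prod_(b <- bs) ap_prod M b J.
Proof.
move=> J M1 eM hA; have M0 := ltnW M1.
apply/dvdn_partP => [|q].
  by rewrite muln_gt0 expn_gt0 !part_gt0.
rewrite mem_primes => /andP[pq _].
have R0 : 0 < \prod_(b <- bs) ap_prod M b J.
  by apply: prodn_gt0 => b; apply: prodn_gt0 => j; apply: ap_term_gt0.
rewrite p_part pfactor_dvdn // lognM ?expn_gt0 ?part_gt0 // lognX.
set X := maxn m.*2 (M.+1 * J).
have mX : m.*2 <= X by rewrite leq_maxl.
have MJX : M.+1 * J <= X by rewrite leq_maxr.
have JX : J <= X by apply: leq_trans MJX; rewrite leq_pmull.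
rewrite logn_prod_seq => [|b]; last by apply: prodn_gt0 => j; apply: ap_term_gt0.
rewrite !logn_partn // (logn_central_binom pq mX) (logn_fact_upto pq JX).
under [X in _ <= X]eq_bigr => b _ do rewrite (logn_ap_prod b pq M1 MJX).
rewrite exchange_big /= !big_distrr /= -big_split /=.
rewrite big_seq_cond [leqRHS]big_seq_cond; apply: leq_sum => a.
rewrite mem_iota => /andP[/andP[a0 _] _].
rewrite inE /= mem_primes pq M0 /=.
have [qM|qM] := boolP (q %| M).
  have [qA|_] := boolP (q \in A); last by rewrite muln0.
  have [] := hA q a pq qA a0; rewrite prime_coprime // qM //.
have cop : coprime (q ^ a) M by rewrite coprimeXl // prime_coprime.
have n1 : 1 < q ^ a by rewrite -{1}(exp1n a) ltn_exp2r // prime_gt1.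
have [qA|_] := boolP (q \in A); last first.
  rewrite mul0n add0n mul1n -sum1_size big_distrl /=; apply: leq_sum => b _.
  by rewrite mul1n; apply: ap_count => //; apply: ltnW.
rewrite !mul1n; have [oy|ey] := boolP (odd (m.*2 %/ q ^ a)); last first.
  rewrite add0n -sum1_size big_distrl /=; apply: leq_sum => b _.
  by rewrite mul1n; apply: ap_count => //; apply: ltnW.
have [_ hb] := hA q a pq qA a0.
have big_lt : forall s : seq bool, 
    has (fun b : bool => if b then M %| (q ^ a).-1 else M %| (q ^ a).+1) s ->
    1 + size s * (J %/ q ^ a) <=
    \sum_(b <- s) \sum_(j <- iota 1 J) (q ^ a %| ap_term M b j).
  elim=> [//|b s IH] /= /orP[hb'|/IH h].
    rewrite big_cons mulSn addnA; apply: leq_add; first exact: ap_count_odd.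
    rewrite -sum1_size big_distrl /=; apply: leq_sum => b' _.
    by rewrite mul1n; apply: ap_count => //; apply: ltnW.
  rewrite big_cons mulSn addnCA; apply: leq_add h.
  by apply: ap_count => //; apply: ltnW.
exact: big_lt.
Qed.

Lemma fact_part_le (p J : nat) : prime p -> J`!`_p <= 2 ^ J.
Proof.
move=> pp; have p1 := prime_gt1 pp.
have key K n : (p - 1) * \sum_(1 <= k < K.+1) n %/ p ^ k <= n.
  elim: K n => [|K IH] n; first by rewrite big_geq // muln0.
  rewrite big_add1 big_nat_recl //= expn1.
  under eq_bigr => k _ do rewrite expnS divnMA.
  have := IH (n %/ p); rewrite big_add1 /= mulnDr => h.
  have h2 := leq_trunc_div n p; have pE : p = p - 1 + 1 by clear -p1; lia.
  rewrite {2}pE mulnDr muln1 mulnC in h2.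
  by apply: leq_trans h2; rewrite leq_add2l.
rewrite p_part logn_fact //; set v := \sum_(_ <= _ < _) _.
have vJ : (p - 1) * v <= J := key J J.
apply: (@leq_trans ((2 ^ (p - 1)) ^ v)); last by rewrite -expnM leq_exp2l.
have [->|v0] := posnP v; first by rewrite !expn0.
by rewrite leq_exp2r // -{1}(subnK (ltnW p1)) addn1 ltn_expl.
Qed.

Lemma fact_part2_le (p M J : nat) : prime p -> (forall q, prime q -> q %| M -> q = 2 \/ q = p) ->
  J`!`_(\pi(M)) <= 4 ^ J.
Proof.
move=> pp hM; set n := J`!`_(\pi(M)).
have n0 : 0 < n by rewrite part_gt0.
rewrite -(partnC 2 n0) (_ : 4 = 2 * 2) // expnMn; apply: leq_mul.
  apply: leq_trans (fact_part_le J (isT : prime 2)); apply: dvdn_leq; first by rewrite part_gt0.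
  by apply: partn_dvd; rewrite ?fact_gt0 // dvdn_part.
apply: leq_trans (fact_part_le J pp).
rewrite -[n`__](@part_pnat_id p).
  apply: dvdn_leq; first by rewrite part_gt0.
  by apply: partn_dvd; rewrite ?fact_gt0 // (dvdn_trans (dvdn_part _ _)) ?dvdn_part.
apply/pnatP => [|q pq qn]; first by rewrite part_gt0.
have qM : q \in \pi(M).
  have /pnatP h := part_pnat \pi(M) J`!; apply: (h (part_gt0 _ _) q pq).
  exact: dvdn_trans qn (dvdn_part _ _).
have q2 : q \in 2^'.
  by have /pnatP h := part_pnat 2^' n; apply: (h (part_gt0 _ _) q pq).
move: qM; rewrite mem_primes => /and3P[_ _ qM].
by case: (hM q pq qM) q2 => ->; rewrite !inE.
Qed.

Lemma binom_part_le (M m p : nat) (A : nat_pred) (bs : seq bool) :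
  let J := m.*2 %/ M in
  1 < M -> ~~ odd M -> prime p -> (forall q, prime q -> q %| M -> q = 2 \/ q = p) ->
  (forall q a, prime q -> q \in A -> 0 < a -> coprime q M /\
     has (fun b : bool => if b then M %| (q ^ a).-1 else M %| (q ^ a).+1) bs) ->
  (central_binom m)`_A <= (4 * M.+1) ^ (J * size bs).
Proof.
move=> J M1 eM pp hM hA.
have := @binom_part_dvd M m A bs M1 eM hA; rewrite -/J => /dvdn_leq.
rewrite prodn_gt0 => [/(_ isT) h|b]; last by apply: prodn_gt0 => j; apply: ap_term_gt0.
have {}h : (central_binom m)`_A * (J`!`_(\pi(M)^')) ^ size bs <=
   (M.+1 ^ J * (4 ^ J * J`!`_(\pi(M)^'))) ^ size bs.
  apply: leq_trans h _.
  elim: (bs) => [|b s IH]; first by rewrite big_nil.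
  rewrite big_cons [size _]/= expnS; apply: leq_mul IH.
  apply: leq_trans (ap_prod_le M b J) _; rewrite leq_mul2l; apply/orP; right.
  by rewrite -{1}(partnC \pi(M) (fact_gt0 J)) leq_mul2r (fact_part2_le J pp hM) orbT.
move: h; rewrite mulnA expnMn leq_pmul2r ?expn_gt0 ?part_gt0 //.
by rewrite -expnMn [M.+1 * 4]mulnC -expnM.
Qed.

(** * P21 *)

Lemma dvdn_pow_pred (M q a : nat) : 0 < q -> M %| q.-1 -> M %| (q ^ a).-1.
Proof.
move=> q0 Mq; apply: dvdn_trans Mq _; rewrite -!subn1 -{2}(exp1n a).
by rewrite subn_exp dvdn_mulr.
Qed.

Lemma dvdn_pow_succ (M q a : nat) : 0 < q -> M %| q.+1 -> (M %| (q ^ a).-1) || (M %| (q ^ a).+1).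
Proof.
move=> q0 Mq; elim: a => [|a /orP[h|h]]; first by rewrite dvdn0.
  apply/orP; right.
  have -> : (q ^ a.+1).+1 = q * (q ^ a).-1 + q.+1.
    have : 0 < q ^ a by rewrite expn_gt0 q0.
    by rewrite expnS; case: (q ^ a) => // x _ /=; rewrite mulnS; clear; lia.
  by rewrite dvdn_add // dvdn_mull.
apply/orP; left.
have -> : (q ^ a.+1).-1 = q * (q ^ a).+1 - q.+1.
  by rewrite expnS mulnS; clear; lia.
by rewrite dvdn_sub // dvdn_mull.
Qed.

Lemma splitting_part_le (N : int) (p e m : nat) : N = 1%R \/ N = (-1)%R ->
  prime p -> 0 < e ->
  (central_binom m)`_(splitting_primes N (p ^ e)) ^ (p ^ e) <= (16 * p ^ e + 4) ^ m.
Proof.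
move=> hN pp e0; set l := p ^ e; have l0 : 0 < l by rewrite expn_gt0 prime_gt0.
have primes_l k q : prime q -> q %| 2 ^ k * l -> q = 2 \/ q = p.
  move=> pq; rewrite Euclid_dvdM // !Euclid_dvdX // => /orP[/andP[h _]|/andP[h _]].
    by left; apply/eqP; rewrite -dvdn_prime2.
  by right; apply/eqP; rewrite -dvdn_prime2.
have even_l k : ~~ odd (2 ^ k.+1 * l) by rewrite expnS -mulnA oddM.
have fin k (bs : seq bool) (A : nat_pred) : 2 ^ k = 2 * size bs -> k <= 2 ->
    (central_binom m)`_A <= (4 * (2 ^ k * l).+1) ^ ((m.*2 %/ (2 ^ k * l)) * size bs) ->
    (central_binom m)`_A ^ l <= (16 * l + 4) ^ m.
  move=> kE k2 h; apply: (@leq_trans ((4 * (2 ^ k * l).+1) ^ m)).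
    apply: (@leq_trans (((4 * (2 ^ k * l).+1) ^ ((m.*2 %/ (2 ^ k * l)) * size bs)) ^ l)).
      by rewrite leq_exp2r.
    rewrite -expnM leq_exp2l //; last by clear; lia.
    have := leq_trunc_div m.*2 (2 ^ k * l); rewrite kE; move: (_ %/ _) => J.
    by rewrite -[m.*2]mul2n -!mulnA mulnCA leq_pmul2l.
  have [->//|m0] := posnP m; rewrite leq_exp2r // mulnS addnC leq_add2r mulnA leq_mul2r.
  by apply/orP; right; rewrite -[16]/(4 * 2 ^ 2) leq_mul2l leq_exp2l.
case: hN => hN.
  apply: (fin 2 [:: true; false] (splitting_primes N l) erefl isT); apply: (@binom_part_le _ _ p) => //.
  - by clear -l0; lia.
  - exact: (primes_l 2).
  move=> q a pq; rewrite inE hN eqxx -[4]/(2 ^ 2) => h a0; have q0 := prime_gt0 pq.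
  split; last by case/orP: h => h /=; rewrite orbF; [rewrite dvdn_pow_pred | apply: dvdn_pow_succ].
  case/orP: h => h; last by apply: coprime_dvdr h _; rewrite coprimenS.
  by apply: coprime_dvdr h _; rewrite -{1}(prednK q0) coprimeSn.
apply: (fin 1 [:: true] (splitting_primes N l) erefl isT); apply: (@binom_part_le _ _ p) => //.
- by clear -l0; lia.
- exact: (primes_l 1).
move=> q a pq; rewrite inE hN (_ : (-1 == 1 :> int)%R = false) // -[in 2 * l](expn1 2) => h a0.
have q0 := prime_gt0 pq; split; last by rewrite /= dvdn_pow_pred.
by apply: coprime_dvdr h _; rewrite -{1}(prednK q0) coprimeSn.
Qed.

(** * P22 *)
Local Open Scope ring_scope.

(* The parameters (P, N) for which the sequence grows. *)
Definition lucas_ok (N : int) (P : nat) : Prop := N = 1 /\ (2 < P)%N \/ N = -1 /\ (0 < P)%N.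

Lemma lucas_increasing (N : int) (P : nat) (k : nat) : lucas_ok N P ->
  0 < lucas P%:Z N k.+1 /\ lucas P%:Z N k.+1 < lucas P%:Z N k.+2.
Proof.
move=> hP; elim: k => [|k [IH1 IH2]].
  by case: hP => -[-> P0] /=; split; clear -P0; nia.
split; first by lia.
rewrite (lucasSS _ _ k.+1); move: (lucas _ _ k.+2) (lucas _ _ k.+1) IH1 IH2 => b a a0 ab.
have b0 : 0 <= b by apply: le_trans (ltW a0) (ltW ab).
case: hP => -[-> P0].
  have : 3 * b <= P%:Z * b by apply: ler_wpM2r => //; clear -P0; lia.
  by move: (P%:Z * b) => c; clear -a0 ab; lra.
have : 1 * b <= P%:Z * b by apply: ler_wpM2r => //; clear -P0; lia.
by move: (P%:Z * b) => c; clear -a0 ab; lra.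
Qed.

Lemma lucas_le (N : int) (P j k : nat) : lucas_ok N P -> (0 < j <= k)%N ->
  lucas P%:Z N j <= lucas P%:Z N k.
Proof.
move=> hP /andP[j0 jk]; rewrite -(subnK jk); elim: (k - j)%N => [//|n IH].
apply: (le_trans IH); case: (lucas_increasing (n + j).-1 hP) => _.
by rewrite prednK ?addn_gt0 ?j0 ?orbT // => /ltW.
Qed.

Lemma lucas_nat (N : int) (P k : nat) : lucas_ok N P -> (0 < k)%N ->
  exists v : nat, (0 < v)%N /\ lucas P%:Z N k = v%:Z.
Proof.
case: k => // k hP _; have [V0 _] := lucas_increasing k hP.
by exists (absz (lucas P%:Z N k.+1)); split; lia.
Qed.

Lemma lucas_ok_iter (N : int) (P k v : nat) : lucas_ok N P -> odd k ->
  lucas P%:Z N k = v%:Z -> lucas_ok (N ^+ k) v /\ N ^+ k = N.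
Proof.
move=> hP ok vE; have k0 : (0 < k)%N by case: k ok vE.
have : P%:Z <= v%:Z by rewrite -vE (@lucas_le N P 1 k hP).
case: hP => -[-> P0] Pv.
  by rewrite expr1n; split=> //; left; split=> //; lia.
by rewrite -signr_odd ok expr1; split=> //; right; split=> //; lia.
Qed.

Fixpoint cofactor (P N : int) (i : nat) : int :=
  match i with
  | 0 => 1
  | i1.+1 => if i1 is i2.+1 then (P ^+ 2 - 2 * N) * cofactor P N i1 - cofactor P N i2
             else P ^+ 2 - 3 * N
  end.

Lemma cofactorSS (P N : int) i :
  cofactor P N i.+2 = (P ^+ 2 - 2 * N) * cofactor P N i.+1 - cofactor P N i.
Proof. by []. Qed.

Lemma lucas_cofactor (P N : int) (i : nat) : N ^+ 2 = 1 ->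
  lucas P N i.*2.+1 = P * cofactor P N i.
Proof.
move=> N2; suff: lucas P N i.*2.+1 = P * cofactor P N i /\
  lucas P N i.+1.*2.+1 = P * cofactor P N i.+1 by case.
elim: i => [|i [IH1 IH2]]; first by rewrite /=; split; ring.
split=> //; rewrite cofactorSS mulrBr mulrCA -IH2 -IH1 !doubleS !lucasSS.
move: (lucas P N i.*2.+1) (lucas P N i.*2) => a b.
have -> : (P ^+ 2 - 2 * N) * (P * (P * a - N * b) - N * a) - a =
  (P ^+ 2 - 2 * N) * (P * (P * a - N * b) - N * a) - N ^+ 2 * a by rewrite N2 mul1r.
by ring.
Qed.

Lemma cofactor_mod (P N : int) (i : nat) : N ^+ 2 = 1 ->
  exists r : int, cofactor P N i = (- N) ^+ i * (i.*2.+1)%:R + P ^+ 2 * r.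
Proof.
move=> N2; suff: (exists r : int, cofactor P N i = (- N) ^+ i * (i.*2.+1)%:R + P ^+ 2 * r) /\
  exists r : int, cofactor P N i.+1 = (- N) ^+ i.+1 * (i.+1.*2.+1)%:R + P ^+ 2 * r by case.
elim: i => [|i [[r rE] [s sE]]].
  by split; [exists 0; rewrite -[0.*2.+1]/1%N | exists 1; rewrite -[1.*2.+1]/3%N]; rewrite /=; ring.
split; first by exists s.
exists (cofactor P N i.+1 - 2 * N * s - r).
have e : (- N) ^+ i.+2 = (- N) ^+ i by rewrite -addn2 exprD sqrrN N2 mulr1.
rewrite cofactorSS mulrBl {2}sE rE e.
have -> : i.+2.*2.+1%:R = 2 * i.+1.*2.+1%:R - i.*2.+1%:R :> int by lia.
rewrite (exprS (- N) i); move: (i.+1.*2.+1%:R) (i.*2.+1%:R) ((- N) ^+ i) (cofactor P N i.+1) => a b x y.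
transitivity (N ^+ 2 * (2 * x * a) - x * b + P ^+ 2 * (y - 2 * N * s - r)); first by ring.
by rewrite N2; ring.
Qed.

Lemma cofactor_odd (P N : int) (i : nat) : N = 1 \/ N = -1 -> ~~ (3 %| i.*2.+1)%N ->
  odd (absz (cofactor P N i)).
Proof.
move=> hN n3; have N2 : N ^+ 2 = 1 by case: hN => ->.
have [eP|oP] : (exists a, P = 2 * a) \/ exists a, P = 2 * a + 1.
- case: (intP P) => [|n|n]; [by left; exists 0 | |].
  + have := odd_double_half n.+1; case: (odd n.+1) => h; [right|left]; exists (n.+1./2)%:Z; lia.
  + have := odd_double_half n.+1; case: (odd n.+1) => h; [right; exists (- (n.+1./2)%:Z - 1)|left; exists (- (n.+1./2)%:Z)]; lia.
- have [r ->] := cofactor_mod P i N2; case: eP => a ->.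
  have -> : (2 * a) ^+ 2 * r = 2 * (2 * a ^+ 2 * r) by ring.
  have [->|->] : (- N) ^+ i = 1 \/ (- N) ^+ i = -1.
  + case: hN => ->; last by rewrite opprK expr1n; left.
    by rewrite -signr_odd; case: (odd i); [right|left].
  + by move: (2 * a ^+ 2 * r) => b; clear; lia.
  + by move: (2 * a ^+ 2 * r) => b; clear; lia.
have [s sE] : exists s, P ^+ 2 - 2 * N = 2 * s + 1.
  by case: oP => a ->; exists (2 * a ^+ 2 + 2 * a - N); ring.
have [t tE] : exists t, P ^+ 2 - 3 * N = 2 * t.
  case: oP => a ->; case: hN => ->; [exists (2 * a ^+ 2 + 2 * a - 1) | exists (2 * a ^+ 2 + 2 * a + 2)]; ring.
have key j : [/\ exists r, cofactor P N (3 * j) = 2 * r + 1 & exists r, cofactor P N (3 * j).+1 = 2 * r].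
  elim: j => [|j [[r rE] [u uE]]].
    by split; [exists 0 | exists t].
  have -> : (3 * j.+1 = (3 * j).+3)%N by rewrite mulnS.
  split.
    rewrite !cofactorSS sE uE rE.
    by exists ((2 * s + 1) * ((2 * s + 1) * u - r - 1) + s - u); ring.
  rewrite !cofactorSS sE uE rE.
  by exists ((2 * s + 1) * ((2 * s + 1) * ((2 * s + 1) * u - r - 1) + s - u) + (s + 1) - ((2 * s + 1) * u - r) ) ; ring.
have : (i = 3 * (i %/ 3) \/ i = (3 * (i %/ 3)).+2)%N.
  by clear -n3; lia.
have [[r rE] [u uE]] := key (i %/ 3)%N.
case=> ->; first by rewrite rE; clear; lia.
rewrite cofactorSS sE uE rE.
have -> : (2 * s + 1) * (2 * u) - (2 * r + 1) = 2 * ((2 * s + 1) * u - r - 1) + 1 by ring.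
by move: ((2 * s + 1) * u - r - 1) => b; clear; lia.
Qed.

(** * P23 *)

Lemma lucas_split (N : int) (P p e : nat) : lucas_ok N P -> odd p ->
  exists P' Q : nat, [/\ lucas_ok N P', lucas P%:Z N (p ^ e)%N = P'%:Z,
    lucas P%:Z N (p ^ e.+1)%N = (P' * Q)%N%:Z, (0 < Q)%N & Q%:Z = cofactor P'%:Z N p./2].
Proof.
move=> hP op; have ope : odd (p ^ e)%N by rewrite oddX op orbT.
have p0 : (0 < p)%N by case: (p) op.
have [P' [P'0 P'E]] := @lucas_nat N P (p ^ e)%N hP (odd_gt0 ope).
have [hP' NE] := lucas_ok_iter hP ope P'E; rewrite NE in hP'.
have N2 : N ^+ 2 = 1 by case: hP => -[->].
have [V [V0 VE]] := @lucas_nat N P' p hP' p0.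
have pE : p = (p./2).*2.+1 by rewrite -{1}(odd_double_half p) op.
have VQ : V%:Z = P'%:Z * cofactor P'%:Z N p./2 by rewrite -VE {1}pE lucas_cofactor.
have Q0 : 0 < cofactor P'%:Z N p./2.
  by rewrite -(pmulr_rgt0 _ (_ : 0 < P'%:Z)) -?VQ //; lia.
exists P', (absz (cofactor P'%:Z N p./2)); split=> //.
- by rewrite expnS lucasM P'E NE VE VQ PoszM; congr (_ * _); lia.
- by lia.
by lia.
Qed.

Lemma splitting_primes_large (N : int) (l q : nat) : (1 < q)%N ->
  q \in splitting_primes N l -> (2 * l <= q)%N.
Proof.
move=> q1; rewrite inE /=; case: ifP => _; first (case/orP; move/dvdn_leq).
- by move=> h; clear -h q1; lia.
- by move=> h; clear -h q1; lia.
by move/dvdn_leq => h; clear -h q1; lia.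
Qed.

Lemma cofactor_prime_factor (N : int) (P p e P' Q q : nat) : lucas_ok N P -> prime p -> odd p ->
  lucas P%:Z N (p ^ e)%N = P'%:Z -> lucas P%:Z N (p ^ e.+1)%N = (P' * Q)%N%:Z ->
  Q%:Z = cofactor P'%:Z N p./2 -> prime q -> (q %| Q)%N ->
  [\/ q = 2%N, q = p /\ (p %| P')%N | q \in splitting_primes N (p ^ e.+1)].
Proof.
move=> hP pp op P'E VE QE pq qQ.
have hN : N = 1 \/ N = -1 by case: hP => -[]; [left|right].
have [->|oq] := even_prime pq; first by constructor 1.
have [qP|qP] := boolP (q %| P')%N; last first.
  constructor 3; rewrite inE /=; apply: (@lucas_divisor_class q p e P%:Z N pq oq pp op hN).
    by rewrite VE absz_nat dvdn_mull.
  by rewrite P'E absz_nat.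
suff qp : q = p by constructor 2; rewrite -qp.
have N2 : N ^+ 2 = 1 by case: hN => ->.
have [r rE] := cofactor_mod P'%:Z p./2 N2.
have pE : p = (p./2).*2.+1 by rewrite -{1}(odd_double_half p) op.
rewrite -QE -pE in rE.
have [a aE] : exists a, Q = (q * a)%N by case/dvdnP: qQ => a ->; exists a; rewrite mulnC.
have [b bE] : exists b, P' = (q * b)%N by case/dvdnP: qP => b ->; exists b; rewrite mulnC.
have qp : (q%:Z %| p%:Z)%Z.
  apply/dvdzP; exists ((- N) ^+ p./2 * (a%:Z - q%:Z * b%:Z ^+ 2 * r)).
  have e1 : (- N) ^+ p./2 * (- N) ^+ p./2 = 1 by rewrite -expr2 -exprM mulnC exprM sqrrN N2 expr1n.
  have : (- N) ^+ p./2 * Q%:Z = p%:Z + (- N) ^+ p./2 * P'%:Z ^+ 2 * r.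
    by rewrite rE mulrDr mulrA e1 mul1r mulrA natz.
  rewrite aE bE !PoszM => E.
  transitivity ((- N) ^+ p./2 * (q%:Z * a%:Z) - (- N) ^+ p./2 * (q%:Z * b%:Z) ^+ 2 * r); last by ring.
  by rewrite E addrK.
by apply/eqP; rewrite -dvdn_prime2.
Qed.

Lemma cofactor_pfactor (N : int) (P p e P' Q : nat) : lucas_ok N P -> prime p -> odd p ->
  lucas P%:Z N (p ^ e)%N = P'%:Z -> lucas P%:Z N (p ^ e.+1)%N = (P' * Q)%N%:Z ->
  Q%:Z = cofactor P'%:Z N p./2 -> ~~ (p ^ 2 %| Q)%N.
Proof.
move=> hP pp op P'E VE QE; apply/negP => p2Q.
have pQ : (p %| Q)%N by apply: dvdn_trans p2Q; rewrite expnS dvdn_mulr.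
have hN : N = 1 \/ N = -1 by case: hP => -[]; [left|right].
have p1 := prime_gt1 pp.
have pe : (p <= p ^ e.+1)%N by rewrite expnS leq_pmulr // expn_gt0 ltnW.
case: (cofactor_prime_factor hP pp op P'E VE QE pp pQ) => [p2|[_ pP]|].
- by rewrite p2 in op.
- have N2 : N ^+ 2 = 1 by case: hN => ->.
  have [r rE] := cofactor_mod P'%:Z p./2 N2.
  have pE : p = (p./2).*2.+1 by rewrite -{1}(odd_double_half p) op.
  rewrite -QE -pE in rE.
  case/dvdnP: p2Q => a aE; case/dvdnP: pP => b bE.
  have e1 : (- N) ^+ p./2 * (- N) ^+ p./2 = 1 by rewrite -expr2 -exprM mulnC exprM sqrrN N2 expr1n.
  have E : (- N) ^+ p./2 * Q%:Z = p%:Z + (- N) ^+ p./2 * P'%:Z ^+ 2 * r.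
    by rewrite rE mulrDr mulrA e1 mul1r mulrA natz.
  have pN0 : p%:Z != 0 by clear -p1; lia.
  have : p%:Z * 1 = p%:Z * (((- N) ^+ p./2 * (a%:Z - b%:Z ^+ 2 * r)) * p%:Z).
    rewrite mulr1.
    transitivity ((- N) ^+ p./2 * Q%:Z - (- N) ^+ p./2 * P'%:Z ^+ 2 * r); first by rewrite E addrK.
    by rewrite aE bE !PoszM; ring.
  move/(mulfI pN0) => h; have : (p%:Z %| 1)%Z by apply/dvdzP; exact: ex_intro h.
  by rewrite dvdz1 /=; clear -p1; lia.
by move/(splitting_primes_large p1) => h; clear -h pe p1; lia.
Qed.

(** * P24 *)

Lemma pnat_le_bound (p n k : nat) : prime p -> p.-nat n -> ~~ (p ^ k.+1 %| n)%N -> (n <= p ^ k)%N.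
Proof.
move=> pp /p_natP[a ->] nd; rewrite leq_exp2l ?prime_gt1 // leqNgt.
by apply: contra nd => ka; apply: dvdn_exp2l.
Qed.

Lemma prime_dvd_fact (p n : nat) : prime p -> (p %| n`!)%N -> (p <= n)%N.
Proof.
move=> pp; elim: n => [|n IH]; first by rewrite dvdn1 => /eqP p1; rewrite p1 in pp.
by rewrite factS Euclid_dvdM // => /orP[/dvdn_leq|/IH/leqW]; [apply|].
Qed.

Lemma partn_dbl (m : nat) (A : nat_pred) : 2%N \notin A -> ((2 * central_binom m)`_A = (central_binom m)`_A)%N.
Proof.
move=> nA; rewrite partnM ?central_binom_gt0 // (@part_p'nat A 2) ?mul1n //.
by apply/pnatP => // q pq; rewrite dvdn_prime2 // => /eqP ->.
Qed.

Lemma two_notin_splitting (N : int) (l : nat) : (1 < l)%N -> 2%N \notin splitting_primes N l.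
Proof.
by move=> l1; apply/negP => /(@splitting_primes_large N l 2 isT); clear -l1; lia.
Qed.

Lemma prime_cofactor_le (N : int) (P p Q m : nat) : lucas_ok N P -> prime p -> (3 < p)%N ->
  lucas P%:Z N p = (P * Q)%N%:Z -> (0 < Q)%N -> Q%:Z = cofactor P%:Z N p./2 ->
  (0 < m)%N -> (Q %| 2 * central_binom m)%N ->
  (Q <= m.*2 * (central_binom m)`_(splitting_primes N (p ^ 1)))%N.
Proof.
move=> hP pp p3 VE Q0 QE m0 QB; set A := splitting_primes N (p ^ 1).
have hN : N = 1 \/ N = -1 by case: hP => -[]; [left|right].
have op : odd p by case: (even_prime pp) p3 => [->|].
have P'E : lucas P%:Z N (p ^ 0)%N = P%:Z by [].
have VE' : lucas P%:Z N (p ^ 1)%N = (P * Q)%N%:Z by rewrite expn1.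
have oQ : odd Q.
  have := @cofactor_odd P%:Z N p./2 hN; rewrite -QE absz_nat; apply.
  have -> : (p./2).*2.+1 = p by rewrite -{2}(odd_double_half p) op.
  by rewrite dvdn_prime2 // neq_ltn p3.
have npart : p.-nat (Q`_(A^'))%N.
  apply/pnatP => [|q pq qn]; first by rewrite part_gt0.
  have qQ := dvdn_trans qn (dvdn_part _ _).
  have qA : q \in A^' by have /pnatP h := part_pnat A^' Q; apply: (h (part_gt0 _ _) q pq).
  case: (cofactor_prime_factor hP pp op P'E VE' QE pq qQ) => [q2|[-> _]|qA'].
  - by move: (dvdn_odd qQ oQ); rewrite q2.
  - by rewrite inE.
  by rewrite inE /= qA' in qA.
have pB : (central_binom m %| (m.*2)`!)%N.
  by rewrite /central_binom -(bin_fact (_ : m <= m.*2)%N) ?dvdn_mulr // -addnn leq_addr.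
rewrite -(partn_dbl m (two_notin_splitting N _)); last by rewrite expn1 prime_gt1.
apply: (cofactor_le_partn _ QB); first by rewrite muln_gt0 central_binom_gt0.
have [pQ|pQ] := boolP (p %| Q)%N; last first.
  apply: leq_trans (_ : p ^ 0 <= _)%N; last by rewrite double_gt0.
  apply: pnat_le_bound => //; apply: contra pQ; rewrite expn1 => h.
  exact: dvdn_trans h (dvdn_part _ _).
apply: leq_trans (_ : p ^ 1 <= _)%N.
  apply: pnat_le_bound => //.
  apply: contra (cofactor_pfactor hP pp op P'E VE' QE) => h.
  exact: dvdn_trans h (dvdn_part _ _).
rewrite expn1; have pB2 := dvdn_trans pQ QB.
rewrite Euclid_dvdM // dvdn_prime2 // in pB2.
case/orP: pB2 => [/eqP p2|pB2]; first by rewrite p2 in op.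
exact: prime_dvd_fact pp (dvdn_trans pB2 pB).
Qed.

Lemma nine_cofactor_le (N : int) (P P' Q m : nat) : lucas_ok N P -> lucas_ok N P' ->
  lucas P%:Z N (3 ^ 1)%N = P'%:Z -> lucas P%:Z N (3 ^ 2)%N = (P' * Q)%N%:Z ->
  (0 < Q)%N -> Q%:Z = cofactor P'%:Z N 3./2 ->
  (Q %| 2 * central_binom m)%N ->
  (Q <= 12 * (central_binom m)`_(splitting_primes N (3 ^ 2)))%N.
Proof.
move=> hP hP' P'E VE Q0 QE QB; set A := splitting_primes N (3 ^ 2).
have hN : N = 1 \/ N = -1 by case: hP => -[]; [left|right].
have Q8 : ~~ (8 %| Q)%N.
  apply/negP => /dvdnP[k kE]; move: QE; rewrite kE /= => E.
  have [s sE] : exists s : int, P'%:Z ^+ 2 = 8 * s + (P' %% 8)%N%:Z ^+ 2.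
    exists (8 * (P' %/ 8)%N%:Z ^+ 2 + 2 * (P' %/ 8)%N%:Z * (P' %% 8)%N%:Z).
    by rewrite {1}(divn_eq P' 8) PoszD PoszM; ring.
  rewrite sE in E; have := ltn_pmod P' (isT : 0 < 8)%N.
  move: (P' %% 8)%N E => r E; clear -E hN.
  by case: r E => [|[|[|[|[|[|[|[|r]]]]]]]] // E _; lia.
have Q9 := cofactor_pfactor hP (isT : prime 3) isT P'E VE QE.
rewrite -(partn_dbl m (two_notin_splitting N _)) //.
apply: (cofactor_le_partn _ QB); first by rewrite muln_gt0 central_binom_gt0.
set n := (Q`_(A^'))%N; have n0 : (0 < n)%N by rewrite part_gt0.
have nQ : (n %| Q)%N := dvdn_part _ _.
have fac q : prime q -> (q %| n)%N -> q = 2%N \/ q = 3%N.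
  move=> pq qn; have qQ := dvdn_trans qn nQ.
  have qA : q \in A^' by have /pnatP h := part_pnat A^' Q; apply: (h (part_gt0 _ _) q pq).
  case: (cofactor_prime_factor hP (isT : prime 3) isT P'E VE QE pq qQ) => [->|[-> _]|qA'].
  - by left.
  - by right.
  by rewrite inE /= qA' in qA.
rewrite -(partnC 2%N n0) (_ : 12 = 2 ^ 2 * 3 ^ 1)%N //; apply: leq_mul; apply: pnat_le_bound => //.
- exact: part_pnat.
- by apply: contra Q8 => h; apply: dvdn_trans h (dvdn_trans (dvdn_part _ _) nQ).
- apply/pnatP => [|q pq qn]; first by rewrite part_gt0.
  have q2 : q \in (2%N : nat_pred)^' by have /pnatP h := part_pnat (2%N : nat_pred)^' n; apply: (h (part_gt0 _ _) q pq).
  by case: (fac q pq (dvdn_trans qn (dvdn_part _ _))) q2 => ->.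
by apply: contra Q9 => h; apply: dvdn_trans h (dvdn_trans (dvdn_part _ _) nQ).
Qed.

(** * P25 *)

Lemma bernoulli_step (m k : nat) : (k <= m)%N -> (m.+1 ^ k * (m - k) <= m ^ k.+1)%N.
Proof.
elim: k => [|k IH] km; first by rewrite expn0 mul1n subn0 expn1.
have h : (m.+1 * (m - k.+1) <= (m - k) * m)%N.
  have [d dE] : exists d, m = (k.+1 + d)%N by exists (m - k.+1)%N; rewrite subnKC.
  by rewrite {2}dE addnC addnK dE; clear; nia.
rewrite expnSr -mulnA; apply: leq_trans (leq_mul (leqnn _) h) _.
by rewrite mulnA [(m ^ _)%N]expnSr leq_mul2r (IH (ltnW km)) orbT.
Qed.

Lemma ltn_mul_le4 (f a b x d y : nat) : (0 < b)%N -> (0 < d)%N -> (0 < y)%N ->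
  (f < a)%N -> (x <= y)%N -> (f * b * (d * x) < a * b * (d * y))%N.
Proof.
move=> b0 d0 y0 fa xy; rewrite -!mulnA.
apply: (@leq_ltn_trans (f * (b * (d * y)))%N); first by rewrite !leq_mul2l xy !orbT.
by rewrite ltn_pmul2r // !muln_gt0 b0 d0 y0.
Qed.

Lemma size_gap_start (t f s : nat) : t = 2%N -> (f < t ^ 7)%N -> (s ^ 2 <= t ^ 9)%N ->
  (f * (t ^ 7) ^ 13 * (t ^ 2 * s) ^ 64 < t ^ 4 * (t ^ 8) ^ 64)%N.
Proof.
move=> t2 ft st; have t0 k : (0 < t ^ k)%N by rewrite expn_gt0 t2.
have h : (s ^ 64 <= t ^ 288)%N by rewrite (expnM s 2 32) (expnM t 9 32) leq_exp2r.
rewrite expnMn -!expnM; apply: (leq_trans (ltn_mul_le4 (t0 _) (t0 _) (t0 _) ft h)).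
by rewrite -!expnD leq_exp2l // t2.
Qed.

Lemma size_gap (m : nat) : (64 <= m)%N ->
  (81 * m.*2 ^ 13 * (2 ^ 2 * 21) ^ m < 2 ^ 4 * (2 ^ 8) ^ m)%N.
Proof.
have [c [cE c3]] : exists c, c = (2 ^ 2 * 21)%N /\ (3 * c <= 2 ^ 8)%N by exists 84%N.
have [f [fE f0]] : exists f, f = 81%N /\ (0 < f)%N by exists 81%N.
move=> m64; rewrite -cE -fE; rewrite -(subnK m64); elim: (m - 64)%N => [|n IH].
  have f7 : (f < 2 ^ 7)%N by rewrite fE.
  rewrite add0n (_ : 64.*2 = 2 ^ 7)%N; last by [].
  rewrite cE; exact: (@size_gap_start 2 f 21 erefl f7 isT).
set k := (n + 64)%N in IH *; have k64 : (64 <= k)%N by rewrite leq_addl.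
rewrite addSn -/k.
have h : (k.+1 ^ 13 <= 3 * k ^ 13)%N.
  have b := @bernoulli_step k 13 (leq_trans (isT : 13 <= 64)%N k64).
  have k3 : (k <= 3 * (k - 13))%N by clear -k64; lia.
  have k13 : (0 < k - 13)%N by clear -k64; lia.
  rewrite -(leq_pmul2r k13).
  apply: leq_trans b _; rewrite expnSr mulnAC mulnC.
  by rewrite leq_mul2r k3 orbT.
have -> : (k.+1.*2 ^ 13 = 2 ^ 13 * k.+1 ^ 13)%N by rewrite -mul2n expnMn.
have e2 : (k.*2 ^ 13 = 2 ^ 13 * k ^ 13)%N by rewrite -mul2n expnMn.
rewrite e2 in IH.
have -> : (c ^ k.+1 = c ^ k * c)%N by rewrite expnSr.
have -> : ((2 ^ 8) ^ k.+1 = (2 ^ 8) ^ k * 2 ^ 8)%N by rewrite expnSr.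
apply: (@leq_ltn_trans ((f * (2 ^ 13 * k ^ 13) * c ^ k) * (3 * c))%N).
  apply: (@leq_trans (f * (2 ^ 13 * (3 * k ^ 13)) * (c ^ k * c))%N).
    by rewrite leq_mul2r leq_mul2l leq_mul2l h !orbT.
  by move: (2 ^ 13)%N (k ^ 13)%N (c ^ k)%N => a b d; apply: eq_leq; ring.
apply: (@leq_trans (2 ^ 4 * (2 ^ 8) ^ k * (3 * c))%N).
  by rewrite ltn_pmul2r // muln_gt0 cE.
by rewrite -mulnA !leq_mul2l c3 !orbT.
Qed.

Lemma part_pow5 (p m B c : nat) : c = 84%N -> (5 <= p)%N ->
  (B ^ p <= (16 * p + 4) ^ m)%N -> (B ^ 5 <= c ^ m)%N.
Proof.
move=> cE p5 h; have key : ((16 * p + 4) ^ 5 <= c ^ p)%N.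
  rewrite -(subnK p5); elim: (p - 5)%N => [|n IH]; first by rewrite cE leqnn.
  rewrite addSn (expnS c); apply: leq_trans (leq_mul (leqnn c) IH).
  apply: (@leq_trans ((2 * (16 * (n + 5) + 4)) ^ 5)); first by rewrite leq_exp2r //; clear; lia.
  by rewrite expnMn leq_mul2r cE orbT.
have p0 : (0 < p)%N by apply: leq_trans p5.
rewrite -(leq_exp2r _ _ p0) [leqLHS]expnAC.
apply: (@leq_trans (((16 * p + 4) ^ m) ^ 5)); first by rewrite leq_exp2r.
rewrite [leqLHS]expnAC [leqRHS]expnAC.
by case: (m) => // n; rewrite leq_exp2r.
Qed.

Lemma part_pow6 (m B c : nat) : c = 84%N -> (B ^ 9 <= (16 * 9 + 4) ^ m)%N -> (B ^ 6 <= c ^ m)%N.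
Proof.
move=> cE h; rewrite -(@leq_exp2r _ _ 3) // -(expnM B) (_ : 6 * 3 = 9 * 2)%N; last by [].
rewrite expnM; apply: (@leq_trans (((16 * 9 + 4) ^ m) ^ 2)); first by rewrite leq_exp2r.
rewrite [leqLHS]expnAC [leqRHS]expnAC.
case: (m) => // n; rewrite leq_exp2r //.
apply: (@leq_trans ((c * 2) ^ 2)%N); first by rewrite leq_exp2r // cE.
by rewrite expnMn (expnSr c 2) leq_mul2l cE orbT.
Qed.

Lemma prime_cofactor_ge (N : int) (P p Q : nat) : lucas_ok N P -> (5 <= p)%N ->
  lucas P%:Z N p = (P * Q)%N%:Z -> (16 * P ^ 4 <= 81 * Q)%N.
Proof.
move=> hP p5 VE.
have P0 : (0 < P)%N by case: hP => -[_] //; apply: ltn_trans.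
have : lucas P%:Z N 5 <= lucas P%:Z N p by apply: lucas_le; rewrite ?p5.
have -> : lucas P%:Z N 5 = P%:Z * (P%:Z ^+ 4 - 5 * N * P%:Z ^+ 2 + 5 * N ^+ 2) by rewrite /=; ring.
rewrite VE PoszM ler_pM2l; last by clear -P0; lia.
have -> : P%:Z ^+ 4 = (P%:Z ^+ 2) ^+ 2 by rewrite -exprM.
have : (P ^ 4)%N%:Z = (P%:Z ^+ 2) ^+ 2 by rewrite -exprM; lia.
have : (if N == 1 then 9 else 1) <= P%:Z ^+ 2.
  by case: hP => -[->]; rewrite ?eqxx /=; clear; nia.
move: (P%:Z ^+ 2) (P ^ 4)%N => x y; case: hP => -[-> _]; rewrite ?eqxx /= => h1 h2 h3.
  by clear -h1 h2 h3; nia.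
by clear -h1 h2 h3; nia.
Qed.

Lemma nine_cofactor_ge (N : int) (P Q : nat) : lucas_ok N P ->
  Q%:Z = P%:Z ^+ 2 - 3 * N -> (4 * P ^ 2 <= 9 * Q)%N.
Proof. by case=> -[-> P0] QE; clear -P0 QE; nia. Qed.

(** * P26 *)

(* The indices treated in this part: a prime at least 5, or 9; in both cases the
   index is p^(e+1). *)
Definition good_index (p e : nat) : Prop := prime p /\ (5 <= p)%N /\ e = 0%N \/ p = 3%N /\ e = 1%N.

Lemma power_size_prime (V P Q B n c m : nat) : V = (P * Q)%N -> (16 * P ^ 4 <= 81 * Q)%N ->
  (Q <= n * B)%N -> (B ^ 5 <= c ^ m)%N -> (16 * V ^ 4 <= 81 * n ^ 5 * c ^ m)%N.
Proof.
move=> -> h1 h2 h3; rewrite expnMn mulnA.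
apply: leq_trans (leq_mul h1 (leqnn _)) _; rewrite -[leqLHS]mulnA -[leqRHS]mulnA leq_mul2l -expnS /=.
apply: (@leq_trans ((n * B) ^ 5)%N); first by rewrite leq_exp2r.
by rewrite expnMn leq_mul2l h3 orbT.
Qed.

Lemma power_size_nine (V P Q B n c m : nat) : V = (P * Q)%N -> (4 * P ^ 2 <= 9 * Q)%N ->
  (Q <= 12 * B)%N -> (B ^ 6 <= c ^ m)%N -> (12 ^ 6 <= n ^ 5)%N ->
  (16 * V ^ 4 <= 81 * n ^ 5 * c ^ m)%N.
Proof.
move=> -> h1 h2 h3 h4.
have {}h1 : (16 * P ^ 4 <= 81 * Q ^ 2)%N.
  have : ((4 * P ^ 2) ^ 2 <= (9 * Q) ^ 2)%N by rewrite leq_exp2r.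
  by rewrite (expnMn 4) (expnMn 9) -expnM.
rewrite expnMn mulnA.
apply: leq_trans (leq_mul h1 (leqnn _)) _; rewrite -[leqLHS]mulnA -[leqRHS]mulnA leq_mul2l -expnD /=.
apply: (@leq_trans ((12 * B) ^ 6)%N); first by rewrite leq_exp2r.
by rewrite expnMn leq_mul.
Qed.

Lemma pow_12_20 (t : nat) : t = 2%N -> ((t ^ 2 * 3) ^ 6 <= (t ^ 2 * 5) ^ 5)%N.
Proof.
move=> t2; rewrite (expnMn (t ^ 2) 3) (expnMn (t ^ 2) 5) -!(expnM t).
by rewrite (expnD t 10 2) -mulnA leq_mul2l t2 orbC.
Qed.

Lemma lucas_power_size (N : int) (P p e V m c : nat) : lucas_ok N P -> good_index p e ->
  lucas P%:Z N (p ^ e.+1)%N = V%:Z -> (V %| 2 * central_binom m)%N -> (10 <= m)%N -> c = 84%N ->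
  (16 * V ^ 4 <= 81 * m.*2 ^ 5 * c ^ m)%N.
Proof.
move=> hP hpe VE VB m10 cE.
have m0 : (0 < m)%N by apply: leq_trans m10.
have op : odd p.
  case: hpe => [[pp [p5 _]]|[-> _] //].
  by case: (even_prime pp) p5 => [->|].
have hN : N = 1 \/ N = -1 by case: hP => -[]; [left|right].
have [P' [Q [hP' P'E VE' Q0 QE]]] := lucas_split e hP op.
have VPQ : V = (P' * Q)%N by move: VE; rewrite VE'; clear; lia.
have QB : (Q %| 2 * central_binom m)%N by apply: dvdn_trans VB; rewrite VPQ dvdn_mull.
case: hpe => [[pp [p5 e0]]|[p3 e1]].
  rewrite e0 expn0 in P'E VE'; have PP : P' = P by move: P'E => /=; clear; lia.
  rewrite PP in VPQ QE VE' hP'; rewrite expn1 in VE'.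
  apply: (power_size_prime VPQ (prime_cofactor_ge hP p5 VE')).
    exact: (prime_cofactor_le hP pp (ltnW p5) VE' Q0 QE m0 QB).
  by apply: (part_pow5 cE p5); have := splitting_part_le m hN pp (isT : 0 < 1)%N; rewrite expn1.
rewrite p3 e1 in P'E VE' QE.
apply: (power_size_nine VPQ (nine_cofactor_ge hP' QE)).
- exact: (nine_cofactor_le hP hP' P'E VE' Q0 QE QB).
- by apply: (part_pow6 cE); have := splitting_part_le m hN (isT : prime 3) (isT : 0 < 2)%N.
apply: (@leq_trans ((2 ^ 2 * 5) ^ 5)%N); first exact: (@pow_12_20 2 erefl).
by rewrite leq_exp2r //; clear -m10; lia.
Qed.

Lemma lucas_large (N : int) (P p e V m T : nat) : lucas_ok N P -> good_index p e ->
  lucas P%:Z N (p ^ e.+1)%N = V%:Z -> T = catalan m \/ T = central_binom m ->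
  V = T \/ V = (2 * T)%N -> (64 <= m)%N -> False.
Proof.
move=> hP hpe VE hT hV m64.
have [c cE] : exists c, c = 84%N by exists 84%N.
have [T0 TB BT] := catalan_or_binom_dvd hT.
have VB : (V %| 2 * central_binom m)%N by case: hV => ->; [apply: dvdn_mull | apply: dvdn_mul].
have m10 : (10 <= m)%N by apply: leq_trans m64.
have m0 : (0 < m)%N by apply: leq_trans m64.
have h := lucas_power_size hP hpe VE VB m10 cE.
have TV : (T <= V)%N by case: hV => ->; clear; lia.
have h4 : (4 ^ m <= m.*2 ^ 2 * V)%N.
  apply: leq_trans (central_binom_ge m0) _; rewrite -[(_ ^ 2)%N]mulnn -mulnA leq_mul2l.
  apply/orP; right; apply: leq_trans BT _; apply: leq_mul TV.
  by clear -m0; lia.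
have gap := size_gap m64.
have {}h4 : (2 ^ 4 * (4 ^ m) ^ 4 <= 2 ^ 4 * (m.*2 ^ 2 * V) ^ 4)%N by rewrite leq_mul2l leq_exp2r.
have : (2 ^ 4 * (2 ^ 8) ^ m <= 81 * m.*2 ^ 13 * (2 ^ 2 * 21) ^ m)%N.
  apply: (@leq_trans (2 ^ 4 * (4 ^ m) ^ 4)%N).
    rewrite leq_mul2l; apply/orP; right; apply: eq_leq.
    by rewrite -(expnM 2 8) (_ : 4 ^ m = 2 ^ (2 * m))%N ?expnM // -!expnM; congr (_ ^ _)%N; clear; lia.
  apply: leq_trans h4 _; rewrite expnMn -expnM mulnCA.
  apply: leq_trans (leq_mul (leqnn _) h) _; apply: eq_leq.
  have -> : (c ^ m = (2 ^ 2 * 21) ^ m)%N by rewrite cE.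
  move: (_ ^ m)%N => x; rewrite (_ : m.*2 ^ 13 = m.*2 ^ (2 * 4) * m.*2 ^ 5)%N; last by rewrite -expnD.
  by move: (_ ^ (2 * 4))%N (_ ^ 5)%N => a b; ring.
by rewrite leqNgt gap.
Qed.

(** * P27 *)
Local Close Scope ring_scope.

Definition splits (plus : bool) (l q : nat) : bool :=
  (l.*2 <= q) && (if plus then (4 * l %| q.-1) || (4 * l %| q.+1) else 2 * l %| q.-1).

Definition upper_primes (m : nat) : seq nat := [seq q <- iota m.+2 m.-1 | prime q].

Definition unsplit_primes (plus : bool) (l p : nat) (s : seq nat) : seq nat :=
  [seq q <- s | ~~ splits plus l q && (q != p)].

Definition prod_N (s : seq nat) : N :=
  foldr (fun q => BinNat.N.mul (BinNat.N.of_nat q)) (BinNat.N.of_nat 1) s.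

Definition product_ok (a : nat) (plus : bool) (l p : nat) (s : seq nat) : bool :=
  BinNat.N.leb (BinNat.N.pow (BinNat.N.of_nat 2) (BinNat.N.of_nat a))
    (prod_N (unsplit_primes plus l p s)).

Definition window_ok (ls : seq nat) (m : nat) : bool :=
  let s := upper_primes m in
  let a5 := (m.*2 + 7) %/ 5 in let a3 := (m.*2 + 4) %/ 3 in
  [&& all (fun l => product_ok a5 true l l s && product_ok a5 false l l s) ls,
      product_ok a3 true 9 3 s & product_ok a3 false 9 3 s].

Definition small_indices : seq nat := Eval vm_compute in 128 :: [seq l <- iota 5 123 | prime l].

Lemma windows15_ok : all (window_ok small_indices) (iota 15 49).
Proof. by vm_compute. Qed.
Lemma prod_NE (s : seq nat) : BinNat.N.to_nat (prod_N s) = \prod_(q <- s) q.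
Proof.
elim: s => [|q s IH]; first by rewrite big_nil.
by rewrite big_cons /= Nnat.N2Nat.inj_mul Nnat.Nat2N.id -IH.
Qed.

Lemma product_okP (a : nat) (plus : bool) (l p : nat) (s : seq nat) :
  product_ok a plus l p s -> 2 ^ a <= \prod_(q <- unsplit_primes plus l p s) q.
Proof.
rewrite -prod_NE => /BinNat.N.leb_le/N_le_to_nat.
by rewrite N_pow2 Nnat.Nat2N.id.
Qed.

Lemma splitsE (N : int) (l q : nat) : 1 < q ->
  splits (N == 1%R) l q = (q \in splitting_primes N l).
Proof.
move=> q1; apply/idP/idP; first by case/andP; rewrite inE.
by move=> h; rewrite /splits -mul2n (splitting_primes_large q1 h); rewrite inE in h.
Qed.

Lemma unsplit_large (plus : bool) (l m : nat) : m < 64 -> 128 <= l ->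
  unsplit_primes plus l l (upper_primes m) = unsplit_primes plus 128 128 (upper_primes m).
Proof.
move=> m64 l128; apply: eq_in_filter => q; rewrite mem_filter mem_iota => /andP[_ /andP[_ qm]].
have ql : q < 128 by clear -qm m64; lia.
rewrite /splits ![_ <= q]leqNgt !ltn_neqAle.
have -> : (q != l) by rewrite neq_ltn (leq_trans ql l128).
have -> : (q != 128) by rewrite neq_ltn ql.
have e k : 128 <= k -> (k.*2 <= q) = false by move=> h; apply/negbTE; clear -h ql; lia.
by rewrite -!ltn_neqAle -!leqNgt !e.
Qed.

(* The primes between m + 1 and 2m that do not divide the cofactor Q all divide P. *)
Lemma unsplit_dvd (N : int) (P p e P' Q m T : nat) : lucas_ok N P -> prime p -> odd p ->
  (lucas P%:Z N (p ^ e)%N = P'%:Z)%R -> (lucas P%:Z N (p ^ e.+1)%N = (P' * Q)%N%:Z)%R ->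
  (Q%:Z = cofactor P'%:Z N p./2)%R -> T = catalan m \/ T = central_binom m ->
  T %| P' * Q -> 
  \prod_(q <- unsplit_primes (N == 1%R) (p ^ e.+1) p (upper_primes m)) q %| P'.
Proof.
move=> hP pp op P'E VE QE hT TV; apply: prod_primes_dvdn.
- by rewrite !filter_uniq // iota_uniq.
- by apply/allP => q; rewrite !mem_filter => /andP[_ /andP[]].
apply/allP => q; rewrite !mem_filter mem_iota => /andP[/andP[nsp qp] /andP[pq /andP[mq qm]]].
rewrite splitsE ?prime_gt1 // in nsp.
have qB : q %| central_binom m.
  apply: dvdn_central_binom => //; first by clear -qm mq; lia.
  by rewrite (@divn_between 1) //; clear -qm mq; lia.
have qT : q %| T.
  case: hT => -> //; move: qB; rewrite -catalan_mul Euclid_dvdM // => /orP[/dvdn_leq|//].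
  by move=> h; have := h isT; clear -mq; lia.
have := dvdn_trans qT TV; rewrite Euclid_dvdM // => /orP[//|qQ].
case: (cofactor_prime_factor hP pp op P'E VE QE pq qQ) => [q2|[q_p _]|qA].
- by move: mq; rewrite q2; case: (m) qm => // ; rewrite q2.
- by rewrite q_p eqxx in qp.
by rewrite qA in nsp.
Qed.

Lemma lucas_mid (N : int) (P p e V m T : nat) : lucas_ok N P -> good_index p e ->
  (lucas P%:Z N (p ^ e.+1)%N = V%:Z)%R -> T = catalan m \/ T = central_binom m ->
  V = T \/ V = 2 * T -> 15 <= m -> m < 64 -> False.
Proof.
move=> hP hpe VE hT hV m15 m64.
have op : odd p.
  case: hpe => [[pp [p5 _]]|[-> _] //].
  by case: (even_prime pp) p5 => [->|].
have pp : prime p by case: hpe => [[]|[->]].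
have [P' [Q [hP' P'E VE' Q0 QE]]] := lucas_split e hP op.
have VPQ : V = P' * Q by move: VE; rewrite VE'; clear; lia.
have [T0 TB BT] := catalan_or_binom_dvd hT.
have P'0 : 0 < P' by case: (P') VPQ T0 hV => // -> T0; case; clear -T0; lia.
have TV : T %| P' * Q by rewrite -VPQ; case: hV => -> //; apply: dvdn_mull.
have W_le := dvdn_leq P'0 (unsplit_dvd hP pp op P'E VE' QE hT TV).
have V_le : V <= 4 * 4 ^ m.-1.
  apply: (@leq_trans (2 * T)); first by case: hV => ->; rewrite ?leq_pmull.
  apply: (@leq_trans (2 * (2 * 4 ^ m.-1))); last by rewrite mulnA.
  rewrite leq_mul2l; apply/orP; right.
  have := dvdn_leq (central_binom_gt0 m) TB; move/leq_trans; apply.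
  by have := central_binomS_le m.-1; rewrite prednK // (leq_trans _ m15).
have := allP windows15_ok m; rewrite mem_iota m15 /= => /(_ m64).
rewrite /window_ok; set s := upper_primes m; case/and3P=> w5 w9 w9'.
have m0 : 0 < m by apply: leq_trans m15.
have e4 : 4 ^ m.-1 = 2 ^ (m.-1).*2 by rewrite -mul2n expnM.
case: hpe => [[_ [p5 e0]]|[p3 e1]].
  rewrite e0 expn0 in P'E VE' W_le.
  have PP : P' = P by move: P'E => /=; clear; lia.
  rewrite PP in VPQ VE' W_le; rewrite expn1 in VE' W_le.
  have P_ge := prime_cofactor_ge hP p5 VE'.
  have aP : 2 ^ ((m.*2 + 7) %/ 5) <= P.
    apply: leq_trans W_le; apply: product_okP.
    have [p128|p128] := leqP 128 p.
      rewrite /product_ok (unsplit_large _ m64 p128).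
      by move: w5 => /andP[/andP[]]; case: (N == 1%R).
    have : p \in small_indices.
      have -> : small_indices = 128 :: [seq l <- iota 5 123 | prime l] by vm_compute.
      by rewrite inE mem_filter pp mem_iota p5 p128 orbT.
    by move/(allP w5) => /andP[]; case: (N == 1%R).
  suff : 16 * 2 ^ (m.*2 + 3) <= 81 * (4 * 2 ^ (m.-1).*2).
    have -> : m.*2 + 3 = 5 + (m.-1).*2 by clear -m0; lia.
    by rewrite expnD !mulnA leq_mul2r expn_eq0.
  apply: (@leq_trans (16 * P ^ 5)).
    rewrite leq_mul2l; apply/orP; right.
    apply: (@leq_trans ((2 ^ ((m.*2 + 7) %/ 5)) ^ 5)); last by rewrite leq_exp2r.
    by rewrite -expnM leq_exp2l //; clear; lia.
  rewrite -e4; apply: (@leq_trans (81 * V)); last by rewrite leq_mul2l.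
  by rewrite VPQ [P * Q]mulnC mulnA expnSr mulnA leq_mul2r P_ge orbT.
rewrite p3 e1 in W_le QE.
have P_ge : 4 * P' ^ 2 <= 9 * Q := nine_cofactor_ge hP' QE.
have aP : 2 ^ ((m.*2 + 4) %/ 3) <= P'.
  apply: leq_trans W_le; apply: product_okP.
  by move: w9 w9'; case: (N == 1%R).
suff : 4 * 2 ^ (m.*2 + 2) <= 9 * (4 * 2 ^ (m.-1).*2).
  have -> : m.*2 + 2 = 4 + (m.-1).*2 by clear -m0; lia.
  by rewrite expnD !mulnA leq_mul2r expn_eq0.
apply: (@leq_trans (4 * P' ^ 3)).
  rewrite leq_mul2l; apply/orP; right.
  apply: (@leq_trans ((2 ^ ((m.*2 + 4) %/ 3)) ^ 3)); last by rewrite leq_exp2r.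
  by rewrite -expnM leq_exp2l //; clear; lia.
rewrite -e4; apply: (@leq_trans (9 * V)); last by rewrite leq_mul2l.
by rewrite VPQ [P' * Q]mulnC mulnA expnSr mulnA leq_mul2r P_ge orbT.
Qed.

(** * P28 *)

Fixpoint avoid_run (n : nat) (plus : bool) (L : seq N) (bound P a b : N) (o : bool) : bool :=
  BinNat.N.ltb bound a ||
  if n is n1.+1 then
    (o ==> ~~ has (BinNat.N.eqb a) L) &&
    avoid_run n1 plus L bound P b
      (if plus then BinNat.N.sub (BinNat.N.mul P b) a else BinNat.N.add (BinNat.N.mul P b) a) (~~ o)
  else false.

Definition lucas_N (plus : bool) (P : N) (k : nat) : N * N :=
  iter k (fun ab : N * N => (ab.2, if plus then BinNat.N.sub (BinNat.N.mul P ab.2) ab.1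
    else BinNat.N.add (BinNat.N.mul P ab.2) ab.1)) (BinNat.N.of_nat 2, P).

Fixpoint target_list (n m : nat) (B : N) : seq N :=
  if n is n1.+1 then
    let C := BinNat.N.div B (BinNat.N.of_nat m.+1) in
    [:: B, BinNat.N.double B, C, BinNat.N.double C & target_list n1 m.+1 (binom_next (BinNat.N.of_nat m) B)]
  else [::].

Definition avoid_ok (plus : bool) (L : seq N) (bound : N) (P : nat) : bool :=
  let ab := lucas_N plus (BinNat.N.of_nat P) 5 in
  avoid_run 40 plus L bound (BinNat.N.of_nat P) ab.1 ab.2 (odd 5).

Definition targets15 : seq N := Eval vm_compute in target_list 15 0 (BinNat.N.of_nat 1).

Definition bound15 : N := Eval vm_compute in foldr BinNat.N.max BinNums.N0 targets15.

Lemma avoid15_ok : all (avoid_ok true targets15 bound15) (iota 3 51) &&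
  all (avoid_ok false targets15 bound15) (iota 1 53).
Proof. by vm_compute. Qed.

(* a : N represents the k-th term *)
Definition is_term (N : int) (P k : nat) (a : BinNums.N) : Prop :=
  (lucas P%:Z N k = (BinNat.N.to_nat a)%:Z)%R.

Lemma is_term_step (N : int) (P k : nat) (a b : BinNums.N) : lucas_ok N P ->
  is_term N P k a -> is_term N P k.+1 b ->
  is_term N P k.+2 (if N == 1%R then BinNat.N.sub (BinNat.N.mul (BinNat.N.of_nat P) b) a
                    else BinNat.N.add (BinNat.N.mul (BinNat.N.of_nat P) b) a).
Proof.
move=> hP aE bE; have [V0 _] := lucas_increasing k.+1 hP; move: V0.
rewrite /is_term (lucasSS _ _ k) aE bE; case: hP => -[-> _].
  rewrite eqxx Nnat.N2Nat.inj_sub Nnat.N2Nat.inj_mul Nnat.Nat2N.id.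
  move: (BinNat.N.to_nat a) (BinNat.N.to_nat b) => x y h.
  have e : (P%:Z * y%:Z = (P * y)%N%:Z)%R by rewrite PoszM.
  rewrite e in h *; change (Nat.mul P y) with (P * y).
  by move: (P * y) h => z h; clear -h; lia.
rewrite (_ : ((-1)%R == 1%R) = false) // => _.
rewrite Nnat.N2Nat.inj_add Nnat.N2Nat.inj_mul Nnat.Nat2N.id.
move: (BinNat.N.to_nat a) (BinNat.N.to_nat b) => x y.
by rewrite PoszD PoszM mulN1r opprK.
Qed.

Lemma is_term_lucas_N (N : int) (P k : nat) : lucas_ok N P ->
  let ab := lucas_N (N == 1%R) (BinNat.N.of_nat P) k in
  is_term N P k ab.1 /\ is_term N P k.+1 ab.2.
Proof.
move=> hP; elim: k => [|k [IH1 IH2]].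
  by rewrite /is_term /= Nnat.Nat2N.id.
by split; [exact: IH2 | exact: is_term_step hP IH1 IH2].
Qed.

Lemma avoid_runP (N : int) (P n k j v : nat) (L : seq BinNums.N) (bound a b : BinNums.N) :
  lucas_ok N P -> 0 < k -> all (fun x => BinNat.N.leb x bound) L ->
  is_term N P k a -> is_term N P k.+1 b ->
  avoid_run n (N == 1%R) L bound (BinNat.N.of_nat P) a b (odd k) ->
  odd (k + j) -> (lucas P%:Z N (k + j) = v%:Z)%R -> ~~ has (BinNat.N.eqb (BinNat.N.of_nat v)) L.
Proof.
move=> hP k0 /allP Lb; elim: n k j a b k0 => [|n IH] k j a b k0 aE bE /=.
  rewrite orbF => ba _ vE; apply/negP => /hasP[x xL vx].
  have := @lucas_le N P k (k + j) hP; rewrite k0 leq_addr aE vE => /(_ isT).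
  by move: (Lb x xL) vx ba; clear; lia.
case/orP=> [ba _ vE|/andP[nh run] okj vE].
  apply/negP => /hasP[x xL vx].
  have := @lucas_le N P k (k + j) hP; rewrite k0 leq_addr aE vE => /(_ isT).
  by move: (Lb x xL) vx ba; clear; lia.
case: j okj vE => [|j] okj vE.
  rewrite addn0 in okj vE; rewrite okj /= in nh.
  have -> : BinNat.N.of_nat v = a by move: vE; rewrite aE; clear; lia.
  exact: nh.
rewrite addnS -addSn in okj vE.
exact: (IH k.+1 j b _ isT bE (is_term_step hP aE bE) run okj vE).
Qed.

Lemma target_listP (m n T : nat) (r : nat) (B : BinNums.N) : B = BinNat.N.of_nat (central_binom m) ->
  m <= n < m + r -> T = catalan n \/ T = central_binom n ->
  has (BinNat.N.eqb (BinNat.N.of_nat T)) (target_list r m B) /\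
  has (BinNat.N.eqb (BinNat.N.of_nat (2 * T))) (target_list r m B).
Proof.
move=> + + hT; elim: r m B => [|r IH] m B BE /andP[mn nm].
  by move: nm; rewrite addn0 ltnNge mn.
have eqb x y : x = y -> BinNat.N.eqb (BinNat.N.of_nat x) (BinNat.N.of_nat y).
  by move=> ->; apply/BinNat.N.eqb_eq.
have dblE x : BinNat.N.double (BinNat.N.of_nat x) = BinNat.N.of_nat (2 * x) by clear; lia.
case: (ltngtP m n) mn => [lt _|//|mn _].
  have [] := IH m.+1 (binom_next (BinNat.N.of_nat m) B).
  - by rewrite BE binom_nextE.
  - by rewrite lt addSnnS.
  by move=> h1 h2; split; rewrite /= ?h1 ?h2 !orbT.
rewrite /target_list -/target_list BE N_div_nat -[central_binom m %/ m.+1]/(catalan m) !dblE /=.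
case: hT => ->; rewrite -mn !(eqb _ _ erefl) ?orbT //.
Qed.

Lemma targets15E : targets15 = target_list 15 0 (BinNat.N.of_nat 1).
Proof. by vm_compute. Qed.

Lemma targets15_le : all (fun x => BinNat.N.leb x bound15) targets15.
Proof. by vm_compute. Qed.

Definition fifth (x : BinNums.N) : BinNums.N :=
  BinNat.N.mul x (BinNat.N.mul x (BinNat.N.mul x (BinNat.N.mul x x))).

Lemma bound15_fifth : BinNat.N.leb (BinNat.N.mul (BinNat.N.of_nat 16) (fifth (BinNat.N.of_nat 54)))
  (BinNat.N.mul (BinNat.N.of_nat 81) bound15) = false.
Proof. by vm_compute. Qed.

Lemma lucas_small_bound (N : int) (P k V : nat) : lucas_ok N P -> 4 < k ->
  (lucas P%:Z N k = V%:Z)%R -> BinNat.N.le (BinNat.N.of_nat V) bound15 -> P < 54.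
Proof.
move=> hP k5 VE; move: bound15 bound15_fifth => bd bdE Vb.
rewrite ltnNge; apply/negP => P54.
have [Q [Q0 QE]] := lucas_nat hP (isT : 0 < 5).
have QV : Q <= V by have := @lucas_le N P 5 k hP k5; rewrite QE VE.
have [P' [Q' [_ P'E VE' _ _]]] := lucas_split 0 hP (isT : odd 5).
have PP : P' = P by move: P'E => /=; clear; lia.
rewrite PP in VE'.
have h := prime_cofactor_ge hP (isT : 5 <= 5) VE'.
have QPQ : Q = P * Q' by move: QE; rewrite VE'; clear; lia.
have {}h : 16 * (P * (P * (P * (P * P)))) <= 81 * V.
  apply: (@leq_trans (81 * Q)); last by rewrite leq_mul2l QV.
  have -> : 81 * Q = P * (81 * Q') by rewrite QPQ mulnCA.
  by rewrite [leqLHS]mulnCA leq_mul2l h orbT.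
have {}h : BinNat.N.le (BinNat.N.mul (BinNat.N.of_nat 16) (fifth (BinNat.N.of_nat P)))
    (BinNat.N.mul (BinNat.N.of_nat 81) (BinNat.N.of_nat V)) by rewrite /fifth; clear -h; lia.
have h5 : BinNat.N.le (fifth (BinNat.N.of_nat 54)) (fifth (BinNat.N.of_nat P)).
  have p54 : BinNat.N.le (BinNat.N.of_nat 54) (BinNat.N.of_nat P) by clear -P54; lia.
  by rewrite /fifth; do 4?[apply: BinNat.N.mul_le_mono => //].
have {}h := BinNat.N.le_trans _ _ _ (BinNat.N.mul_le_mono_l _ _ (BinNat.N.of_nat 16) h5) h.
have := BinNat.N.le_trans _ _ _ h (BinNat.N.mul_le_mono_l _ _ (BinNat.N.of_nat 81) Vb).
by move=> /BinNat.N.leb_le; rewrite bdE.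
Qed.

Lemma mem_targets15 (m T : nat) : m < 15 -> T = catalan m \/ T = central_binom m ->
  has (BinNat.N.eqb (BinNat.N.of_nat T)) targets15 /\
  has (BinNat.N.eqb (BinNat.N.of_nat (2 * T))) targets15.
Proof.
move=> m15 hT; rewrite targets15E.
apply: (@target_listP 0 m T 15 (BinNat.N.of_nat 1) _ m15 hT).
by rewrite /central_binom bin0.
Qed.

Lemma avoid15P (N : int) (P : nat) : lucas_ok N P -> P < 54 ->
  avoid_ok (N == 1%R) targets15 bound15 P.
Proof.
move=> hP P54; have [/allP h1 /allP h2] := andP avoid15_ok.
case: hP => -[-> P0].
  by rewrite eqxx; apply: h1; rewrite mem_iota P0 P54.
by rewrite (_ : ((-1)%R == 1%R) = false) //; apply: h2; rewrite mem_iota P0 P54.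
Qed.

Lemma avoid_okP (N : int) (P k V : nat) (L : seq BinNums.N) (bound : BinNums.N) : lucas_ok N P ->
  all (fun x => BinNat.N.leb x bound) L ->
  avoid_ok (N == 1%R) L bound P -> odd k -> 4 < k -> (lucas P%:Z N k = V%:Z)%R ->
  ~~ has (BinNat.N.eqb (BinNat.N.of_nat V)) L.
Proof.
move=> hP Lb; have [aE bE] := is_term_lucas_N 5 hP.
rewrite /avoid_ok => run ok k5; rewrite -(subnKC k5) in ok *.
exact: (avoid_runP hP (isT : 0 < 5) Lb aE bE run ok).
Qed.

Lemma lucas_small (N : int) (P k V m T : nat) : lucas_ok N P -> odd k -> 4 < k ->
  (lucas P%:Z N k = V%:Z)%R -> T = catalan m \/ T = central_binom m ->
  V = T \/ V = 2 * T -> m < 15 -> False.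
Proof.
move=> hP ok k5 VE hT hV m15.
have [tT t2T] := mem_targets15 m15 hT.
have inL : has (BinNat.N.eqb (BinNat.N.of_nat V)) targets15 by case: hV => ->.
have P54 : P < 54.
  apply: (lucas_small_bound hP k5 VE).
  have /hasP[x xL /BinNat.N.eqb_eq ->] := inL.
  by apply/BinNat.N.leb_le; apply: (allP targets15_le).
by have := avoid_okP hP targets15_le (avoid15P hP P54) ok k5 VE; rewrite inL.
Qed.

(** * P29 *)

Lemma odd_index_factor (k : nat) : odd k -> 4 < k ->
  exists j p e, [/\ odd j, good_index p e & k = p ^ e.+1 * j].
Proof.
move=> ok k5; have k0 : 0 < k by apply: leq_trans k5.
have [/hasP[p]|no5] := boolP (has (fun p => 4 < p) (primes k)).
  rewrite mem_primes => /and3P[pp _ /dvdnP[j kE]] p5.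
  exists j, p, 0; rewrite expn1 mulnC kE; split=> //; last by left.
  by move: ok; rewrite kE oddM => /andP[].
have k3 : (3 : nat_pred).-nat k.
  apply/pnatP => // q pq qk; have := dvdn_odd qk ok; move: (hasPn no5 q).
  rewrite mem_primes pq k0 qk => /(_ isT); rewrite -leqNgt.
  by move: pq; case: q {qk} => [|[|[|[|[]]]]].
have [[|[|a]] kE] := p_natP k3; rewrite kE // in ok k5 *.
exists (3 ^ a), 3, 1; rewrite -expnD add2n; split=> //; last by right.
by rewrite oddX orbT.
Qed.

Lemma lucas_odd_neq (N : int) (P k V m T : nat) : lucas_ok N P -> odd k -> 4 < k ->
  (lucas P%:Z N k = V%:Z)%R -> T = catalan m \/ T = central_binom m ->
  V = T \/ V = 2 * T -> False.
Proof.
move=> hP ok k5 VE hT hV.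
have [m15|m15] := ltnP m 15; first exact: lucas_small hP ok k5 VE hT hV m15.
have [j [p [e [oj hpe kE]]]] := odd_index_factor ok k5.
have [P1 [P1_0 P1E]] := lucas_nat hP (odd_gt0 oj).
have [hP1 NE] := lucas_ok_iter hP oj P1E; rewrite NE in hP1.
rewrite kE lucasM P1E NE in VE.
have [m64|m64] := ltnP m 64; first exact: lucas_mid hP1 hpe VE hT hV m15 m64.
exact: lucas_large hP1 hpe VE hT hV m64.
Qed.

(** * P30 *)
Local Open Scope ring_scope.

Module RealLog.
Import Stdlib.Reals.Reals.

Definition lg (n : nat) : R := (ln (INR n) / ln 2)%R.

Lemma ln2_gt0 : Rlt 0 (ln 2).
Proof. by rewrite -ln_1; apply: ln_increasing; [exact: Rlt_0_1 | exact: (Rlt_plus_1 1)]. Qed.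

Lemma INR_gt0 (n : nat) : is_true (leq 1 n) -> Rlt 0 (INR n).
Proof. by move=> n0; apply: lt_0_INR; apply/ssrnat.ltP. Qed.

Lemma lg_is_log : is_log lg.
Proof.
split.
- move=> m n m0 n0; rewrite /lg mult_INR ln_mult; try exact: INR_gt0.
  by rewrite /Rdiv Rmult_plus_distr_r.
- move=> m n m0 mn; apply/RleP; apply: Rmult_le_compat_r.
    by apply: Rlt_le; apply: Rinv_0_lt_compat; exact: ln2_gt0.
  have [<-|lt] := Nat.eq_dec m n; first exact: Rle_refl.
  apply: Rlt_le; apply: ln_increasing; first exact: INR_gt0.
  by apply: lt_INR; move/ssrnat.leP: mn; clear -lt; lia.
by rewrite /lg; apply: Rinv_r; apply: Rgt_not_eq; exact: ln2_gt0.
Qed.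
End RealLog.

(** * P31 *)

Lemma pell4_lucas_ok (e d N b : int) (a : nat) : 1 < d -> pell4 e d N a%:Z b -> lucas_ok N a.
Proof.
move=> d1 [a0 b0 hN E _]; case: hN E => -> E; [left|right]; split=> //.
have : 2 * 1 <= d * b ^+ 2 by apply: ler_pM => //; clear -d1 b0; nia.
move: E; move: (d * b ^+ 2) => z; case: (a) a0 => [|[|[|n]]] //= _; clear; lia.
Qed.

Lemma pell4_lucas (e d n x y : int) : e = 1 \/ e = 2 -> 1 < d -> pell4 e d n x y ->
  exists (N : int) (a : nat) (b : int), [/\ lucas_ok N a, pell4 e d N a%:Z b &
    forall n' x' y', pell4 e d n' x' y' -> exists k, x' = lucas a%:Z N k.+1].
Proof.
move=> he d1 sx.
suff [N [a [b [sa amin]]]] : exists (N : int) (a : nat) (b : int), pell4 e d N a%:Z b /\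
    forall n' x' y', pell4 e d n' x' y' -> a%:Z <= x'.
  exists N, a, b; split=> //; first exact: pell4_lucas_ok d1 sa.
  by move=> n' x' y'; apply: pell4_structure he d1 sa amin.
have [v vE] : exists v : nat, x = v%:Z by case: sx => x0 *; exists (absz x); clear -x0; lia.
rewrite {}vE in sx; elim/ltn_ind: v n y sx => v IH n y sx.
have [[n' [x' [y' [sx' xv]]]]|nosmall] :=
    Classical_Prop.classic (exists n' x' y', pell4 e d n' x' y' /\ x' < v%:Z).
  have [w wE] : exists w : nat, x' = w%:Z by case: sx' => x0 *; exists (absz x'); clear -x0; lia.
  by rewrite wE in sx' xv; apply: (IH w _ n' y' sx').
exists n, v, y; split=> // n' x' y' sx'; rewrite leNgt; apply/negP => xv.
by apply: nosmall; exists n', x', y'.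
Qed.

Lemma lucas_lt (N : int) (P i j : nat) : lucas_ok N P -> (i < j)%N ->
  lucas P%:Z N i.+1 < lucas P%:Z N j.+1.
Proof.
move=> hP ij; case: (lucas_increasing i hP) => _ /lt_le_trans; apply.
by apply: lucas_le; rewrite // ltnS.
Qed.

Lemma lucas_term_two (N : int) (P j : nat) : lucas_ok N P -> lucas P%:Z N j.+1 = 2 ->
  N = -1 /\ j = 0%N /\ P = 2%N.
Proof.
move=> hP; case: j => [|j] E.
  by case: hP => -[NE P0]; move: E => /=; [clear -P0; lia | rewrite NE; clear; lia].
have : lucas P%:Z N 2 <= 2 by rewrite -E; apply: lucas_le.
by rewrite /=; case: hP => -[-> P0] /=; clear -P0; nia.
Qed.

Lemma lucas_term_four (N : int) (P j : nat) : lucas_ok N P -> lucas P%:Z N j.+1 = 4 ->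
  N ^+ j.+1 = 1 -> N = 1 /\ j = 0%N /\ P = 4%N.
Proof.
move=> hP E Nj; case: hP (hP) => -[NE P0] hP.
  case: j E {Nj} => [|j] E; first by move: E => /=; clear -NE; lia.
  have : lucas P%:Z N 2 <= 4 by rewrite -E; apply: lucas_le.
  by rewrite /= NE; clear -P0; nia.
case: j E Nj => [|[|[|j]]] E Nj; rewrite NE ?expr1 // in Nj.
- by move: E; rewrite /= NE; case: (P) P0 => [|[|p]] // _; clear; nia.
have : lucas P%:Z N 4 <= 4 by rewrite -E; apply: lucas_le.
have -> : lucas P%:Z N 4 = P%:Z ^+ 4 + 4 * P%:Z ^+ 2 + 2 by rewrite /= NE; ring.
have : 1 <= P%:Z ^+ 2 by clear -P0; nia.
have -> : P%:Z ^+ 4 = P%:Z ^+ 2 * P%:Z ^+ 2 by ring.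
by move: (P%:Z ^+ 2) => x; clear; nia.
Qed.

Lemma lucas_even_target (N : int) (P j T m : nat) : lucas_ok N P ->
  lucas P%:Z N (2 * j.+1)%N = T%:Z -> T = catalan m \/ T = central_binom m ->
  [/\ j = 0%N, N = -1, P = 2%N & T = central_binom 2] \/
  [/\ j = 0%N, N = 1, P = 4%N & T = catalan 4].
Proof.
move=> hP E hT; have [w [w0 wE]] := lucas_nat hP (ltn0Sn j).
have hN : N ^+ j.+1 = 1 \/ N ^+ j.+1 = -1.
  case: hP => -[-> _]; first by rewrite expr1n; left.
  by rewrite -signr_odd; case: (odd _); [right | left].
have w0' : 0 < w%:Z by [].
have E2 : w%:Z ^+ 2 - 2 * N ^+ j.+1 = T%:Z.
  by rewrite -E lucasM wE /=; ring.
case: (square_sub_two_target w0' hN E2 hT) => [[w2 Nj]|[w2 Nj TE]|[w4 Nj TE]].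
- rewrite w2 in wE; have [NE [j0 P2]] := lucas_term_two hP wE.
  by rewrite NE j0 in Nj.
- rewrite w2 in wE; have [NE [j0 P2]] := lucas_term_two hP wE.
  by left.
rewrite w4 in wE; have [NE [j0 P4]] := lucas_term_four hP wE Nj.
by right.
Qed.

Lemma pell4_double (d N b : int) (a : nat) : lucas_ok N a -> pell4 1 d N a%:Z b ->
  pell4 1 d 1 (lucas a%:Z N 2) (a%:Z * b).
Proof.
move=> hP [a0 b0 hN E _]; split.
- by case: (lucas_increasing 1 hP).
- by rewrite mulr_gt0.
- by left.
- rewrite /=; transitivity (a%:Z ^+ 2 * (a%:Z ^+ 2 - d * b ^+ 2 - 4 * N) + 4 * N ^+ 2); first by ring.
  by rewrite E subrr mulr0 add0r; case: hN => ->.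
by split; [exists (lucas a%:Z N 2) | exists (a%:Z * b)]; rewrite mul1r.
Qed.

Lemma pell_solution4P (d x y : nat) :
  pell_solution 4 d x y <-> exists n, pell4 1 d%:Z n x%:Z y%:Z.
Proof.
split=> [[x0 y0 E]|[n [x0 y0 hn E _]]].
  have hxy : (exists x0 : int, x%:Z = 1 * x0) /\ (exists y0 : int, y%:Z = 1 * y0).
    by split; [exists x%:Z | exists y%:Z]; rewrite mul1r.
  by case: E => E; [exists 1 | exists (-1)]; split=> //; [left | right].
by split=> //; case: hn => nE; rewrite nE in E; [left | right]; rewrite E.
Qed.

Lemma pell_solution1P (d x y : nat) : pell_solution 1 d x y ->
  exists n, pell4 2 d%:Z n (2 * x)%N%:Z (2 * y)%N%:Z.
Proof.
case=> x0 y0 E.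
have hxy : (exists x0 : int, (2 * x)%N%:Z = 2 * x0) /\ (exists y0 : int, (2 * y)%N%:Z = 2 * y0).
  by split; [exists x%:Z | exists y%:Z]; rewrite PoszM.
have e2 : (2 * x)%N%:Z ^+ 2 - d%:Z * (2 * y)%N%:Z ^+ 2 = 4 * (x%:Z ^+ 2 - d%:Z * y%:Z ^+ 2).
  by rewrite !PoszM; ring.
have [x2 y2] : 0 < (2 * x)%N%:Z /\ 0 < (2 * y)%N%:Z by rewrite !ltz_nat !muln_gt0.
by case: E => E; [exists 1 | exists (-1)]; split=> //; [left | rewrite e2 E | right | rewrite e2 E].
Qed.

(* The first three terms are numbered 1, 2, 3. *)
Lemma nth_pair_index (d n k a b W Z : nat) (N : int) : (1 < d)%N -> lucas_ok N a ->
  pell4 1 d%:Z N a%:Z b%:Z ->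
  (forall n' x' y', pell4 1 d%:Z n' x' y' -> exists k, x' = lucas a%:Z N k.+1) ->
  nth_pair (pell_solution 4 d) n W Z -> W%:Z = lucas a%:Z N k.+1 -> (k <= 2)%N -> n = k.+1.
Proof.
move=> d1 hP sa cls [_ [s [us sE ->]]] WE k2.
have [v [v0 vE]] := lucas_nat hP (isT : (0 < 2)%N).
have sv : pell4 1 d%:Z 1 v%:Z (a * b)%N%:Z by rewrite -vE PoszM; apply: pell4_double.
have d1' : 1 < d%:Z by [].
pose L := take k [:: (a, b); (v, (a * b)%N)].
have av : (a < v)%N by rewrite -ltz_nat -vE; exact: (lucas_lt hP (ltn0Sn 0)).
have uL : uniq L.
  apply: take_uniq; rewrite /= inE andbT; apply/eqP => -[av' _].
  by rewrite av' ltnn in av.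
have aE : a%:Z = lucas a%:Z N 1 by [].
have sL : size L = k by rewrite size_takel.
congr (_.+1); rewrite -sL; apply: perm_size; apply: uniq_perm => // -[x y].
apply/idP/idP.
  move/(sE (x, y)).1 => [/pell_solution4P[n' sxy] /= xW].
  have [j xE] := cls _ _ _ sxy.
  have jk : (j < k)%N.
    rewrite ltnNge; apply/negP => kj; move: xW; rewrite -ltz_nat WE xE ltNge.
    by rewrite (lucas_le hP) // ltnS.
  case: j xE jk => [|[|j]] xE jk.
  - rewrite -aE in xE; rewrite xE in sxy; have [_ yb] := pell4_y_unique d1' sxy sa.
    have -> : (x, y) = (a, b) by case: xE => ->; case: yb => ->.
    by rewrite /L; case: (k) jk => // k' _; rewrite inE eqxx.
  - rewrite vE in xE; rewrite xE in sxy; have [_ yb] := pell4_y_unique d1' sxy sv.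
    have -> : (x, y) = (v, (a * b)%N) by case: xE => ->; case: yb => ->.
    by rewrite /L; case: (k) jk => [|[|k']] // _; rewrite !inE eqxx orbT.
  by move: (leq_trans jk k2).
have memL : (x, y) \in L -> exists2 j, (j < k)%N & x%:Z = lucas a%:Z N j.+1 /\
    exists n', pell4 1 d%:Z n' x%:Z y%:Z.
  rewrite /L; case: (k) k2 => [|[|[|k']]] // _ /=; rewrite ?inE.
    by move=> /eqP[-> ->]; exists 0%N => //; split=> //; exists N.
  case/orP=> /eqP[-> ->]; [exists 0%N => //; split=> //; exists N|].
    by [].
  by exists 1%N => //; split; [rewrite -vE | exists 1].
move=> /memL[j jk [xE sxy]]; apply/(sE (x, y)).2; split; first exact/pell_solution4P.
by rewrite /= -ltz_nat WE xE; apply: lucas_lt.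
Qed.

(** * P32 *)

Lemma lucas_parity (N : int) (a0 : int) (k : nat) :
  exists w : int, lucas (2 * a0) N k = 2 * w.
Proof.
suff [] : (exists w, lucas (2 * a0) N k = 2 * w) /\ (exists w, lucas (2 * a0) N k.+1 = 2 * w) by [].
elim: k => [|k [[u uE] [v vE]]]; first by split; [exists 1 | exists a0].
split; first by exists v.
by exists (2 * a0 * v - N * u); rewrite lucasSS uE vE; ring.
Qed.

(* The equation with right-hand sides 1 and -1. *)
Lemma pell1_target_index (d n X Y m : nat) : (1 < d)%N ->
  nth_pair (pell_solution 1 d) n X Y -> X = catalan m \/ X = central_binom m -> n = 1%N.
Proof.
move=> d1 [sXY [s [us sE ->]]] hX.
have d1' : 1 < d%:Z by [].
have [n0 s2] := pell_solution1P sXY.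
have [N [a [b [hP sa cls]]]] := pell4_lucas (or_intror erefl) d1' s2.
have hN : N = 1 \/ N = -1 by case: hP => -[]; [left | right].
have [X0 _ _] := sXY.
have [a0 aE] : exists a0 : nat, a = (2 * a0)%N.
  by case: sa => _ _ _ _ [[a0 aE] _]; exists (absz a0); move: aE; clear; lia.
have [k kE] := cls _ _ _ s2.
have k0 : k = 0%N.
  have [ok|ek] := boolP (odd k.+1); last first.
    have [j jE] : exists j, k.+1 = (2 * j.+1)%N.
      by exists (k.+1./2).-1; have := odd_double_half k.+1; rewrite (negbTE ek); clear; lia.
    have [w wE] : exists w, lucas a%:Z N j.+1 = 2 * w.
      by rewrite aE PoszM; apply: lucas_parity.
    have hNj : N ^+ j.+1 = 1 \/ N ^+ j.+1 = -1.
      case: hN => ->; first by rewrite expr1n; left.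
      by rewrite -signr_odd; case: (odd _); [right | left].
    have E : (2 * w) ^+ 2 - 2 * N ^+ j.+1 = (2 * X)%N%:Z.
      by rewrite kE jE lucasM wE /=; ring.
    have XE : X%:Z = 2 * w ^+ 2 - N ^+ j.+1 by rewrite PoszM in E; move: E; rewrite exprMn; clear; lia.
    have oX : odd X by move: XE; move: (w ^+ 2) => x XE; clear -XE hNj; lia.
    have X1 : X = 1%N.
      apply: (odd_target_eq1 _ (odd_divisors_square_sub_two hNj E) oX hX).
      by case: ifP.
    rewrite X1 in XE; have w1 : w ^+ 2 = 1 /\ N ^+ j.+1 = 1.
      have w0 : 0 < w by case: (lucas_increasing j hP) => + _; rewrite wE; clear; lia.
      have : 0 < w ^+ 2 by rewrite exprn_gt0.
      by move: (w ^+ 2) XE => x XE x0; clear -XE x0 hNj; lia.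
    have Vj : lucas a%:Z N j.+1 = 2.
      have [v [v0 vE]] := lucas_nat hP (ltn0Sn j).
      have v2 : v%:Z ^+ 2 = 4 by rewrite -vE wE exprMn w1.1.
      by rewrite vE; clear -v2 v0; nia.
    have [NE [j0 _]] := lucas_term_two hP Vj.
    by case: w1 => _; rewrite NE j0.
  case: k ok kE => [|[|[|k]]] // ok kE; exfalso.
    apply: (@cubic_neq _ _ N a0 X m RealLog.lg_is_log _ hX).
      by case: hP => -[NE P0]; [left|right]; split=> //; move: P0; rewrite aE; clear; lia.
    move: kE; rewrite lucas3 aE !PoszM /cubic => kE.
    have : 2 * X%:Z = 2 * (a0%:Z * (4 * a0%:Z ^+ 2 - 3 * N)) by rewrite kE; ring.
    by clear; lia.
  have k5 : (4 < k.+4)%N by case: (k) ok.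
  by apply: (@lucas_odd_neq N a k.+4 (2 * X)%N m X hP ok k5 _ hX); [rewrite kE | right].
suff -> : s = [::] by [].
case: s us sE => // p s _ sE; have := (sE p).1; rewrite mem_head => /(_ isT)[sp pX].
have [n' sp2] := pell_solution1P sp; have [j jE] := cls _ _ _ sp2.
have : lucas a%:Z N 1 <= lucas a%:Z N j.+1 by apply: lucas_le.
by rewrite -jE -{1}k0 -kE; clear -pX; lia.
Qed.

Lemma squarefree_square_mul (d b c : nat) : squarefree d -> (d * b ^ 2 = 4 * c)%N ->
  c = 2%N \/ c = 3%N -> d = c /\ b = 2%N.
Proof.
move=> sf E hc; have [b1|[b2|b3]] : (b = 1 \/ b = 2 \/ b != 1 /\ b != 2)%N.
  by case: (b) => [|[|[|b']]]; auto.
- have : (2 ^ 2 %| d)%N by apply/dvdnP; exists c; move: E; rewrite b1; clear; lia.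
  by move/sf.
- by rewrite b2 in E *; split=> //; clear -E; lia.
case: (b) b3 E => [|[|[|b']]] [] // _ _ E; first by case: hc E => ->; rewrite muln0.
have d0 : (0 < d)%N by case: (d) E => //; case: hc => ->.
by clear -E d0 hc; nia.
Qed.

Lemma pell4_target_index (d n W Z m : nat) : (1 < d)%N -> squarefree d ->
  nth_pair (pell_solution 4 d) n W Z -> W = catalan m \/ W = central_binom m ->
  (n = 1%N \/ n = 3%N) \/
  (n = 2%N /\
   ([/\ d = 2%N, nth_pair (pell_solution 4 d) 1 2 2, W = central_binom 2 & Z = 4%N]
    \/ [/\ d = 3%N, nth_pair (pell_solution 4 d) 1 4 2, W = catalan 4 & Z = 8%N])).
Proof.
move=> hd hsf nWZ hW.
have hd' : 1 < d%:Z by [].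
have [sWZ _] := nWZ; have /pell_solution4P[n' s4] := sWZ.
have [N [a [b' [hP sa cls]]]] := pell4_lucas (or_introl erefl) hd' s4.
have [b bE] : exists b : nat, b' = b%:Z by case: (sa) => _ b0 *; exists (absz b'); clear -b0; lia.
rewrite {}bE in sa; have [k kE] := cls _ _ _ s4.
have first_pair : nth_pair (pell_solution 4 d) 1 a b.
  split; first by apply/pell_solution4P; exists N.
  exists [::]; split=> // -[x y]; split=> // -[/pell_solution4P[n1 s1] /= xa].
  have [j jE] := cls _ _ _ s1.
  have : lucas a%:Z N 1 <= lucas a%:Z N j.+1 by apply: lucas_le.
  by rewrite -jE /=; clear -xa; lia.
have idx := nth_pair_index hd hP sa cls nWZ kE.
have [ok|ek] := boolP (odd k.+1).
  left; case: k ok kE idx => [|[|[|k]]] // ok kE idx; [left|right|]; try exact: idx.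
  have k5 : (4 < k.+4)%N by case: (k) ok.
  by case: (@lucas_odd_neq N a k.+4 W m W hP ok k5 (esym kE) hW); left.
right; have [j jE] : exists j, k.+1 = (2 * j.+1)%N.
  by exists (k.+1./2).-1; have := odd_double_half k.+1; rewrite (negbTE ek); clear; lia.
have kE' := kE; rewrite jE in kE'.
have [_ _ _ E _] := sa.
case: (lucas_even_target hP (esym kE') hW) => -[j0 NE aE WE].
- have k1 : k = 1%N by move: jE; rewrite j0; clear; lia.
  have [d2 b2] : d = 2%N /\ b = 2%N.
    by apply: squarefree_square_mul hsf _ (or_introl erefl); move: E; rewrite aE NE; clear; lia.
  split; first by rewrite idx k1.
  left; split=> //.
  + by move: first_pair; rewrite aE b2.
  + have sv := pell4_double hP sa.
    rewrite -[lucas _ _ 2](_ : W%:Z = _) in sv; last by rewrite kE k1.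
    have [_] := pell4_y_unique hd' s4 sv; rewrite aE b2; clear; lia.
have k1 : k = 1%N by move: jE; rewrite j0; clear; lia.
have [d3 b2] : d = 3%N /\ b = 2%N.
  by apply: squarefree_square_mul hsf _ (or_intror erefl); move: E; rewrite aE NE; clear; lia.
split; first by rewrite idx k1.
right; split=> //.
- by move: first_pair; rewrite aE b2.
have sv := pell4_double hP sa.
rewrite -[lucas _ _ 2](_ : W%:Z = _) in sv; last by rewrite kE k1.
have [_] := pell4_y_unique hd' s4 sv; rewrite aE b2; clear; lia.
Qed.

Local Close Scope ring_scope.

Theorem theorem2 (d : nat) (hd : (1 < d)%N) (hsf : squarefree d) :
  (forall n X Y : nat,
      nth_pair (pell_solution 1 d) n X Y ->
      (exists m : nat, X = catalan m \/ X = central_binom m) ->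
      n = 1%N)
  /\
  (forall n W Z : nat,
      nth_pair (pell_solution 4 d) n W Z ->
      (exists m : nat, W = catalan m \/ W = central_binom m) ->
      (n = 1%N \/ n = 3%N)
      \/
      (n = 2%N /\
       ([/\ d = 2%N,
            nth_pair (pell_solution 4 d) 1 2 2,
            W = central_binom 2 /\ central_binom 2 = 6%N,
            Z = 4%N
          & (6%:Z ^+ 2 - 2%:Z * 4%:Z ^+ 2 = 4)%R]
        \/
        [/\ d = 3%N,
            nth_pair (pell_solution 4 d) 1 4 2,
            W = catalan 4 /\ catalan 4 = 14%N,
            Z = 8%N
          & (14%:Z ^+ 2 - 3%:Z * 8%:Z ^+ 2 = 4)%R]))).
Proof.
split=> [n X Y nXY [m hX]|n W Z nWZ [m hW]]; first exact: pell1_target_index nXY hX.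
have [n13|[n2 h]] := pell4_target_index hd hsf nWZ hW; first by left.
right; split=> //; case: h => -[dE first_pair WE ZE]; [left | right]; split=> //.
Qed.
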